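(* Let $G$ be a map on a surface $S$ (not necessarily irreducible) and let $F$ be an irreducible face of $G$. Then one may replace the interior of $F$ by new vertices, edges and faces so as to obtain a new map $G'$ on $S$ such that all the new faces are $3$-faces, all the new edges are noncontractible in $G'$, and the interior of the union of the new vertices, edges and faces is simply connected.
   Context: A surface is a compact two-dimensional manifold (without boundary). All graphs are simple (no loops or multiple edges). A map on $S$ is a connected simple graph embedded in $S$ such that every face (connected component of the complement of the graph) is homeomorphic to an open disk. A face whose boundary walk traverses edges $v_1v_2,\dots,v_mv_1$ is denoted $v_1\cdots v_m$ (vertices need not be distinct, subscripts mod $m$) and has size $m$; a face of size $3$ is a $3$-face and a face of size $m\ge4$ is large. A large face $v_1\cdots v_m$ is irreducible if $v_i$ and $v_{i+2}$ are adjacent for every $i$. If $v_1v_2,v_2v_3,v_3v_1$ are edges, their union is the $3$-cycle $v_1v_2v_3$. An edge is noncontractible if at least one $3$-cycle containing it is not (the boundary of) a $3$-face. *)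

(* Defs.v *)
From HB Require Import structures.
From mathcomp Require Import all_boot all_order all_algebra.
From mathcomp Require Import all_classical all_reals all_analysis.
From Stdlib Require Relation_Operators.

Set Implicit Arguments.
Unset Strict Implicit.
Unset Printing Implicit Defensive.

Import Order.TTheory GRing.Theory Num.Theory.
Import numFieldNormedType.Exports.

Local Open Scope classical_set_scope.
Local Open Scope ring_scope.

Definition homeomorphism (T U : topologicalType) (A : set T) (B : set U)
    (f : T -> U) : Prop :=
  [/\ set_bij A B f,
      {within A, continuous f} &
      exists2 g : U -> T,
        {within B, continuous g} & forall x, A x -> g (f x) = x].

Definition homeomorphic (T U : topologicalType) (A : set T) (B : set U) :
    Prop :=
  exists f : T -> U, homeomorphism A B f.

(* The plane is [R * R]; its topology is the product topology. *)
Definition open_disk (R : realType) : set (R * R) :=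
  [set p | p.1 ^+ 2 + p.2 ^+ 2 < 1].

Definition closed_disk (R : realType) : set (R * R) :=
  [set p | p.1 ^+ 2 + p.2 ^+ 2 <= 1].

Arguments open_disk R : clear implicits.
Arguments closed_disk R : clear implicits.

Definition circle_point (R : realType) (t : R) : R * R :=
  (cos (2 * pi * t), sin (2 * pi * t)).

(* Second countability is not required separately: it follows from compactness
   and the existence of charts. Connectedness is not required either. *)
Definition surface (R : realType) (S : topologicalType) : Prop :=
  [/\ hausdorff_space S,
      compact [set: S] &
      forall x : S, exists U : set S,
        [/\ open U, U x & homeomorphic (open_disk R) U]].

Definition unit_interval (R : realType) : set R := `[0, 1].
Arguments unit_interval R : clear implicits.

Definition path_in (R : realType) (T : topologicalType) (A : set T)
    (c : R -> T) : Prop :=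
  {within unit_interval R, continuous c} /\
  forall s, unit_interval R s -> A (c s).

Definition path_connected (R : realType) (T : topologicalType) (A : set T) :
    Prop :=
  forall x y, A x -> A y ->
    exists c : R -> T, [/\ path_in A c, c 0 = x & c 1 = y].

Definition null_homotopic (R : realType) (T : topologicalType) (A : set T)
    (c : R -> T) : Prop :=
  exists H : R * R -> T,
    [/\ {within unit_interval R `*` unit_interval R, continuous H},
        forall s t, unit_interval R s -> unit_interval R t -> A (H (s, t)),
        forall s, unit_interval R s -> H (s, 0) = c s,
        forall s, unit_interval R s -> H (s, 1) = c 0 &
        forall t, unit_interval R t -> H (0, t) = c 0 /\ H (1, t) = c 0].

Definition simply_connected (R : realType) (T : topologicalType) (A : set T) :
    Prop :=
  [/\ A !=set0,
      path_connected R A &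
      forall c : R -> T, path_in A c -> c 0 = c 1 -> null_homotopic A c].

(* A graph drawn on [S]: a vertex is a point, an edge is the set of points of a
   closed arc (endpoints included). *)
Record drawing (S : Type) := Drawing {
  vertices : set S;
  edges : set (set S) }.

(* As [t] runs from [a] to [b], [c] runs once along [e] from [u] to [v]; in a
   Hausdorff space [c] is then a homeomorphism of [a, b] onto [e]. *)
Definition runs_along (R : realType) (S : topologicalType) (a b : R)
    (c : R -> S) (e : set S) (u v : S) : Prop :=
  [/\ {within `[a, b], continuous c},
      set_inj `[a, b] c,
      c @` `[a, b] = e,
      c a = u & c b = v].

Definition joins (R : realType) (S : topologicalType) (e : set S) (u v : S) :
    Prop :=
  exists c : R -> S, runs_along 0 1 c e u v.

Definition adjacent (R : realType) (S : topologicalType) (G : drawing S)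
    (u v : S) : Prop :=
  exists2 e, edges G e & joins R e u v.

(* Loops are excluded because [joins e u v] forces [u != v]. *)
Definition embedded_simple_graph (R : realType) (S : topologicalType)
    (G : drawing S) : Prop :=
  [/\ finite_set (vertices G),
      finite_set (edges G),
      forall e, edges G e ->
        exists u v, joins R e u v /\ e `&` vertices G = [set u; v],
      forall e e', edges G e -> edges G e' -> e <> e' ->
        e `&` e' `<=` vertices G &
      forall e e' u v, edges G e -> edges G e' ->
        joins R e u v -> joins R e' u v -> e = e'].

Definition connected_graph (R : realType) (S : topologicalType)
    (G : drawing S) : Prop :=
  vertices G !=set0 /\
  forall u v, vertices G u -> vertices G v ->
    Relation_Operators.clos_refl_trans S (adjacent R G) u v.

Definition graph_points (S : Type) (G : drawing S) : set S :=
  vertices G `|` \bigcup_(e in edges G) e.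

Definition face (S : topologicalType) (G : drawing S) (F : set S) : Prop :=
  exists2 x, (~` graph_points G) x &
    F = connected_component (~` graph_points G) x.

Definition is_map (R : realType) (S : topologicalType) (G : drawing S) : Prop :=
  [/\ embedded_simple_graph R G,
      connected_graph R G &
      forall F, face G F -> homeomorphic (open_disk R) F].

(* [F] is the face v_1 ... v_m, where [vs] lists the v_i: going once around the
   boundary of a closed disk whose interior is identified with [F], one runs
   successively along edges v_1 v_2, ..., v_m v_1. Vertices and edges may be
   repeated. The edge v_i v_(i+1) is determined by its ends. *)
Definition boundary_walk (R : realType) (S : topologicalType) (G : drawing S)
    (F : set S) (vs : seq S) : Prop :=
  exists (phi : R * R -> S) (t : nat -> R),
    [/\ {within closed_disk R, continuous phi},
        homeomorphism (open_disk R) F phi,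
        t 0%N = 0 /\ t (size vs) = 1,
        forall i, (i < size vs)%N -> t i < t i.+1 &
        forall (x0 : S) (i : nat), (i < size vs)%N ->
          exists2 e, edges G e &
            runs_along (t i) (t i.+1) (phi \o @circle_point R) e
              (nth x0 vs i) (nth x0 vs (i.+1 %% size vs)%N)].

Definition three_face (R : realType) (S : topologicalType) (G : drawing S)
    (F : set S) : Prop :=
  face G F /\ exists2 vs, boundary_walk R G F vs & size vs = 3%N.

Definition irreducible_face (R : realType) (S : topologicalType)
    (G : drawing S) (F : set S) : Prop :=
  face G F /\
  exists vs, [/\ boundary_walk R G F vs,
    (4 <= size vs)%N &
    forall (x0 : S) (i : nat), (i < size vs)%N ->
      adjacent R G (nth x0 vs i) (nth x0 vs ((i + 2) %% size vs)%N)].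

Definition three_cycle (R : realType) (S : topologicalType) (G : drawing S)
    (v1 v2 v3 : S) : Prop :=
  [/\ adjacent R G v1 v2, adjacent R G v2 v3 & adjacent R G v3 v1].

(* In a simple graph a 3-cycle is determined by its three vertices, so the
   starting point and direction of the boundary walk are irrelevant. *)
Definition bounds_three_face (R : realType) (S : topologicalType)
    (G : drawing S) (v1 v2 v3 : S) : Prop :=
  exists F vs,
    [/\ face G F, boundary_walk R G F vs & perm_eq vs [:: v1; v2; v3]].

(* [three_cycle] is invariant under permutation, so the given edge may be taken
   to be v1 v2. *)
Definition noncontractible (R : realType) (S : topologicalType) (G : drawing S)
    (e : set S) : Prop :=
  exists v1 v2 v3, [/\ joins R e v1 v2, three_cycle R G v1 v2 v3 &
    ~ bounds_three_face R G v1 v2 v3].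

Definition new_vertices (S : topologicalType) (G G' : drawing S) : set S :=
  vertices G' `\` vertices G.

Definition new_edges (S : topologicalType) (G G' : drawing S) : set (set S) :=
  edges G' `\` edges G.

Definition new_faces (S : topologicalType) (G G' : drawing S) : set (set S) :=
  face G' `\` face G.

(* [G'] keeps all vertices, edges and faces of [G] except the face [F]; whatever
   is new lies in [F], except that new edges may end at old vertices. *)
Definition replaces_interior (S : topologicalType) (G : drawing S) (F : set S)
    (G' : drawing S) : Prop :=
  [/\ vertices G `<=` vertices G' /\ edges G `<=` edges G',
      forall H, face G H -> (face G' H <-> H <> F),
      new_vertices G G' `<=` F,
      forall e, new_edges G G' e -> e `\` vertices G `<=` F &
      forall H, new_faces G G' H -> H `<=` F].

Definition new_part (S : topologicalType) (G G' : drawing S) : set S :=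
  new_vertices G G' `|` \bigcup_(e in new_edges G G') e
    `|` \bigcup_(H in new_faces G G') H.

(* Main.v *)
(** The filling is found combinatorially. A new vertex [c] is joined to one
    occurrence of every vertex of the walk of [F]: the first one, after a
    rotation making v_1 <> v_4 (if no rotation does, the walk is v_1 v_2 v_3
    repeated, and positions 1, 3, 5 are used instead). Between consecutive
    chosen positions a polygon c u_0 ... u_r remains, all of whose vertices are
    already joined to [c]; it is filled by new vertices d_1, d_2, ..., each
    joined to [c], to its predecessor and to a maximal run of distinct u_i,
    each run starting where the previous one ends. Then
    c d_j u_i, u_i u_(i+2) d_j, d_j d_(j+1) u_i and c v_i v_(i+2) provide enough
    3-cycles which are not faces, the edges u_i u_(i+2) and v_i v_(i+2) being
    given by irreducibility.

    Topologically, the filling is made of two kinds of steps, which cut a face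
    along an arc joining two positions of its boundary walk, with or without a
    new vertex on the arc. After an angular reparametrization of the disk of
    the face the arc is a diameter, and a half disk is a disk again by an
    affine map on each vertical fibre. A vertex of the map lies in the closure
    of a face exactly when it is on its walk, so that 3-cycles can be shown not
    to bound a face by looking at the walks only. *)

From HB Require Import structures.
From mathcomp Require Import all_boot all_order all_algebra.
From mathcomp Require Import all_classical all_reals all_analysis.
From mathcomp Require Import zify ring lra.
From Stdlib Require Relation_Operators Operators_Properties.
Require Import Defs.

Set Implicit Arguments.
Unset Strict Implicit.
Unset Printing Implicit Defensive.

(** * Filling a polygon *)

(** The walk of a face may repeat vertices, while the graph has to stay simple: no vertex may be
    joined twice to [c], nor twice to the same [d_j]. This forces first occurrences around [c] and
    runs of distinct corners inside a gap. Runs are taken maximal because the corner that stops a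
    run is already joined to the [d_j] of that run, and so closes a 3-cycle with the edge from [d_j]
    to [d_(j+1)]. Every new edge has an end in the open set [F]. Hence it cannot repeat an edge of
    the original graph, and a 3-cycle through it cannot bound an old face, whose closure misses [F].
    Only the new faces have to be inspected, by membership in their walks. The combinatorial half is
    therefore carried out for an abstract predicate [P] closed under rotation of a walk and two
    kinds of cuts, and all that topology owes to it is that these cuts exist. *)

Lemma nth_rot (T : Type) (x0 : T) k s i : k <= size s -> i < size s ->
  nth x0 (rot k s) i = nth x0 s ((k + i) %% size s).
Proof.
move=> ks im; rewrite /rot nth_cat size_drop nth_drop.
case: ltnP => h; first by rewrite modn_small //; lia.
rewrite nth_take; last by lia.
have -> : k + i = (i - (size s - k)) + size s by lia.
by rewrite modnDr modn_small //; lia.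
Qed.

Section Fillings.

Variables (T : eqType) (adj : T -> T -> Prop) (new : T -> Prop).
(* [P L es Ws]: the face can be subdivided so that the new edges have the ends
   listed in [es] (the first one being a new vertex) and the faces in it have the
   boundary walks [Ws]; [L] lists the labels in use. *)
Variable P : seq T -> seq (T * T) -> seq (seq T) -> Prop.

Hypothesis adj_sym : forall x y, adj x y -> adj y x.
Hypothesis adj_neq : forall x y, adj x y -> x != y.
Hypothesis P_rot : forall L es W1 w W2 k,
  P L es (W1 ++ w :: W2) -> P L es (W1 ++ rot k w :: W2).
(** [p] and [q] may be empty; with [p] empty, a triangle is cut off along the edge from [a] to
    [b]. *)
Hypothesis P_cone : forall L es W1 a p b q W2,
  P L es (W1 ++ (a :: p ++ b :: q) :: W2) -> a != b ->
  exists x, [/\ x \notin L, new x &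
    P (x :: L) [:: (x, a), (x, b) & es]
      (W1 ++ [:: a :: p ++ [:: b; x], [:: a, x, b & q] & W2])].
(** An edge of the original graph cannot end at a vertex inside the face, so for a new vertex [a]
    absence from [es] is all that simplicity asks. *)
Hypothesis P_chord : forall L es W1 a p b q W2,
  P L es (W1 ++ (a :: p ++ b :: q) :: W2) -> new a -> a != b ->
  (a, b) \notin es -> (b, a) \notin es ->
  P L ((a, b) :: es) (W1 ++ [:: a :: p ++ [:: b], [:: a, b & q] & W2]).
Hypothesis P_face_sub : forall L es Ws w,
  P L es Ws -> w \in Ws -> {subset w <= L}.
Hypothesis P_edge_sub : forall L es Ws e,
  P L es Ws -> e \in es -> e.1 \in L /\ e.2 \in L.

Definition linked (es : seq (T * T)) (x y : T) :=
  [\/ adj x y, (x, y) \in es | (y, x) \in es].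

(** [Ws] lists the faces inside the subdivided face only. The others are excluded by topology, the
    first end of every listed edge being a new vertex. *)
Definition certified (es : seq (T * T)) (Ws : seq (seq T)) (e : T * T) :=
  exists z, [/\ linked es e.1 z, linked es e.2 z &
    forall w, w \in Ws -> e.1 \in w -> e.2 \in w -> z \in w -> False].

(** Irreducibility without wrap-around, so that it passes to any stretch of a walk. *)
Definition close_adjacent (s : seq T) := forall x0 i,
  (i.+1 < size s -> adj (nth x0 s i) (nth x0 s i.+1)) /\
  (i.+2 < size s -> adj (nth x0 s i) (nth x0 s i.+2)).

Lemma close_adjacent_infix s1 s2 s3 :
  close_adjacent (s1 ++ s2 ++ s3) -> close_adjacent s2.
Proof.
move=> h x0 i; have [h1 h2] := h x0 (size s1 + i).
have nthE j : j < size s2 -> nth x0 (s1 ++ s2 ++ s3) (size s1 + j) = nth x0 s2 j.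
  by move=> ji; rewrite nth_cat ltnNge leq_addr /= addKn nth_cat ji.
split=> hi; [move: h1|move: h2]; rewrite -!addnS !nthE ?size_cat; try lia;
  by apply; lia.
Qed.

Lemma linked_sym es x y : linked es x y -> linked es y x.
Proof. by case=> h; [apply: Or31; exact: adj_sym|apply: Or33|apply: Or32]. Qed.

Lemma linked_sub es es' x y :
  {subset es <= es'} -> linked es x y -> linked es' x y.
Proof. by move=> h []; [exact: Or31|move/h; exact: Or32|move/h; exact: Or33]. Qed.

(** * Fans of triangles and runs of distinct corners *)

Definition fan (d u : T) (xs : seq T) : seq (seq T) :=
  pairmap (fun a b => [:: d; a; b]) u xs.

Lemma fanP d u xs w : w \in fan d u xs ->
  exists s1 a b s2, u :: xs = s1 ++ a :: b :: s2 /\ w = [:: d; a; b].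
Proof.
elim: xs u => [//|x xs IH] u; rewrite /= inE => /orP[/eqP->|].
  by exists [::], u, x, xs.
by move=> /IH [s1 [a [b [s2 [-> ->]]]]]; exists (u :: s1), a, b, s2.
Qed.

(** Used contrapositively: two corners two places apart in [u :: xs] never share a fan triangle, so
    an edge between them closes a nonfacial 3-cycle with the apex. *)
Lemma fan_index d u xs w x y : uniq (u :: xs) -> w \in fan d u xs ->
  x \in w -> y \in w -> x != d -> y != d ->
  index x (u :: xs) <= (index y (u :: xs)).+1.
Proof.
move=> uxs /fanP[s1 [a [b [s2 [E ->]]]]]; rewrite {}E in uxs *.
move: uxs; rewrite cat_uniq /= !inE !negb_or.
move=> /and3P[_ /and3P[as1 bs1 _] /andP[/andP[ab _] _]].
have ia : index a (s1 ++ [:: a, b & s2]) = size s1.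
  by rewrite index_cat (negbTE as1) /= eqxx addn0.
have ib : index b (s1 ++ [:: a, b & s2]) = (size s1).+1.
  by rewrite index_cat (negbTE bs1) /= (negbTE ab) eqxx addn1.
by move=> /or3P[]/eqP-> /or3P[]/eqP->; rewrite ?eqxx// => _ _; rewrite ?ia ?ib; lia.
Qed.

Lemma fan_mem d u xs w x : w \in fan d u xs -> x \in w -> x = d \/ x \in u :: xs.
Proof.
move=> /fanP[s1 [a [b [s2 [-> ->]]]]]; rewrite !inE => /or3P[]/eqP->; [by left| |];
by right; rewrite mem_cat !inE eqxx !orbT.
Qed.

Lemma fan_apex d u xs w : w \in fan d u xs -> size w = 3 /\ d \in w.
Proof. by move=> /fanP[s1 [a [b [s2 [_ ->]]]]]; rewrite inE eqxx. Qed.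

(** Each chord at [d] cuts off a triangle [d u x] and puts [x] in the role of [u]. Chords start at
    the head of a walk, so the face is rotated to begin with [d] and then rotated back. The edges
    come out reversed because each is put in front of the list. *)
Lemma P_fan xs L es W1 W2 c d u rest :
  P L es (W1 ++ [:: c, d, u & xs ++ rest] :: W2) -> new d ->
  d \notin xs -> uniq xs ->
  (forall x, x \in xs -> (d, x) \notin es /\ (x, d) \notin es) ->
  P L ([seq (d, x) | x <- rev xs] ++ es)
    (W1 ++ fan d u xs ++ [:: c, d, last u xs & rest] :: W2).
Proof.
elim: xs es W1 u => [//|x xs IH] es W1 u HP dnew.
rewrite inE negb_or => /andP[dx dxs] /andP[xxs xsu] hes.
have [e1 e2] := hes x (mem_head _ _).
have := @P_rot _ _ _ _ _ 1 HP; rewrite rot1_cons rcons_cons => HP1.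
have HP2 := @P_chord L es W1 d [:: u] x (rcons (xs ++ rest) c) W2 HP1 dnew dx e1 e2.
have := @P_rot L _ (W1 ++ [:: [:: d; u; x]]) (rcons [:: d, x & xs ++ rest] c) W2
   (size [:: d, x & xs ++ rest]).
rewrite -cats1 rot_size_cat -!catA /= cats1 => /(_ _ HP2) HP3.
have := IH ((d, x) :: es) (W1 ++ [:: [:: d; u; x]]) x.
rewrite -!catA /= => /(_ HP3 dnew dxs xsu) {}IH.
rewrite rev_cons map_rcons cat_rcons; apply: IH => y yxs.
have [e3 e4] := hes y (mem_behead (s := x :: xs) yxs).
rewrite !inE !negb_or e3 e4 !andbT /= !xpair_eqE eqxx /=.
have yx : y != x by apply: contraNneq xxs => <-.
by rewrite yx negb_and eq_sym dx orbT.
Qed.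

Lemma max_run (acc us : seq T) : uniq acc -> exists xs rest,
  [/\ us = xs ++ rest, uniq (acc ++ xs) &
      rest = [::] \/ exists y r, rest = y :: r /\ y \in acc ++ xs].
Proof.
elim: us acc => [|y us IH] acc ua.
  by exists [::], [::]; rewrite !cats0; split=> //; left.
have [yacc|yacc] := boolP (y \in acc).
  by exists [::], (y :: us); rewrite cats0; split=> //; right; exists y, us.
have [|xs [rest [-> uxs hr]]] := IH (rcons acc y).
  by rewrite rcons_uniq yacc ua.
by exists (y :: xs), rest; rewrite -cat_rcons.
Qed.

(* The finished faces and the edges at [d] when its run starts at [u]; [op] is
   the vertex whose run ended at [u], if any. *)
Definition previous_faces (c d u : T) (op : option T) : seq (seq T) :=
  if op is Some p then [:: [:: d; c; p]; [:: d; p; u]] else [:: [:: c; u; d]].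

Definition first_edges (c d u : T) (op : option T) : seq (T * T) :=
  [:: (d, c), (d, u) & if op is Some p then [:: (d, p)] else [::]].

Lemma in_seq3 (x a b c : T) : x \in [:: a; b; c] -> [\/ x = a, x = b | x = c].
Proof.
by rewrite !inE => /or3P[]/eqP->; [apply: Or31|apply: Or32|apply: Or33].
Qed.

Ltac mem3 := repeat (case/in_seq3=> ?); congruence.

(** An edge at [d] can be certified only when all faces at [d] are known. The certificates of the
    edges present when the round of [d] starts ([first_edges]) are therefore postponed to this
    lemma, and the faces already finished at [d] are carried along as [previous_faces]. The link
    from [p] to the next corner gives the edge from [d] to [p] its third vertex; in the first round,
    two corners after [u] are needed instead. The induction is on a bound for the length, since each
    round consumes at least one corner. *)
Lemma run_filling n L es W1 W2 c d u us op :
  size us <= n ->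
  P L es (W1 ++ [:: c, d, u & us] :: W2) -> new d ->
  uniq [:: c; d; u] -> c \notin us -> d \notin us -> 0 < size us ->
  close_adjacent (u :: us) ->
  (forall x, x \in u :: us -> linked es c x) ->
  {subset first_edges c d u op <= es} ->
  (forall e, e \in es -> e.1 = d \/ e.2 = d -> e \in first_edges c d u op) ->
  (if op is Some p then
     [/\ p \in L, p \notin [:: c, d, u & us] & linked es p (head u us)]
   else 1 < size us) ->
  exists L' es' Ds,
    [/\ P L' (es' ++ es) (W1 ++ Ds ++ W2), {subset L <= L'},
      forall w, w \in Ds -> [/\ size w = 3,
        exists2 x, x \in w & x = d \/ x \notin L &
        forall x, x \in w -> x \in [:: c, d, u & us] \/ x \notin L],
      forall e, e \in es' -> e.1 = d \/ e.1 \notin L &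
      forall e, e \in first_edges c d u op ++ es' ->
        certified (es' ++ es) (previous_faces c d u op ++ Ds) e].
Proof.
elim: n L es W1 W2 d u us op => [|n IH] L es W1 W2 d u us op.
  by case: us.
move=> szn HP dnew ucdu.
have [cd cu du] : [/\ c != d, c != u & d != u].
  by move: ucdu; rewrite /= !inE !negb_or andbT => /andP[/andP[]].
move=> cus dus us0 adjus linkc fe_sub fe_all hop.
have us_sub : {subset [:: c, d, u & us] <= L}.
  by apply: (P_face_sub HP); rewrite mem_cat inE eqxx orbT.
have [xs [rest [usE uxs hrest]]] := @max_run [:: u] us isT.
have adj1 : adj u (nth u us 0) by have [h _] := adjus u 0; apply: h.
have xs0 : 0 < size xs.
  case: (posnP (size xs)) => // /size0nil xs0; move: hrest us0 adj1.
  rewrite usE xs0 /= => -[->//|[y [r [-> yu]]]] _ /= /adj_neq.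
  by move: yu; rewrite mem_seq1 eq_sym => ->.
(* Corners one or two places apart are adjacent, hence distinct, so a run contains the next two
   corners if there are two. *)
have xs1 : 1 < size us -> 1 < size xs.
  move=> us1; case: hrest => [r0|[y [r [rE yin]]]].
    by move: us1; rewrite usE r0 cats0.
  case: xs xs0 usE uxs yin {hop} => [//|x1 [|//]] _ usE uxs.
  have [_ h2] := adjus u 0; have [h1 _] := adjus u 1.
  move: h1 h2; rewrite usE rE /= => /(_ isT)/adj_neq n1 /(_ isT)/adj_neq n2.
  by rewrite !inE !(eq_sym y) (negbTE n1) (negbTE n2).
have uxs' : uniq (u :: xs) by [].
have xs_us : {subset xs <= us} by move=> x xx; rewrite usE mem_cat xx.
have rest_us : {subset rest <= us} by move=> x xx; rewrite usE mem_cat xx orbT.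
have dxs : d \notin xs by apply: contra dus => /xs_us.
have cxs : c \notin xs by apply: contra cus => /xs_us.
have pus p : op = Some p -> [/\ p != c, p != d, p != u, p \notin us & p \in L].
  by move=> opE; move: hop; rewrite opE !inE !negb_or => -[? /and4P[]].
have fresh x : x \in xs -> (d, x) \notin es /\ (x, d) \notin es.
  move=> xx; have xus := xs_us _ xx.
  have xc : x != c by apply: contraNneq cus => <-.
  have xd : x != d by apply: contraNneq dus => <-.
  have xu : x != u by move: uxs'; rewrite /=; case/andP=> + _; apply: contraNneq => <-.
  have xp p : op = Some p -> x != p.
    by move=> /pus[_ _ _ + _]; apply: contraNneq => <-.
  split; apply/negP => /fe_all; rewrite /first_edges !inE !xpair_eqE.
    move=> /(_ (or_introl erefl)); rewrite eqxx (negbTE xc) (negbTE xu) /=.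
    case: (op) xp => [p|]//= /(_ _ erefl) xp; by rewrite inE xpair_eqE (negbTE xp) andbF.
  move=> /(_ (or_intror erefl)); rewrite (negbTE xd) /=.
  by case: (op) => [p|]//=; rewrite inE xpair_eqE (negbTE xd).
have := @P_fan xs L es W1 W2 c d u rest; rewrite -usE.
move=> /(_ HP dnew dxs); have /andP[uxs1 uxs2] := uxs'; move=> /(_ uxs2 fresh).
set es1 := _ ++ es; set xl := last u xs => HP1.
have es1P x : x \in xs -> (d, x) \in es1.
  by move=> xx; rewrite mem_cat map_f // mem_rev.
have es1es : {subset es <= es1} by move=> e ee; rewrite mem_cat ee orbT.
have xlxs : xl \in xs by rewrite /xl; case: (xs) xs0 => //= a l _; exact: mem_last.
have [x1 x1E] : exists x1, x1 = head u xs by eexists.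
have x1xs : x1 \in xs by rewrite x1E; case: (xs) xs0 => //= a l _; exact: mem_head.
have hus : head u us = x1 by rewrite x1E usE; case: (xs) xs0.
have neqN x y : x != y -> x <> y by move/eqP.
have xlc : xl <> c by apply/eqP; apply: contraNneq cxs => <-.
have xld : xl <> d by apply/eqP; apply: contraNneq dxs => <-.
have xlu : xl <> u by apply/eqP; apply: contraNneq uxs1 => <-.
have x1c : x1 <> c by apply/eqP; apply: contraNneq cxs => <-.
have x1d : x1 <> d by apply/eqP; apply: contraNneq dxs => <-.
have x1u : x1 <> u by apply/eqP; apply: contraNneq uxs1 => <-.
move/neqN in cd; move/neqN in cu; move/neqN in du.
have pxs p : op = Some p -> [/\ p <> c, p <> d, p <> u, p <> x1 & p <> xl].
  move=> /pus[/eqP ? /eqP ? /eqP ? pus' _]; split=> //; apply/eqP;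
  by apply: contraNneq pus' => ->; exact: xs_us.
have fan_c w : w \in fan d u xs -> c \in w -> False.
  by move=> /fan_mem /[apply] -[//|]; rewrite inE (negbTE cxs) => /orP[/eqP|].
have fan_p p w : op = Some p -> w \in fan d u xs -> p \in w -> False.
  move=> /[dup]/pxs[_ ? ? _ _] /pus[_ _ _ pus' _] /fan_mem /[apply] -[//|].
  by rewrite inE => /orP[/eqP//|/xs_us]; apply/negP.
(* The finished faces at [d] for both endings of the round: [c d xl] closes the polygon, while [d']
   stands for the next new vertex when there is one. *)
pose dface w := [\/ w \in previous_faces c d u op, w \in fan d u xs,
  w = [:: c; d; xl] |
  exists2 d', d' \notin L & w = [:: d'; c; d] \/ w = [:: d'; d; xl]].
(* All edges at [d] except the one to [xl], whose certificate depends on how the round ends. *)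
have cert_d es' Ds e : {subset es1 <= es'} ->
    (forall w, w \in Ds -> d \in w -> dface w) ->
    e \in first_edges c d u op ++ [seq (d, x) | x <- xs] ->
    e <> (d, xl) -> certified es' Ds e.
  move=> es1' dDs.
  have link1 := linked_sub es1'; have link0 := linked_sub es1es.
  have face_d z x : linked es' d z -> linked es' x z ->
      (forall w, dface w -> d \in w -> x \in w -> z \in w -> False) ->
      certified es' Ds (d, x).
    by move=> h1 h2 h3; exists z; split=> //= w wD dw; apply: h3 (dDs _ wD dw) dw.
  have ld x : x \in xs -> linked es' d x.
    by move=> xx; apply: Or32; apply: es1'; apply: es1P.
  have ldu : linked es' d u.
    by apply: Or32; apply: es1'; apply: es1es; apply: fe_sub; rewrite !inE eqxx orbT.
  have ldc : linked es' d c.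
    by apply: Or32; apply: es1'; apply: es1es; apply: fe_sub; rewrite !inE eqxx.
  have lc x : x \in u :: us -> linked es' c x.
    by move=> /linkc/link0; apply: link1.
  have outL x d' : x \in [:: c, d, u & us] -> d' \notin L -> x <> d'.
    by move=> /us_sub + + xE; rewrite xE => ->.
  have cL := outL c _ (mem_head _ _).
  have uL : forall d', d' \notin L -> u <> d' by move=> d'; apply: outL; rewrite !inE eqxx !orbT.
  have xsL x : x \in xs -> forall d', d' \notin L -> x <> d'.
    by move=> /xs_us xx d'; apply: outL; rewrite !inE xx !orbT.
  have pL p : op = Some p -> forall d', d' \notin L -> p <> d'.
    by move=> /pus[_ _ _ _ +] d' + pE; rewrite pE => ->.
  (* For a corner of the run other than [xl] the third vertex is [c]: no face contains [c], [d] and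
     such a corner. *)
  rewrite mem_cat => /orP[|/mapP[x xx -> exl]]; last first.
    have xl' : x <> xl by move=> xE; apply: exl; rewrite xE.
    have xc : x <> c by apply/eqP; apply: contraNneq cxs => <-.
    have xd : x <> d by apply/eqP; apply: contraNneq dxs => <-.
    have xu : x <> u by apply/eqP; apply: contraNneq uxs1 => <-.
    have xp p : op = Some p -> x <> p.
      move=> /pus[_ _ _ pus' _] xp; move: pus'; by rewrite -xp xs_us.
    apply: (face_d c) => //.
      by apply: linked_sym; apply: lc; rewrite inE xs_us ?orbT.
    move=> w [|+ _ _|->|[d' /[dup]/cL cd' /(xsL _ xx) xd' [] ->]]; last 3 first.
    - mem3.
    - mem3.
    - mem3.
    - rewrite /previous_faces; case: (op) xp pxs => [p /(_ _ erefl) ? /(_ _ erefl)[? ? ? ? ?]|_ _].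
        by rewrite !inE => /orP[]/eqP->; mem3.
      by rewrite inE => /eqP->; mem3.
    - exact: fan_c.
  (* Third vertices: for the edge to [c], it is [u] if there is a predecessor and [x1] otherwise;
     for the edge to [u], it is [c], respectively the corner two places after [u]; for the edge to
     [p], it is [x1]. *)
  rewrite /first_edges !inE => /or3P[/eqP->|/eqP->|ein] _.
  - case opE : op hop => [p|] hop.
    + have [? ? ? ? ?] := pxs _ opE.
      apply: (face_d u) => //; first by apply: lc; exact: mem_head.
      rewrite /dface opE; move=> w [|+ _ + _|->|[d' /[dup]/cL cd' /uL ud' [] ->]].
      * by rewrite !inE => /orP[]/eqP->; mem3.
      * exact: fan_c.
      * mem3.
      * mem3.
      * mem3.
    + have x1xl : x1 <> xl.
        rewrite x1E /xl; case: (xs) (xs1 hop) uxs2 => [|a [|b l]]//= _ /andP[al _] aE.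
        by move: al; rewrite aE mem_last.
      apply: (face_d x1); [exact: ld| |].
        by apply: lc; rewrite inE xs_us ?orbT.
      rewrite /dface opE; move=> w [|+ _ + _|->|[d' /[dup]/cL cd' /(xsL _ x1xs) ud' [] ->]].
      * by rewrite !inE => /eqP->; mem3.
      * exact: fan_c.
      * mem3.
      * mem3.
      * mem3.
  - case opE : op hop => [p|] hop.
    + have [? ? ? ? ?] := pxs _ opE.
      apply: (face_d c) => //; first by apply: linked_sym; apply: lc; exact: mem_head.
      rewrite /dface opE; move=> w [|+ _ _|->|[d' /[dup]/cL cd' /uL ud' [] ->]].
      * by rewrite !inE => /orP[]/eqP->; mem3.
      * exact: fan_c.
      * mem3.
      * mem3.
      * mem3.
    + have szxs := xs1 hop.
      have x2xs : nth u xs 1 \in xs by rewrite mem_nth.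
      have x2c : nth u xs 1 <> c by apply/eqP; apply: contraNneq cxs => <-.
      have x2d : nth u xs 1 <> d by apply/eqP; apply: contraNneq dxs => <-.
      have x2u : nth u xs 1 <> u by apply/eqP; apply: contraNneq uxs1 => <-.
      apply: (face_d (nth u xs 1)); first exact: ld.
        apply: Or31; have [_] := adjus u 0; rewrite /= usE nth_cat szxs; apply.
        by rewrite size_cat; clear -szxs; lia.
      rewrite /dface opE; move=> w [|wf _ uw x2w|->|[d' /[dup]/cL cd' /uL ud' [] ->]].
      * by rewrite !inE => /eqP->; mem3.
      * have := fan_index uxs' wf x2w uw (introN eqP x2d) (introN eqP (nesym du)).
        rewrite (_ : index (nth u xs 1) _ = 2); first by rewrite /= eqxx.
        by have := @index_uniq _ u 2 (u :: xs) _ uxs'; apply.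
      * mem3.
      * mem3.
      * mem3.
  - case opE : op hop ein => [p|] hop //.
    rewrite mem_seq1 => /eqP->.
    have [? ? ? ? ?] := pxs _ opE.
    apply: (face_d x1); first exact: ld.
      by apply: link1; apply: link0; case: hop => _ _; rewrite hus.
    rewrite /dface opE; move=> w [|+ _ + _|->|[d' /[dup]/(pL _ opE) cd' /(xsL _ x1xs) ud' [] ->]].
    + by rewrite !inE => /orP[]/eqP->; mem3.
    + by apply: (fan_p _ _ opE).
    + mem3.
    + mem3.
    + mem3.
have prevL w : w \in previous_faces c d u op -> {subset w <= L}.
  have [cL dL uL] : [/\ c \in L, d \in L & u \in L].
    by split; apply: us_sub; rewrite !inE eqxx ?orbT.
  rewrite /previous_faces; case opE : op => [p|]; rewrite !inE.
    have [_ _ _ _ pL] := pus _ opE.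
    by move=> /orP[]/eqP-> x; rewrite !inE => /or3P[]/eqP->.
  by move=> /eqP-> x; rewrite !inE => /or3P[]/eqP->.
have prev_xl w : w \in previous_faces c d u op -> xl \in w -> False.
  rewrite /previous_faces; case opE : op => [p|]; rewrite !inE.
    by have [? ? ? ? ?] := pxs _ opE; move=> /orP[]/eqP->; mem3.
  by move=> /eqP->; mem3.
have fanL w x : w \in fan d u xs -> x \in w -> x \in [:: c, d, u & us].
  move=> /fan_mem /[apply] -[->|]; rewrite !inE ?eqxx ?orbT//.
  by move=> /orP[->|/xs_us ->]; rewrite ?orbT.
case: hrest => [rest0|[y [r [restE yin]]]].
  exists L, [seq (d, x) | x <- rev xs], (fan d u xs ++ [:: [:: c; d; xl]]).
  split=> //.
  - by rewrite -catA /=; move: HP1; rewrite rest0.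
  - move=> w; rewrite mem_cat inE => /orP[wf|/eqP->].
      have [? ?] := fan_apex wf; split=> //; first by exists d; [|left].
      by move=> x xw; left; apply: fanL wf xw.
    split=> //; first by exists d; [rewrite !inE eqxx orbT|left].
    by move=> x; rewrite !inE => /or3P[]/eqP->; left; rewrite ?eqxx ?orbT// xs_us ?orbT.
  - by move=> e /mapP[x _ ->]; left.
  move=> e ein.
  have Dd w : w \in previous_faces c d u op ++ fan d u xs ++ [:: [:: c; d; xl]] ->
      d \in w -> dface w.
    by rewrite !mem_cat inE => /or3P[|/[swap] _|/eqP]; [constructor 1|constructor 2|constructor 3].
  case: (eqVneq e (d, xl)) => [->|/eqP ne]; last first.
    apply: cert_d Dd _ ne; first by [].
    move: ein; rewrite !mem_cat => /orP[->//|/mapP[x]].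
    by rewrite mem_rev => xx ->; rewrite map_f ?orbT.
  have ldxl : linked es1 d xl by apply: Or32; exact: es1P.
  (* Here [c d xl] is a face, so [c] cannot serve for the edge to [xl]. The corner two places before
     [xl] does; if the run is the single corner [x1 = xl], there is a predecessor [p], which is
     linked to [x1]. *)
  have [sz2|sz1] := ltnP 1 (size xs).
    set xm := nth u (u :: xs) (size xs - 2).
    have xm_in : xm \in u :: xs by rewrite mem_nth //=; clear -sz2; lia.
    have xlE : xl = nth u (u :: xs) (size xs) by rewrite /xl -[in RHS](last_nth u).
    have ixm : index xm (u :: xs) = size xs - 2 by rewrite index_uniq //=; clear -sz2; lia.
    have ixl : index xl (u :: xs) = size xs by rewrite xlE index_uniq.
    have xmc : xm <> c by move=> E; move: xm_in; rewrite E inE (negbTE cxs) orbF => /eqP.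
    have xmd : xm <> d.
      by move=> E; move: xm_in; rewrite E inE (negbTE dxs) orbF => /eqP.
    have xmxl : xm <> xl by move=> E; move: ixm; rewrite E ixl; clear -sz2; lia.
    exists xm; split=> /=.
    - move: xm_in; rewrite inE => /orP[/eqP->|xx]; last by apply: Or32; exact: es1P.
      by apply: Or32; apply: es1es; apply: fe_sub; rewrite !inE eqxx orbT.
    - apply: linked_sym; apply: Or31.
      have [_] := adjus u (size xs - 2); rewrite usE rest0 cats0 xlE -/xm.
      by rewrite (_ : (size xs - 2).+2 = size xs); [apply=> /=; clear; lia|clear -sz2; lia].
    move=> w; rewrite !mem_cat inE => /or3P[wp _ xw|wf _ xw xmw|/eqP-> _ _].
    - by case: (prev_xl _ wp xw).
    - have := fan_index uxs' wf xw xmw; rewrite ixm ixl => h.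
      by have := h (introN eqP xld) (introN eqP xmd); clear -sz2; lia.
    - mem3.
  have xlx1 : xl = x1 by rewrite x1E /xl; case: (xs) sz1 => [|? []].
  have [p opE] : exists p, op = Some p.
    case: (op) hop => [p|] hop; first by exists p.
    by have := xs1 hop; clear -sz1; lia.
  rewrite opE in hop; have [? ? ? ? ?] := pxs _ opE; exists p; split=> /=.
  - by apply: Or32; apply: es1es; apply: fe_sub; rewrite opE !inE eqxx !orbT.
  - apply: linked_sym; rewrite xlx1 -hus; apply: linked_sub es1es _.
    by case: hop.
  move=> w; rewrite !mem_cat inE => /or3P[wp _ xw|wf _ _ pw|/eqP-> _ _].
  - by case: (prev_xl _ wp xw).
  - exact: fan_p opE wf pw.
  - mem3.
have cNxl : c != xl by apply/eqP; apply: nesym.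
have dNxl : d != xl by apply/eqP; apply: nesym.
have es1L e : e \in es1 -> e.1 \in L /\ e.2 \in L by apply: P_edge_sub HP1.
move: HP1; rewrite catA => HP1.
(* The cone cuts off the quadrilateral [c d xl d'], which the chord from [d'] to [d] then divides.
   What remains, [c d' xl] followed by [rest], has the shape required for the next round, with [d]
   as predecessor. *)
have [d' [d'L d'new]] := @P_cone L es1 (W1 ++ fan d u xs) c [:: d] xl rest W2 HP1 cNxl.
move=> /(@P_rot _ _ _ _ _ 3) HP2; rewrite [rot 3 _]/= in HP2.
have d'N x : x \in [:: c, d, u & us] -> d' <> x.
  by move=> /us_sub + xE; rewrite -xE (negbTE d'L).
have d'c : d' <> c by apply: d'N; rewrite !inE eqxx ?orbT.
have d'd : d' <> d by apply: d'N; rewrite !inE eqxx ?orbT.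
have d'xl : d' <> xl by apply: d'N; rewrite !inE xs_us ?orbT.
have := @P_chord _ _ _ d' [:: c] d [:: xl] _ HP2 d'new (introN eqP d'd).
set es2 := [:: (d', c), (d', xl) & es1]; set es3 := _ :: es2.
have es2d : (d', d) \notin es2 /\ (d, d') \notin es2.
  split; rewrite !inE !xpair_eqE ?(introF eqP (nesym d'd)) ?(introF eqP (nesym cd)).
    by rewrite (introF eqP (nesym xld)) !andbF /=; apply/negP => /es1L[/= + _]; apply/negP.
  by apply/negP => /es1L[_]/=; apply/negP.
move=> /(_ es2d.1 es2d.2) HP3.
have es13 : {subset es1 <= es3} by move=> e ee; rewrite !inE ee !orbT.
have restL x : x \in rest -> x \in L by move=> xr; apply: us_sub; rewrite !inE rest_us ?orbT.
have suf : u :: us = belast u xs ++ (xl :: rest) ++ [::].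
  by rewrite cats0 usE -cat_cons lastI cat_rcons.
have sz : size rest <= n by move: szn; rewrite usE size_cat; clear -xs0; lia.
have [|||||||||||L' [es' [Ds [HP4 LL' hDs hes' cert']]]] :=
  @IH (d' :: L) es3 (W1 ++ fan d u xs ++ [:: [:: d'; c; d]; [:: d'; d; xl]]) W2 d' xl rest (Some d) sz.
- by move: HP3; rewrite -!catA.
- by [].
- by rewrite /= !inE negb_or cNxl andbT; apply/and3P; split=> //; apply/eqP => //; apply: nesym.
- by apply: contra cus; apply: rest_us.
- by apply: contra d'L; apply: restL.
- by rewrite restE.
- by apply: (@close_adjacent_infix (belast u xs) _ [::]); rewrite -suf.
- move=> x xr; apply: linked_sub (linkc _ _); first by move=> e /es1es/es13.
  by rewrite suf mem_cat cats0 xr orbT.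
- by move=> e; rewrite /first_edges !inE => /or3P[]/eqP->; rewrite eqxx ?orbT.
- move=> e; rewrite /first_edges !inE.
  move=> /or4P[->|->|->|/es1L[e1 e2]]; rewrite ?orbT// => -[] E; move: d'L; by rewrite -E ?e1 ?e2.
- split; first by rewrite inE us_sub ?orbT // !inE eqxx orbT.
    rewrite !inE !negb_or dNxl (introN eqP (nesym cd)) (introN eqP (nesym d'd)) /=.
    by apply: contra dus; apply: rest_us.
  (* Maximality of the run: [y] repeats a corner of [u :: xs], all of which are joined to [d]. *)
  apply: linked_sub es13 _; rewrite restE /=; move: yin; rewrite inE => /orP[/eqP->|yx].
    by apply: Or32; apply: es1es; apply: fe_sub; rewrite !inE eqxx orbT.
  by apply: Or32; exact: es1P.
exists L', (es' ++ [:: (d', d); (d', c); (d', xl)] ++ [seq (d, x) | x <- rev xs]),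
  (fan d u xs ++ [:: [:: d'; c; d]; [:: d'; d; xl]] ++ Ds).
have L'L x : x \notin d' :: L -> x \notin L by rewrite inE negb_or => /andP[].
split.
- by move: HP4; rewrite -!catA /=.
- by move=> x xL; apply: LL'; rewrite inE xL orbT.
- move=> w; rewrite !mem_cat !inE => /or3P[wf|/orP[]/eqP->|/hDs[sw [x xw xd] hw]].
  + have [? ?] := fan_apex wf; split=> //; first by exists d; [|left].
    by move=> x xw; left; apply: fanL wf xw.
  + split=> //; first by exists d'; [rewrite !inE eqxx|right].
    by move=> x /in_seq3[]->; [right|left|left]; rewrite // !inE eqxx ?orbT.
  + split=> //; first by exists d'; [rewrite !inE eqxx|right].
    by move=> x /in_seq3[]->; [right|left|left]; rewrite // !inE ?eqxx ?orbT // xs_us ?orbT.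
  + split=> //; first by exists x => //; right; case: xd => [->|/L'L].
    move=> z /hw [|/L'L]; last by right.
    rewrite !inE => /or4P[/eqP->|/eqP->|/eqP->|/rest_us ->]; rewrite ?eqxx ?orbT; try by left.
      by right.
    by left; rewrite xs_us ?orbT.
- move=> e; rewrite !mem_cat !inE => /or3P[/hes'[->|/L'L]|/or3P[]/eqP->|/mapP[x _ ->]];
  by [left|right].
have subes : {subset es1 <= (es' ++ [:: (d', d); (d', c); (d', xl)] ++ [seq (d, x) | x <- rev xs]) ++ es}.
  by move=> e; rewrite !mem_cat => /orP[]->; rewrite ?orbT.
have dDs w : w \in Ds -> d \in w -> False.
  move=> /hDs[_ _ hw] /hw[|/L'L]; last by rewrite us_sub // !inE eqxx orbT.
  rewrite !inE (introF eqP (nesym cd)) (introF eqP (nesym d'd)) (negbTE dNxl) /=.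
  by move=> /rest_us; apply/negP.
move=> e ein.
(* The three edges created together with [d'] are the [first_edges] of the next round, so they and
   all later edges are certified by induction; the edges at [d] are certified here. *)
have [] : e \in first_edges c d u op ++ [seq (d, x) | x <- xs] \/
          e \in first_edges c d' xl (Some d) ++ es'.
- move: ein; rewrite !mem_cat => /orP[->|/orP[->|/orP[e3|/mapP[x]]]];
    rewrite ?orbT; try by [left|right].
    by right; move: e3; rewrite !inE => /or3P[]->; rewrite ?orbT.
  by rewrite mem_rev => xx ->; left; rewrite map_f ?orbT.
- move=> ein'.
  have Dd w : w \in previous_faces c d u op ++ fan d u xs ++
      [:: [:: d'; c; d]; [:: d'; d; xl]] ++ Ds -> d \in w ->
      dface w /\ w <> [:: c; d; xl].
    rewrite !mem_cat !inE => /or4P[wp|wf|/orP[]/eqP->|/dDs //] dw.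
    + split; first by constructor 1.
      by move=> wE; apply: (prev_xl _ wp); rewrite wE !inE eqxx !orbT.
    + split; first by constructor 2.
      by move=> wE; apply: (fan_c _ wf); rewrite wE !inE eqxx.
    + by split; [constructor 4; exists d' => //; left|case].
    + by split; [constructor 4; exists d' => //; right|case].
  case: (eqVneq e (d, xl)) => [->|/eqP ne]; last first.
    by apply: cert_d subes _ ein' ne => w wD /(Dd _ wD)[].
  (* The triangle [c d xl] has been divided by [d'], so [c] serves for the edge to [xl]. *)
  exists c; split=> /=.
  + by apply: Or32; apply: subes; apply: es1es; apply: fe_sub; rewrite !inE eqxx.
  + apply: linked_sym; apply: linked_sub subes _; apply: linked_sub es1es _.
    by apply: linkc; rewrite inE xs_us ?orbT.
  move=> w wD dw; have [] := Dd w wD dw.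
  move=> [wp _ xw _|wf _ _|//|[d2 d2L [] -> _]].
  + exact: prev_xl wp xw.
  + exact: fan_c wf.
  + have ? : xl <> d2 by move=> E; move: d2L; rewrite -E us_sub // !inE xs_us ?orbT.
    mem3.
  + have ? : c <> d2 by move=> E; move: d2L; rewrite -E us_sub // !inE eqxx.
    mem3.
- move=> e'in; have [z [l1 l2 hw]] := cert' _ e'in.
  have e1L : e.1 \notin L.
    move: e'in; rewrite mem_cat /first_edges !inE.
    by move=> /orP[/or3P[]/eqP->//|/hes'[->|/L'L]].
  have sub3 : {subset es' ++ es3 <= (es' ++ [:: (d', d); (d', c); (d', xl)] ++ [seq (d, x) | x <- rev xs]) ++ es}.
    by move=> f; rewrite -!catA.
  exists z; split; [exact: linked_sub l1|exact: linked_sub l2|].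
  move=> w; rewrite !mem_cat => /or4P[wp /(prevL _ wp)|wf /(fanL _ _ wf)/us_sub|w3|wD].
  + by rewrite (negbTE e1L).
  + by rewrite (negbTE e1L).
  + by apply: hw; rewrite mem_cat w3.
  + by apply: hw; rewrite mem_cat wD orbT.
Qed.

(** A cone over the edge from [c] to [u] cuts off the triangle [c u d] and starts the runs without a
    predecessor; the bound on [size us] provides the two further corners this requires. Every
    resulting face contains a new vertex, which will exclude 3-cycles formed by [c] and two old
    vertices. *)
Lemma gap_filling L es W1 W2 c us :
  P L es (W1 ++ (c :: us) :: W2) -> c \notin us -> 2 < size us ->
  close_adjacent us -> (forall x, x \in us -> linked es c x) ->
  exists L' es' Ds,
    [/\ P L' (es' ++ es) (W1 ++ Ds ++ W2), {subset L <= L'},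
      forall w, w \in Ds -> [/\ size w = 3, exists2 x, x \in w & x \notin L &
        forall x, x \in w -> x \in c :: us \/ x \notin L] &
      forall e, e \in es' -> e.1 \notin L /\ certified (es' ++ es) Ds e].
Proof.
case: us => [//|u us] HP; rewrite inE negb_or => /andP[cu cus] szus adjus linkc.
have us_sub : {subset [:: c, u & us] <= L}.
  by apply: (P_face_sub HP); rewrite mem_cat inE eqxx orbT.
have [d [dL dnew HP1]] := @P_cone L es W1 c [::] u us W2 HP cu.
have dN x : x \in [:: c, u & us] -> d != x.
  by move=> /us_sub + ; apply: contraTneq => <-.
have cd : c != d by rewrite eq_sym dN ?mem_head.
have du : d != u by rewrite dN // !inE eqxx orbT.
have esL := fun e => @P_edge_sub _ _ _ e HP.
have := @run_filling (size us) (d :: L) [:: (d, c), (d, u) & es] (W1 ++ [:: [:: c; u; d]]) W2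
  c d u us None (leqnn _).
have szus0 : 0 < size us by move: szus; clear=> /=; lia.
case=> //.
- by rewrite -catA.
- by rewrite /= !inE negb_or cd cu du.
- by apply/negP => dus; have := dN d; rewrite eqxx !inE dus !orbT => /(_ isT).
- by move=> x xus; apply: linked_sub (linkc _ xus) => e ee; rewrite !inE ee !orbT.
- by move=> e; rewrite /first_edges !inE => /orP[]->; rewrite ?orbT.
- move=> e; rewrite /first_edges !inE => /or3P[->|->|/esL[e1 e2] h]; rewrite ?orbT//.
  by case: h => E; move: dL; rewrite -E ?e1 ?e2.
move=> L' [es' [Ds [HP2 LL' hDs hes' cert]]].
have L'L x : x \notin d :: L -> x \notin L by rewrite inE negb_or => /andP[].
exists L', (es' ++ [:: (d, c); (d, u)]), ([:: c; u; d] :: Ds); split.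
- by move: HP2; rewrite -!catA.
- by move=> x xL; apply: LL'; rewrite inE xL orbT.
- move=> w; rewrite inE => /orP[/eqP->|/hDs[sw [x xw xd] hw]].
    split=> //; first by exists d => //; rewrite !inE eqxx !orbT.
    by move=> x /in_seq3[]->; [left|left|right]; rewrite // !inE eqxx ?orbT.
  split=> //; first by exists x => //; case: xd => [->|/L'L].
  move=> z /hw[|/L'L]; last by right.
  by rewrite !inE => /or4P[->|/eqP->|->|->]; rewrite ?orbT; [left|right|left|left].
move=> e; rewrite mem_cat => ein; split.
  by case/orP: ein => [/hes'[->//|/L'L//]|]; rewrite !inE => /orP[]/eqP->.
have /cert[z [l1 l2 hw]] : e \in first_edges c d u None ++ es' by rewrite mem_cat orbC.
by exists z; rewrite -catA; split.
Qed.

(** Invariant: [u0] is the last vertex joined to [c], [cur'] the vertices met since then, all joined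
    to [c] before, [rest] what is still to be read, and [v0] closes the walk. A gap with empty
    [cur'] is a triangle of [consecutive] vertices; any other gap has at least three corners and is
    filled by faces with a new vertex. Edges at [c] are only listed, as their certificates concern
    the faces of all gaps together. *)
Lemma sweep rest L es W1 W2 c dpre u0 cur' vs v0 :
  let consecutive x y := index y vs = (index x vs).+1 \/
    y = v0 /\ (index x vs).+1 = size vs in
  vs = (dpre ++ u0 :: cur') ++ rest ->
  index u0 vs = size dpre -> v0 \in dpre ++ u0 :: cur' ->
  close_adjacent (vs ++ [:: v0]) -> {subset vs <= L} -> c \in L -> c \notin vs ->
  new c ->
  (forall x, x \in vs -> ((c, x) \in es) = (x \in dpre ++ u0 :: cur')) ->
  (forall x, x \in vs -> (x, c) \notin es) ->
  P L es (W1 ++ (c :: (u0 :: cur') ++ rest ++ [:: v0]) :: W2) ->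
  exists L' es' Ds,
    [/\ P L' (es' ++ es) (W1 ++ Ds ++ W2), {subset L <= L'},
      forall w, w \in Ds -> [/\ size w = 3,
        (exists2 x, x \in w & x \notin L) \/
        exists x y, w = [:: c; x; y] /\ consecutive x y &
        forall x, x \in w -> x \in c :: vs \/ x \notin L],
      forall e, e \in es' -> e.1 = c /\ e.2 \in vs \/
        e.1 \notin L /\ certified (es' ++ es) Ds e &
      forall x, x \in vs -> (c, x) \in es' ++ es].
Proof.
move=> consecutive.
elim: rest L es W1 dpre u0 cur' => [|y rest IH] L es W1 dpre u0 cur' vsE iu0 v0in
    adjvs vsL cL cvs cnew hes hes' HP.
  rewrite cats0 in vsE; rewrite -vsE in hes v0in.
  have chain_sub : {subset u0 :: cur' ++ [:: v0] <= vs}.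
    move=> x; rewrite -cat_cons mem_cat mem_seq1 => /orP[xc|/eqP->//].
    by rewrite vsE mem_cat xc orbT.
  case: cur' vsE HP chain_sub => [|u1 cur'] vsE HP chain_sub.
    exists L, [::], [:: [:: c; u0; v0]]; split=> //; last by move=> x xv; rewrite hes.
    move=> w; rewrite mem_seq1 => /eqP->; split=> //.
      right; exists u0, v0; split=> //; right; split=> //.
      by rewrite iu0 vsE size_cat addn1.
    move=> x; rewrite inE => /orP[/eqP->|xin]; left; rewrite !inE ?eqxx //.
    by rewrite chain_sub ?orbT.
  have [||||L' [es' [Ds [HP' LL' hDs hcert]]]] :=
      @gap_filling L es W1 W2 c (u0 :: u1 :: cur' ++ [:: v0]) HP.
  - by apply: contra cvs; apply: chain_sub.
  - by rewrite /= size_cat addn1.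
  - apply: (@close_adjacent_infix dpre _ [::]).
    by move: adjvs; rewrite cats0 vsE -!catA.
  - by move=> x xin; apply: Or32; rewrite hes; apply: chain_sub.
  exists L', es', Ds; split=> //.
  - move=> w /hDs[sw hw hw']; split=> //; first by left.
    by move=> x /hw'[|]; [rewrite !inE => /predU1P[->|/chain_sub ->]; rewrite ?eqxx ?orbT; left|right].
  - by move=> e /hcert; right.
  - by move=> x xv; rewrite mem_cat hes // xv orbT.
have yvs : y \in vs by rewrite vsE mem_cat mem_head orbT.
(* A second edge from [c] to [y] is forbidden, so a repeated vertex only lengthens the current
   gap. *)
have [ydone|ynew] := boolP (y \in dpre ++ u0 :: cur').
  apply: (IH L es W1 dpre u0 (rcons cur' y)) => //.
  - by rewrite -rcons_cons -rcons_cat cat_rcons.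
  - by rewrite -rcons_cons -rcons_cat mem_rcons inE v0in orbT.
  - move=> x xv; rewrite hes // -rcons_cons -rcons_cat mem_rcons inE.
    by case: eqVneq => [->|//]; rewrite ydone.
  - by rewrite -rcons_cons cat_rcons.
have cy : c != y by apply: contraNneq cvs => ->.
have HP1 := @P_chord L es W1 c (u0 :: cur') y (rest ++ [:: v0]) W2 HP cnew cy.
have {HP1} HP1 := HP1 _ (hes' _ yvs); rewrite hes // in HP1.
have {}HP1 := HP1 ynew.
have iy : index y vs = size (dpre ++ u0 :: cur').
  by rewrite vsE index_cat (negbTE ynew) /= eqxx addn0.
set es1 := (c, y) :: es in HP1.
(* The induction hypothesis with [y] as last neighbour of [c]. The edges [es2] made while filling
   the gap have their first end outside [L], so they neither start at [c] nor at a vertex of the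
   walk. *)
have IHk L1 es2 W3 : {subset L <= L1} ->
    (forall e, e \in es2 -> e.1 \notin L) ->
    P L1 (es2 ++ es1) (W3 ++ (c :: (y :: [::]) ++ rest ++ [:: v0]) :: W2) ->
    exists L' es' Ds,
    [/\ P L' (es' ++ es2 ++ es1) (W3 ++ Ds ++ W2), {subset L1 <= L'},
      forall w, w \in Ds -> [/\ size w = 3,
        (exists2 x, x \in w & x \notin L1) \/
        exists x y, w = [:: c; x; y] /\ consecutive x y &
        forall x, x \in w -> x \in c :: vs \/ x \notin L1],
      forall e, e \in es' -> e.1 = c /\ e.2 \in vs \/
        e.1 \notin L1 /\ certified (es' ++ es2 ++ es1) Ds e &
      forall x, x \in vs -> (c, x) \in es' ++ es2 ++ es1].
  move=> LL1 es2L HP3.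
  apply: (IH L1 (es2 ++ es1) W3 (dpre ++ u0 :: cur') y [::]) => //.
  - by rewrite vsE -!catA.
  - by rewrite mem_cat v0in.
  - by move=> x /vsL/LL1.
  - exact: LL1.
  - move=> x xv; rewrite [RHS]mem_cat mem_seq1 [LHS]mem_cat /es1 [X in _ || X]in_cons xpair_eqE eqxx hes //=.
    have /negbTE -> : (c, x) \notin es2 by apply/negP => /es2L; rewrite cL.
    by rewrite /= orbC.
  - move=> x xv; rewrite mem_cat /es1 in_cons xpair_eqE (negbTE (hes' _ xv)) orbF negb_or.
    apply/andP; split; first by apply/negP => /es2L; rewrite vsL.
    by rewrite negb_and; apply/orP; left; apply: contraNneq cvs => <-.
case: cur' vsE iu0 v0in hes HP HP1 ynew iy IHk => [|u1 cur'] vsE iu0 v0in hes HP HP1 ynew iy IHk.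
  have [|||L' [es' [Ds [HP' LL' hDs hes2 hc]]]] := @IHk L [::] (W1 ++ [:: [:: c; u0; y]]).
  - by [].
  - by [].
  - by rewrite -catA.
  exists L', (es' ++ [:: (c, y)]), ([:: c; u0; y] :: Ds); split.
  - by move: HP'; rewrite -!catA.
  - by [].
  - move=> w; rewrite inE => /predU1P[->|/hDs//]; split=> //.
      by right; exists u0, y; split=> //; left; rewrite iy iu0 size_cat addn1.
    move=> x /in_seq3[]->; left; rewrite !inE ?eqxx ?yvs ?orbT //.
    by rewrite vsE !mem_cat inE eqxx !orbT.
  - move=> e; rewrite mem_cat mem_seq1 => /orP[/hes2[|[eL [z [l1 l2 hw]]]]|/eqP->]; first by left.
      right; split=> //; exists z; rewrite -catA; split=> // w; rewrite inE => /predU1P[->|]; last exact: hw.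
      move=> e1; case/negP: eL; move: e1 => /in_seq3[]-> //; apply: vsL => //.
      by rewrite vsE !mem_cat inE eqxx !orbT.
    by left.
  - by move=> x /hc; rewrite -catA.
have f1sub : {subset u0 :: u1 :: cur' ++ [:: y] <= vs}.
  move=> x; rewrite -!cat_cons mem_cat mem_seq1 => /orP[xc|/eqP->//].
  by rewrite vsE !mem_cat xc orbT.
have [|||||L1 [es2 [Ds1 [HP2 LL1 hDs1 hcert1]]]] :=
    @gap_filling L es1 W1 ((c :: y :: rest ++ [:: v0]) :: W2) c (u0 :: u1 :: cur' ++ [:: y]).
- by move: HP1.
- by apply: contra cvs; apply: f1sub.
- by rewrite /= size_cat addn1.
- apply: (@close_adjacent_infix dpre _ (rest ++ [:: v0])).
  by move: adjvs; rewrite vsE -!catA /= -catA.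
- move=> x; rewrite -!cat_cons mem_cat mem_seq1 => /orP[xc|/eqP->]; last by apply: Or32; rewrite inE eqxx.
  by apply: Or32; rewrite inE hes ?mem_cat ?xc ?orbT // vsE !mem_cat xc orbT.
have [|||L' [es' [Ds [HP' LL' hDs hes2 hc]]]] := @IHk L1 es2 (W1 ++ Ds1).
- by [].
- by move=> e /hcert1[].
- by rewrite -catA.
have L1L x : x \notin L1 -> x \notin L by apply: contra; apply: LL1.
have Ds1L w : w \in Ds1 -> {subset w <= L1}.
  by move=> wD; apply: (P_face_sub HP2); rewrite !mem_cat wD orbT.
exists L', (es' ++ es2 ++ [:: (c, y)]), (Ds1 ++ Ds); split.
- by move: HP'; rewrite -!catA.
- by move=> x /LL1/LL'.
- move=> w; rewrite mem_cat => /orP[/hDs1[sw hw hw']|/hDs[sw hw hw']]; split=> //.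
  + by left.
  + by move=> x /hw'[|]; [rewrite !inE => /predU1P[->|/f1sub ->]; rewrite ?eqxx ?orbT; left|right].
  + by case: hw => [[x xw /L1L xL]|]; [left; exists x|right].
  + by move=> x /hw'[|/L1L]; [left|right].
- move=> e; rewrite !mem_cat => /or3P[/hes2[|[eL [z [l1 l2 hw]]]]|/[dup] e2 /hcert1[eL [z [l1 l2 hw]]]|].
  + by left.
  + right; split; first exact: L1L.
    exists z; rewrite -!catA; split=> // w; rewrite mem_cat => /orP[wD /(Ds1L _ wD)|]; last exact: hw.
    by rewrite (negbTE eL).
  + right; split=> //; exists z; rewrite -!catA.
    have sub x : x \in es2 ++ es1 -> x \in es' ++ es2 ++ [:: (c, y)] ++ es.
      by move=> xx; rewrite mem_cat xx orbT.
    split; [exact: linked_sub l1|exact: linked_sub l2|].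
    move=> w; rewrite mem_cat => /orP[|/hDs[_ _ hw'] /hw'[]]; first exact: hw.
      rewrite inE => /predU1P[E|/vsL]; last by rewrite (negbTE eL).
      by move: eL; rewrite E cL.
    have /(P_edge_sub HP2)[-> _] // : e \in es2 ++ es1 by rewrite mem_cat e2.
  + by rewrite mem_seq1 => /eqP->; left.
- by move=> x /hc; rewrite -!catA.
Qed.

(** A certificate found in one gap survives the filling of the others, because the first end of the
    edge was created in its own gap and lies on no face of another one. *)
Lemma gaps_filling uss L es W1 W2 c :
  P L es (W1 ++ map (cons c) uss ++ W2) ->
  (forall us, us \in uss -> [/\ c \notin us, 2 < size us, close_adjacent us &
     forall x, x \in us -> linked es c x]) ->
  exists L' es' Ds,
    [/\ P L' (es' ++ es) (W1 ++ Ds ++ W2), {subset L <= L'},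
      forall w, w \in Ds -> [/\ size w = 3, exists2 x, x \in w & x \notin L &
        forall x, x \in w -> x \in c :: flatten uss \/ x \notin L] &
      forall e, e \in es' -> e.1 \notin L /\ certified (es' ++ es) Ds e].
Proof.
elim: uss L es W1 => [|us uss IH] L es W1 HP hus.
  by exists L, [::], [::]; split.
have [cus us2 adjus linkc] := hus _ (mem_head _ _).
have [L1 [es1 [D1 [HP1 LL1 hD1 h1]]]] := gap_filling HP cus us2 adjus linkc.
have sub0 x : x \in c :: flatten uss -> x \in c :: flatten (us :: uss).
  by rewrite /= !inE mem_cat => /orP[]->; rewrite ?orbT.
have inL x : x \in c :: flatten (us :: uss) -> x \in L.
  have face0 u : u \in us :: uss -> {subset c :: u <= L}.
    by move=> uu; apply: (P_face_sub HP); rewrite !mem_cat map_f ?orbT.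
  rewrite inE => /predU1P[->|/flattenP[u uu xu]].
    by apply: (face0 us); rewrite mem_head.
  by apply: (face0 u uu); rewrite inE xu orbT.
have [||L2 [es2 [D2 [HP2 LL2 hD2 h2]]]] := IH L1 (es1 ++ es) (W1 ++ D1).
- by move: HP1; rewrite -!catA.
- move=> u uu; have [|? ? ? lu] := hus u; first by rewrite inE uu orbT.
  by split=> // x /lu; apply: linked_sub => e ee; rewrite mem_cat ee orbT.
have L1L x : x \notin L1 -> x \notin L by apply: contra; apply: LL1.
exists L2, (es2 ++ es1), (D1 ++ D2); split.
- by move: HP2; rewrite -!catA.
- by move=> x /LL1/LL2.
- move=> w; rewrite mem_cat => /orP[/hD1[sw hw hw']|/hD2[sw [x xw xL] hw']]; split=> //.
  + by move=> x /hw'[|]; [rewrite /= !inE mem_cat => /orP[]->; rewrite ?orbT; left|right].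
  + by exists x; rewrite ?L1L.
  + by move=> z /hw'[/sub0|/L1L]; [left|right].
move=> e; rewrite mem_cat => /orP[/h2[eL [z [l1 l2 hw]]]|/[dup] e1 /h1[eL [z [l1 l2 hw]]]].
  split; first exact: L1L.
  exists z; rewrite -catA; split=> // w; rewrite mem_cat => /orP[wD1|]; last exact: hw.
  have wL1 : {subset w <= L1} by apply: (P_face_sub HP1); rewrite !mem_cat wD1 orbT.
  by move=> /wL1; rewrite (negbTE eL).
split=> //; exists z; rewrite -catA.
split; [apply: linked_sub l1|apply: linked_sub l2|].
- by move=> f ff; rewrite mem_cat ff orbT.
- by move=> f ff; rewrite mem_cat ff orbT.
move=> w; rewrite mem_cat => /orP[|/hD2[_ _ hw'] /hw'[/sub0/inL|]]; first exact: hw.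
  by rewrite (negbTE eL).
have /(P_edge_sub HP1)[-> _] // : e \in es1 ++ es by rewrite mem_cat e1.
Qed.

(** Pigeonhole: a new vertex and three distinct old ones do not fit on a walk of length three. *)
Lemma size3_fresh (L w : seq T) (a b c : T) : size w = 3 ->
  (exists2 x, x \in w & x \notin L) -> uniq [:: a; b; c] ->
  a \in L -> b \in L -> c \in L -> a \in w -> b \in w -> c \in w -> False.
Proof.
move=> sw [x xw xL] abc aL bL cL aw bw cw.
have : uniq [:: x; a; b; c].
  rewrite /= -/(uniq [:: a; b; c]) abc andbT !inE.
  by apply/negP => /or3P[]/eqP xE; move: xL; rewrite xE ?aL ?bL ?cL.
move=> u4; have := uniq_leq_size (s2 := w) u4; rewrite sw => h; suff : 3 < 3 by [].
by apply: h => z; rewrite !inE => /or4P[]/eqP->.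
Qed.

Lemma index_nth_leq (x0 : T) s i : i < size s -> index (nth x0 s i) s <= i.
Proof. by elim: s i => [//|x s IH] [|i] /=; rewrite ?eqxx // ltnS; case: eqP => // _ /IH. Qed.

(** * The two fillings of an irreducible walk *)

Definition cyclically_adjacent (vs : seq T) := forall x0 i, i < size vs ->
  adj (nth x0 vs i) (nth x0 vs (i.+1 %% size vs)) /\
  adj (nth x0 vs i) (nth x0 vs (i.+2 %% size vs)).

(** Nonemptiness of [es] guarantees a new vertex inside the face, so that the original face really
    disappears. *)
Definition filled (L : seq T) (es : seq (T * T)) (Ws : seq (seq T)) :=
  [/\ P L es Ws, es != [::], (forall w, w \in Ws -> size w = 3) &
    forall e, e \in es -> certified es Ws e].

Lemma cyclically_adjacent_close v vs :
  cyclically_adjacent (v :: vs) -> close_adjacent ((v :: vs) ++ [:: v]).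
Proof.
move=> h x0 i; have sz : size ((v :: vs) ++ [:: v]) = (size (v :: vs)).+1.
  by rewrite size_cat addn1.
have nthE j : j <= size (v :: vs) ->
    nth x0 ((v :: vs) ++ [:: v]) j = nth x0 (v :: vs) (j %% size (v :: vs)).
  rewrite nth_cat leq_eqVlt => /predU1P[->|ji]; first by rewrite ltnn subnn modnn.
  by rewrite ji modn_small.
rewrite !sz; split=> hi.
  rewrite (nthE i.+1); last by rewrite -ltnS.
  rewrite nthE; last by apply: ltnW; rewrite -ltnS.
  by rewrite (@modn_small i); [apply: (h x0 i _).1|]; rewrite -ltnS.
rewrite (nthE i.+2); last by rewrite -ltnS.
rewrite nthE; last by do 2![apply: ltnW]; rewrite -ltnS.
by rewrite (@modn_small i); [apply: (h x0 i _).2|]; apply: ltnW; rewrite -ltnS.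
Qed.

(* The first-occurrence positions of two consecutive cone neighbours differ by
   one, so a walk neighbour at distance two certifies each edge at [c], except
   that at [v1] the candidate is [v3], which must therefore differ from [v0]. *)
Lemma filling_nonperiodic x0 vs L :
  cyclically_adjacent vs -> 3 < size vs -> {subset vs <= L} ->
  P L [::] [:: vs] -> nth x0 vs 0 != nth x0 vs 3 ->
  exists L' es Ws, filled L' es Ws.
Proof.
move=> cyc sz vsL HP n03.
set m := size vs in sz; pose V j := nth x0 vs j.
have [v0 [v1 [rest vsE]]] : exists v0 v1 rest, vs = v0 :: v1 :: rest.
  by move: sz; rewrite /m; case: (vs) => [//|v0 [//|v1 rest]]; exists v0, v1, rest.
have V0 : V 0 = v0 by rewrite /V vsE.
have V1 : V 1 = v1 by rewrite /V vsE.
have adj1 i : i.+1 < m -> adj (V i) (V i.+1).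
  by move=> im; have [+ _] := cyc x0 i (ltnW im); rewrite -/m modn_small.
have adj2 i : i.+2 < m -> adj (V i) (V i.+2).
  by move=> im; have [_] := cyc x0 i (ltnW (ltnW im)); rewrite -/m modn_small.
have m1 : 1 < m by apply: leq_trans sz.
have v01 : v0 != v1 by rewrite -V0 -V1; apply: adj_neq; apply: adj1.
have vsP x : x \in vs -> V (index x vs) = x by move=> xv; rewrite /V nth_index.
have Vin j : j < m -> V j \in vs by move=> jm; rewrite mem_nth.
have HP0 : P L [::] ([::] ++ (v0 :: [::] ++ v1 :: rest) :: [::]) by rewrite /= -vsE.
have [c [cL cnew]] := P_cone HP0 v01.
move=> /(@P_rot _ _ [:: [:: v0; v1; c]] _ _ 1); rewrite rot1_cons /= -cats1 => HP1.
have cvs : c \notin vs by apply: contra cL; apply: vsL.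
have := @sweep rest (c :: L) [:: (c, v0); (c, v1)] [:: [:: v0; v1; c]] [::] c [:: v0] v1
  [::] vs v0; case.
- by rewrite vsE.
- by rewrite vsE /= (negbTE v01) eqxx.
- by rewrite mem_head.
- by rewrite vsE; apply: cyclically_adjacent_close; rewrite -vsE.
- by move=> x /vsL xL; rewrite inE xL orbT.
- exact: mem_head.
- exact: cvs.
- exact: cnew.
- by move=> x xv; rewrite !inE !xpair_eqE eqxx.
- move=> x xv; rewrite !inE !xpair_eqE; have /negbTE -> // : x != c.
  by apply: contraNneq cvs => <-.
- exact: HP1.
move=> L' [es' [Ds [HP2 LL' hDs hes' hc]]].
set es := es' ++ _ in HP2 hc; set Ws := [:: v0; v1; c] :: Ds.
pose consecutive x y := index y vs = (index x vs).+1 \/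
    y = v0 /\ (index x vs).+1 = size vs.
(* A face with a vertex created in the sweep has no room for [c] and two vertices of the walk; only
   the triangles [c x y] remain. *)
have facial w v z : w \in Ws -> v \in vs -> z \in vs -> v != z ->
    c \in w -> v \in w -> z \in w -> consecutive v z \/ consecutive z v.
  move=> wW vv zv vz cw vw zw.
  have vc : v <> c by move=> E; move: cvs; rewrite -E vv.
  have zc : z <> c by move=> E; move: cvs; rewrite -E zv.
  have vz' : v <> z by apply/eqP.
  have [x [y [wE xy]]] : exists x y, (forall t, t \in w -> [\/ t = c, t = x | t = y]) /\
      consecutive x y.
    move: wW; rewrite inE => /predU1P[wE|/hDs[sw [fr|[x [y [wE xy]]]] _]].
    - exists v0, v1; split.
        by move=> t; rewrite wE => /in_seq3[]->; [apply: Or32|apply: Or33|apply: Or31].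
      by left; rewrite vsE /= eqxx (negbTE v01) eqxx.
    - exfalso; apply: (size3_fresh (a := c) (b := v) (c := z) sw fr) => //.
      + rewrite /= !inE (negbTE vz) (introF eqP (nesym vc)).
        by rewrite (introF eqP (nesym zc)).
      + exact: mem_head.
      + by rewrite inE (vsL _ vv) orbT.
      + by rewrite inE (vsL _ zv) orbT.
    - by exists x, y; split=> // t; rewrite wE; apply: in_seq3.
  case: (wE _ vw) => // vE; case: (wE _ zw) => // zE; rewrite ?vE ?zE; try by [left|right].
  - by case: vz'; rewrite vE zE.
  - by case: vz'; rewrite vE zE.
have cert v : v \in vs -> certified es Ws (c, v).
  move=> vv; set i := index v vs.
  have im : i < m by rewrite index_mem.
  have vV : v = V i by rewrite vsP.
  have good z : z \in vs -> adj v z -> ~ consecutive v z -> ~ consecutive z v ->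
      certified es Ws (c, v).
    move=> zv vz h1 h2; exists z; split=> /=; [by apply: Or32; apply: hc|exact: Or31|].
    by move=> w wW cw vw zw; case: (facial w v z wW vv zv (adj_neq vz) cw vw zw).
  have V2 : index (V 2) vs = 2.
    have n02 := adj_neq (adj2 0 (ltnW sz)); have n12 := adj_neq (adj1 1 (ltnW sz)).
    rewrite V0 in n02; rewrite V1 in n12; move: n02 n12; rewrite /V vsE /= => /negbTE-> /negbTE->.
    by move: sz; rewrite /m vsE /=; case: (rest) => //= a l _; rewrite eqxx.
  (* Here [n03] enters: [V 3] differs from [V 1] and [V 2] by adjacency and from [V 0] by
     assumption, so position 3 is its first occurrence. *)
  have V3 : index (V 3) vs = 3.
    have n13 := adj_neq (adj2 1 sz); have n23 := adj_neq (adj1 2 sz).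
    move: n13 n23 n03 sz; rewrite /m /V vsE /= => /negbTE-> + /negbTE->.
    by case: (rest) => [//|a [//|b l]] /= /negbTE->; rewrite eqxx.
  have iv0 : index v0 vs = 0 by rewrite vsE /= eqxx.
  have iv1 : index v1 vs = 1 by rewrite vsE /= (negbTE v01) eqxx.
  have vi0 : v = v0 -> i = 0 by rewrite /i => ->.
  have [i0|i0] := posnP i.
    apply: (good (V 2)); rewrite /consecutive -/i ?V2 ?i0 -/m.
    - by apply: Vin; apply: ltnW.
    - by rewrite vV i0; apply: adj2; apply: ltnW.
    - by case=> [//|[E _]]; move: V2; rewrite E iv0.
    - by case=> [//|[_ mE]]; move: sz; rewrite -mE.
  have [i1|i1] := eqVneq i 1.
    apply: (good (V 3)); rewrite /consecutive -/i ?V3 ?i1 -/m.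
    - exact: Vin.
    - by rewrite vV i1; apply: adj2.
    - by case=> [//|[E _]]; move: V3; rewrite E iv0.
    - by case=> [//|[/vi0]]; rewrite i1.
  have i2 : 1 < i by rewrite ltn_neqAle eq_sym i1.
  (* At the last position the vertex two places back might be [v0], which counts as consecutive; two
     places ahead lies [v1]. *)
  have [im1|im1] := eqVneq i.+1 m.
    apply: (good v1); rewrite /consecutive -/i ?iv1 -/m.
    - by rewrite -V1; apply: Vin.
    - have [_] := cyc x0 i im; rewrite -/m -/(V i) -vV -addn1 im1 modnDl modn_small //.
      by rewrite -/(V 1) V1.
    - case=> [[E]|[/eqP]]; first by move: i0; rewrite -E.
      by rewrite eq_sym (negbTE v01).
    - by case=> [E|[/vi0 E]]; [move: sz; rewrite -im1 E|move: i0; rewrite E].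
  have im2 : i.+1 < m by rewrite ltn_neqAle im1.
  (* The first occurrence of [V (i - 2)] may come earlier still, which only takes it further from
     position [i]. *)
  have iz : index (V (i - 2)) vs <= i - 2.
    by apply: index_nth_leq; apply: leq_ltn_trans (leq_subr _ _) im.
  have i22 : (i - 2).+2 = i by rewrite -addn2 subnK.
  apply: (good (V (i - 2))); rewrite /consecutive -/i -/m.
  - by apply: Vin; apply: leq_ltn_trans (leq_subr _ _) im.
  - by apply: adj_sym; rewrite vV -{2}i22; apply: adj2; rewrite i22.
  - by case=> [E|[_ E]]; [move: iz; rewrite E -{1}i22; clear; lia|move: im1; rewrite E eqxx].
  - case=> [E|[/vi0 E]]; last by move: i0; rewrite E.
    by move: iz; rewrite -ltnS -E -{1}i22; clear; lia.
exists L', es, Ws; split.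
- by move: HP2; rewrite /= cats0.
- by rewrite -size_eq0 /es size_cat addn_eq0 andbF.
- by move=> w; rewrite inE => /predU1P[->|/hDs[]].
move=> [e1 e2]; rewrite /es mem_cat !inE => /or3P[/hes'[/=[-> e2v]|/=[eL [z [l1 l2 hw]]]]|/eqP[-> ->]|/eqP[-> ->]].
- exact: cert.
- exists z; split=> // w; rewrite inE => /predU1P[-> /=|]; last exact: hw.
  move=> /in_seq3[] e1E; case/negP: eL; rewrite e1E ?inE ?eqxx //; apply/orP; right; apply: vsL.
    by rewrite vsE inE eqxx.
  by rewrite vsE !inE eqxx orbT.
- by apply: cert; rewrite vsE inE eqxx.
- by apply: cert; rewrite vsE !inE eqxx orbT.
Qed.

(** The walk has at least six positions but only three vertices. Joining [c] at positions 0, 2 and 4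
    reaches each of them once and leaves no triangular gap, so every face contains a vertex newer
    than [c]. Hence none contains [c] and two of the three vertices, which certifies the edges at
    [c]. *)
Lemma filling_periodic x0 vs L :
  cyclically_adjacent vs -> 3 < size vs -> {subset vs <= L} ->
  P L [::] [:: vs] ->
  (forall i, i < size vs -> nth x0 vs i = nth x0 vs ((i + 3) %% size vs)) ->
  exists L' es Ws, filled L' es Ws.
Proof.
move=> cyc sz vsL HP per.
(* With four or five positions the period would make a vertex adjacent to itself. *)
have m6 : 5 < size vs.
  have := per 0 (leq_trans (isT : 0 < 4) sz); rewrite add0n modn_small // => n03.
  have [n1 n2] := cyc x0 3 sz; rewrite -n03 in n1 n2.
  rewrite ltn_neqAle ltn_neqAle sz andbT; apply/andP; split; apply/eqP => mE.
    by move: n2; rewrite -mE modnn => /adj_neq; rewrite eqxx.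
  by move: n1; rewrite -mE modnn => /adj_neq; rewrite eqxx.
have shift i : i + 3 < size vs -> nth x0 vs (i + 3) = nth x0 vs i.
  by move=> im; rewrite [RHS]per ?modn_small //; apply: leq_ltn_trans im; apply: leq_addr.
have [v0 [v1 [v2 [r vsE]]]] : exists v0 v1 v2 r, vs = [:: v0, v1, v2, v0, v1, v2 & r].
  have s0 := shift 0 (ltnW (ltnW m6)); have s1 := shift 1 (ltnW m6); have s2 := shift 2 m6.
  move: m6 s0 s1 s2; clear; case: vs => [|v0 [|v1 [|v2 [|v3 [|v4 [|v5 r]]]]]] //= _.
  by move=> -> -> ->; exists v0, v1, v2, r.
have adj01 : v0 != v1.
  by apply: adj_neq; have [+ _] := cyc x0 0 (ltnW (ltnW (ltnW sz))); rewrite modn_small ?vsE.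
have [adj12 _] := cyc x0 1 (ltnW (ltnW sz)); rewrite modn_small ?(ltnW sz) // vsE /= in adj12.
have [_ adj02] := cyc x0 0 (ltnW (ltnW (ltnW sz))).
rewrite modn_small ?(ltnW sz) // vsE /= in adj02.
have v_in x : x \in vs -> x \in [:: v0; v1; v2].
  move=> xv; rewrite -(nth_index x0 xv); move: xv; rewrite -index_mem.
  elim/ltn_ind: (index x vs) => i IH im.
  have [i3|i3] := leqP 3 i; last first.
    by rewrite vsE; case: i i3 {IH im} => [|[|[|//]]] _ /=; rewrite !inE eqxx ?orbT.
  rewrite -(subnK i3) shift ?subnK //; apply: IH; first by rewrite ltn_subrL (leq_trans _ i3).
  by apply: leq_ltn_trans im; apply: leq_subr.
have vin x : x \in [:: v0; v1; v2] -> x \in vs.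
  by rewrite vsE !inE => /or3P[]->; rewrite ?orbT.
have HP0 : P L [::] ([::] ++ (v0 :: [:: v1] ++ v2 :: [:: v0, v1, v2 & r]) :: [::]).
  by rewrite /= -vsE.
have [c [cL cnew HP1]] := P_cone HP0 (adj_neq adj02).
have {HP1} HP1 := @P_rot _ _ [::] _ _ 3 HP1.
have {HP1} HP1 := @P_rot _ _ [:: _] _ _ 1 HP1.
rewrite rot1_cons /rot /= -cats1 in HP1.
have cvs : c \notin vs by apply: contra cL; apply: vsL.
have cv x : x \in [:: v0; v1; v2] -> (c == x) = false.
  by move=> /vin xv; apply: contraNF cvs => /eqP->.
have [cv0 cv1 cv2] : [/\ (c == v0) = false, (c == v1) = false & (c == v2) = false].
  by split; apply: cv; rewrite !inE eqxx ?orbT.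
have HP2 := @P_chord _ _ [:: _] c [:: v2; v0] v1 ([:: v2 & r] ++ [:: v0]) [::] HP1 cnew.
have {HP2} HP2 : P (c :: L) [:: (c, v1); (c, v0); (c, v2)]
    ([::] ++ map (cons c) [:: [:: v0; v1; v2]; [:: v2; v0; v1]; [:: v1, v2 & r] ++ [:: v0]] ++ [::]).
  apply: HP2; rewrite ?cv1 //; rewrite !inE !xpair_eqE ?eqxx /=.
    by rewrite (eq_sym v1 v0) (negbTE adj01) (negbTE (adj_neq adj12)).
  by rewrite (eq_sym v1 c) cv1.
have linkc x : x \in vs -> linked [:: (c, v1); (c, v0); (c, v2)] c x.
  by move=> /v_in /in_seq3[]->; apply: Or32; rewrite !inE eqxx ?orbT.
have adjvs : close_adjacent (vs ++ [:: v0]).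
  by rewrite vsE; apply: cyclically_adjacent_close; rewrite -vsE.
have r_in x : x \in [:: v1, v2 & r] ++ [:: v0] -> x \in vs.
  by rewrite vsE mem_cat !inE => /orP[/or3P[]|]->; rewrite ?orbT.
have v3_in x : x \in [:: v2; v0; v1] -> x \in vs.
  by rewrite vsE !inE => /or3P[]->; rewrite ?orbT.
have [|L' [es' [Ds [HP3 LL' hDs hes']]]] := gaps_filling HP2.
  move=> us; rewrite !inE => /or3P[]/eqP->.
  - split=> //; first by apply: contra cvs; apply: vin.
      apply: (@close_adjacent_infix [::] _ ([:: v0, v1, v2 & r] ++ [:: v0])).
      by move: adjvs; rewrite vsE.
    by move=> x /vin/linkc.
  - split=> //; first by apply: contra cvs; apply: v3_in.
      apply: (@close_adjacent_infix [:: v0; v1] _ ([:: v2 & r] ++ [:: v0])).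
      by move: adjvs; rewrite vsE.
    by move=> x /v3_in/linkc.
  - split; first by apply: contra cvs; apply: r_in.
    + by rewrite size_cat addn1.
    + apply: (@close_adjacent_infix [:: v0; v1; v2; v0] _ [::]).
      by move: adjvs; rewrite cats0 vsE.
    + by move=> x /r_in/linkc.
exists L', (es' ++ [:: (c, v1); (c, v0); (c, v2)]), Ds; split.
- by move: HP3; rewrite cats0.
- by rewrite -size_eq0 size_cat addn_eq0 andbF.
- by move=> w /hDs[].
have cert v z : v \in [:: v0; v1; v2] -> z \in [:: v0; v1; v2] -> adj v z ->
    certified (es' ++ [:: (c, v1); (c, v0); (c, v2)]) Ds (c, v).
  move=> vv zv vz; exists z; split=> /=; [|exact: Or31|].
    by apply: linked_sub (linkc _ (vin _ zv)) => e ee; rewrite mem_cat ee orbT.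
  move=> w /hDs[sw fr _]; apply: size3_fresh sw fr _ _ _ _.
  - by rewrite /= !inE !cv // (negbTE (adj_neq vz)).
  - exact: mem_head.
  - by rewrite inE vsL ?orbT // vin.
  - by rewrite inE vsL ?orbT // vin.
move=> e; rewrite mem_cat !inE => /or4P[/hes'[_ //]|/eqP->|/eqP->|/eqP->].
- by apply: (cert _ v2) => //; rewrite !inE eqxx ?orbT.
- by apply: (cert _ v2) => //; rewrite !inE eqxx ?orbT.
- by apply: (cert _ v0); rewrite ?inE ?eqxx ?orbT //; apply: adj_sym.
Qed.

Lemma cyclically_adjacent_rot k vs : k < size vs ->
  cyclically_adjacent vs -> cyclically_adjacent (rot k vs).
Proof.
move=> km h x0 i; rewrite size_rot => im.
have m0 : 0 < size vs by apply: leq_ltn_trans im.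
have kW := ltnW km; rewrite !nth_rot ?ltn_pmod //.
have [h1 h2] := h x0 ((k + i) %% size vs) (ltn_pmod _ m0).
have e1 : ((k + i) %% size vs).+1 %% size vs = (k + i.+1 %% size vs) %% size vs.
  by rewrite modnDmr -addn1 modnDml addn1 addnS.
have e2 : ((k + i) %% size vs).+2 %% size vs = (k + i.+2 %% size vs) %% size vs.
  by rewrite modnDmr -addn2 modnDml addn2 !addnS.
by rewrite -e1 -e2.
Qed.

Theorem irreducible_filling vs :
  cyclically_adjacent vs -> 3 < size vs -> P vs [::] [:: vs] ->
  exists L es Ws, filled L es Ws.
Proof.
case: vs => [//|x0 vs'] cyc sz HP; set vs := x0 :: vs' in cyc sz HP *.
have [/allP all3|/allPn[k]] :=
    boolP (all (fun i => nth x0 vs i == nth x0 vs ((i + 3) %% size vs)) (iota 0 (size vs))).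
  apply: (@filling_periodic x0 vs vs) => // i im; apply/eqP; apply: all3.
  by rewrite mem_iota add0n.
rewrite mem_iota add0n => /andP[_ km] ne.
apply: (@filling_nonperiodic x0 (rot k vs) vs).
- exact: cyclically_adjacent_rot.
- by rewrite size_rot.
- by move=> x; rewrite mem_rot.
- by apply: (@P_rot vs [::] [::] vs [::] k HP).
have kW := ltnW km; have m0 := leq_ltn_trans (leq0n k) km.
by rewrite !nth_rot ?addn0 ?(modn_small km).
Qed.

End Fillings.

Import Order.TTheory GRing.Theory Num.Theory.
Import numFieldNormedType.Exports.

Local Open Scope classical_set_scope.
Local Open Scope ring_scope.

(** * The disk *)

Lemma within_continuous_comp (T U V : topologicalType) (A : set T) (B : set U)
    (f : T -> U) (g : U -> V) :
  {within A, continuous f} -> {within B, continuous g} ->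
  (forall x, A x -> B (f x)) -> {within A, continuous (g \o f)}.
Proof.
move=> /subspace_continuousP cf /subspace_continuousP cg AB.
apply/subspace_continuousP => x Ax W /(cg _ (AB _ Ax)) nW.
have := cf x Ax _ nW; rewrite /= /within /= !nbhs_simpl /=.
by apply: filterS => z h Az; exact: (h Az (AB _ Az)).
Qed.

Lemma continuous_pairing (X Y Z : topologicalType) (f : X -> Y) (g : X -> Z) :
  continuous f -> continuous g -> continuous (fun x => (f x, g x)).
Proof. by move=> cf cg x; apply: cvg_pair; [exact: cf|exact: cg]. Qed.

Lemma within_eq_continuous (T U : topologicalType) (A : set T) (f g : T -> U) :
  (forall x, A x -> f x = g x) -> {within A, continuous f} ->
  {within A, continuous g}.
Proof. by move=> fg; apply: subspace_eq_continuous => x /set_mem/fg. Qed.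

(* A continuous map on a compact set is a quotient map onto its Hausdorff
   image. *)
Lemma compact_quotient_continuous (T U V : topologicalType) (A : set T)
    (q : T -> U) (f : T -> V) (g : U -> V) :
  compact A -> hausdorff_space U ->
  {within A, continuous q} -> {within A, continuous f} ->
  (forall x, A x -> g (q x) = f x) -> {within q @` A, continuous g}.
Proof.
move=> cA hU cq cf gq; apply/continuous_closedP => C cC.
have /continuous_closedP/(_ _ cC)/closed_subspaceP[W cW WA] := cf.
apply/closed_subspaceP; exists (q @` (A `&` W)).
  apply: (compact_closed hU); apply: continuous_compact.
    by apply: continuous_subspaceW cq => x [].
  exact: compact_closedI.
apply/seteqP; split=> y.
  move=> [[x [Ax Wx] <-] _]; split; last by exists x.
  have : (W `&` A) x by [].
  by rewrite WA => -[fC _]; change (C (g (q x))); rewrite gq.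
move=> [/= Cy [x Ax xy]]; split; last by exists x.
exists x => //; split=> //.
have : (f @^-1` C `&` A) x by split=> //; change (C (f x)); rewrite -gq // xy.
by rewrite -WA => -[].
Qed.

Lemma homeomorphism_comp (T U V : topologicalType) (A : set T) (B : set U)
    (C : set V) (f : T -> U) (g : U -> V) :
  homeomorphism A B f -> homeomorphism B C g -> homeomorphism A C (g \o f).
Proof.
move=> [bf cf [f' cf' ff']] [bg cg [g' cg' gg']].
have [fun_f inj_f surj_f] := bf; have [fun_g inj_g surj_g] := bg.
have AB x : A x -> B (f x) by move=> Ax; apply: fun_f.
split.
- exact: set_bij_comp bf bg.
- exact: within_continuous_comp cf cg AB.
- exists (f' \o g'); last by move=> x Ax /=; rewrite gg' ?ff' //; exact: AB.
  apply: within_continuous_comp cg' cf' _ => z /surj_g[y By <-].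
  by rewrite gg'.
Qed.

Lemma homeomorphism_sub (T U : topologicalType) (A D : set T) (B : set U)
    (f : T -> U) :
  homeomorphism A B f -> D `<=` A -> homeomorphism D (f @` D) f.
Proof.
move=> [[fun_f inj_f surj_f] cf [g cg gf]] DA; split.
- split; first by move=> x Dx; exists x.
    by move=> x y /set_mem/DA/mem_set ? /set_mem/DA/mem_set ?; apply: inj_f.
  by [].
- exact: continuous_subspaceW cf.
- exists g; last by move=> x /DA; apply: gf.
  by apply: continuous_subspaceW cg => _ [x /DA Ax <-]; apply: fun_f.
Qed.

(** The image is the preimage of [D] under the inverse map, which is continuous on the open set
    [B]. *)
Lemma homeomorphism_open (T U : topologicalType) (A D : set T) (B : set U)
    (f : T -> U) :
  homeomorphism A B f -> open B -> open D -> D `<=` A -> open (f @` D).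
Proof.
move=> [[fun_f inj_f surj_f] cf [g cg gf]] oB oD DA.
have -> : f @` D = B `&` g @^-1` D.
  apply/seteqP; split=> y.
    by move=> [x Dx <-]; split; [apply: fun_f; apply: DA|rewrite /= gf //; apply: DA].
  by move=> [/surj_f[x Ax <-]] /=; rewrite gf // => Dx; exists x.
by move: cg; rewrite continuous_open_subspace // continuous_inP //; apply.
Qed.

Section Disk.
Variable R : realType.
Implicit Types (p : R * R) (s t x y : R).

Lemma plane_hausdorff : hausdorff_space (R * R)%type.
Proof. exact: (@norm_hausdorff R (R * R)%type). Qed.

Local Notation cp := (@circle_point R).

Lemma continuous_fst2 : continuous (fun p => p.1).
Proof. by move=> p; apply: cvg_fst. Qed.

Lemma continuous_snd2 : continuous (fun p => p.2).
Proof. by move=> p; apply: cvg_snd. Qed.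

Lemma continuous_circle_point : continuous cp.
Proof.
have c2 : continuous (fun t : R => 2 * pi * t : R).
  by move=> t; apply: cvgM; [apply: cvg_cst|exact: cvg_id].
apply: continuous_pairing => t.
  by apply: (continuous_comp (g := cos)); [exact: c2|exact: continuous_cos].
by apply: (continuous_comp (g := sin)); [exact: c2|exact: continuous_sin].
Qed.

Definition sqnorm p : R := p.1 ^+ 2 + p.2 ^+ 2.

Lemma sqnorm_circle_point t : sqnorm (cp t) = 1.
Proof. by rewrite /sqnorm /= cos2Dsin2. Qed.

Lemma continuous_sqnorm : continuous sqnorm.
Proof.
move=> p; apply: cvgD; rewrite expr2; apply: cvgM;
  by [exact: continuous_fst2|exact: continuous_snd2].
Qed.

Lemma circle_pointD1 t : cp (t + 1) = cp t.
Proof.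
by rewrite /circle_point mulrDr mulr1 mulr_natl cosD2pi sinD2pi.
Qed.

Lemma circle_point0 : cp 0 = (1, 0).
Proof. by rewrite /circle_point mulr0 cos0 sin0. Qed.

Lemma circle_point1 : cp 1 = (1, 0).
Proof. by have := circle_pointD1 0; rewrite add0r circle_point0. Qed.

Lemma circle_point_half : cp (1 / 2) = (-1, 0).
Proof.
have -> : cp (1 / 2) = (cos pi, sin pi).
  by rewrite /circle_point mulrA mulr1 mulrAC divff // mul1r.
by rewrite cospi sinpi.
Qed.

Lemma sin_upper t : 0 <= t <= 1 / 2 -> 0 <= sin (2 * pi * t).
Proof.
move=> /andP[t0 t1]; apply: sin_ge0_pi; have := pi_gt0 R => pi0.
by rewrite !mulr_ge0 //=; [nra|lra].
Qed.

Lemma sin_upper_gt0 t : 0 < t < 1 / 2 -> 0 < sin (2 * pi * t).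
Proof.
move=> /andP[t0 t1]; apply: sin_gt0_pi; have := pi_gt0 R => pi0.
by rewrite !mulr_gt0 //=; nra.
Qed.

Lemma shift_half t : 2 * pi * t = 2 * pi * (t - 1 / 2) + pi :> R.
Proof. by field. Qed.

Lemma sin_lower t : 1 / 2 <= t <= 1 -> sin (2 * pi * t) <= 0.
Proof.
by move=> /andP[t0 t1]; rewrite shift_half sinDpi oppr_le0; apply: sin_upper; lra.
Qed.

Lemma sin_lower_lt0 t : 1 / 2 < t < 1 -> sin (2 * pi * t) < 0.
Proof.
by move=> /andP[t0 t1]; rewrite shift_half sinDpi oppr_lt0; apply: sin_upper_gt0; lra.
Qed.

Lemma cos_inj_upper s t : 0 <= s <= 1 / 2 -> 0 <= t <= 1 / 2 ->
  cos (2 * pi * s) = cos (2 * pi * t) -> s = t.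
Proof.
move=> /andP[s0 s1] /andP[t0 t1]; have pi0 := pi_gt0 R.
have itv (u : R) : 0 <= u -> u <= 1 / 2 -> 2 * pi * u \in `[0, pi].
  by move=> u0 u1; rewrite in_itv /= !mulr_ge0 //=; [nra|lra].
move=> /cos_inj-/(_ (itv _ s0 s1) (itv _ t0 t1)).
by apply: mulfI; rewrite mulf_neq0 ?pnatr_eq0 // gt_eqF.
Qed.

Lemma circle_point_inj s t : 0 <= s < 1 -> 0 <= t < 1 -> cp s = cp t -> s = t.
Proof.
move=> /andP[s0 s1] /andP[t0 t1] [ec es].
have [hs|hs] := leP s (1 / 2); have [ht|ht] := leP t (1 / 2).
- by apply: cos_inj_upper ec; rewrite ?s0 ?t0.
- have h1 : 0 <= sin (2 * pi * s) by apply: sin_upper; rewrite s0.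
  have h2 : sin (2 * pi * t) < 0 by apply: sin_lower_lt0; rewrite ht.
  by move: h1; rewrite es leNgt h2.
- have h1 : 0 <= sin (2 * pi * t) by apply: sin_upper; rewrite t0.
  have h2 : sin (2 * pi * s) < 0 by apply: sin_lower_lt0; rewrite hs.
  by move: h1; rewrite -es leNgt h2.
- move: ec; rewrite (shift_half s) (shift_half t) !cosDpi => /oppr_inj ec.
  suff : s - 1 / 2 = t - 1 / 2 by move/addIr.
  by apply: cos_inj_upper ec; apply/andP; split; lra.
Qed.

Lemma circle_point_surj p : sqnorm p = 1 -> exists2 s, 0 <= s < 1 & p = cp s.
Proof.
case: p => x y; rewrite /sqnorm /= => xy.
have pi0 := pi_gt0 R.
have x1 : -1 <= x <= 1 by apply/andP; split; nra.
have a0 := acos_ge0 x1; have a1 := acos_lepi x1.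
have xK : cos (acos x) = x by rewrite acosK // in_itv.
have sE : sin (acos x) = `|y|.
  by rewrite sin_acos // -(sqrtr_sqr y); congr (Num.sqrt _); lra.
have pi2 : 2 * pi != 0 :> R by rewrite mulf_neq0 ?pnatr_eq0 // gt_eqF.
have [y0|y0] := leP 0 y.
  exists (acos x / (2 * pi)).
    rewrite divr_ge0 ?mulr_ge0 ?pi_ge0 //= ltr_pdivrMr ?mulr_gt0 //; lra.
  by rewrite /circle_point mulrC divfK // xK sE ger0_norm.
have ax : 0 < acos x.
  rewrite lt_neqAle a0 andbT; apply/eqP => E; move: sE; rewrite -E sin0.
  by move=> /esym/normr0_eq0 yE; move: y0; rewrite yE ltxx.
exists (1 - acos x / (2 * pi)).
  rewrite subr_ge0 ler_pdivrMr ?mulr_gt0 // ltrBlDr ltrDl divr_gt0 ?mulr_gt0 // andbT.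
  by rewrite mul1r; lra.
have -> : cp (1 - acos x / (2 * pi)) = (cos (- acos x), sin (- acos x)).
  rewrite /circle_point mulrBr mulr1 [2 * pi * (_ / _)]mulrC divfK // addrC mulr_natl.
  by rewrite cosD2pi sinD2pi.
by rewrite cosN sinN xK sE ltr0_norm // opprK.
Qed.

Definition polar p : R * R := (p.1 * (cp p.2).1, p.1 * (cp p.2).2).

Lemma continuous_polar : continuous polar.
Proof.
have c1 : continuous (fun p => (cp p.2).1).
  move=> p; apply: (continuous_comp (f := fun p => cp p.2) (g := fst)).
    apply: (continuous_comp (f := snd)); [exact: continuous_snd2|exact: continuous_circle_point].
  exact: continuous_fst2.
have c2 : continuous (fun p => (cp p.2).2).
  move=> p; apply: (continuous_comp (f := fun p => cp p.2) (g := snd)).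
    apply: (continuous_comp (f := snd)); [exact: continuous_snd2|exact: continuous_circle_point].
  exact: continuous_snd2.
by apply: continuous_pairing => p; apply: cvgM;
  [exact: continuous_fst2|exact: c1|exact: continuous_fst2|exact: c2].
Qed.

Lemma sqnorm_polar p : sqnorm (polar p) = p.1 ^+ 2.
Proof. by rewrite /sqnorm /polar /= !exprMn -mulrDr cos2Dsin2 mulr1. Qed.

Lemma polar_surj p : exists2 s, 0 <= s < 1 & p = polar (Num.sqrt (sqnorm p), s).
Proof.
have n0 : 0 <= sqnorm p by rewrite addr_ge0 ?sqr_ge0.
have nE := sqr_sqrtr n0.
have [r0|r0] := eqVneq (Num.sqrt (sqnorm p)) 0.
  exists 0; first by rewrite lexx ltr01.
  move: nE; rewrite r0 expr0n /= /polar /= !mul0r /sqnorm => /esym/eqP.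
  rewrite paddr_eq0 ?sqr_ge0 // !sqrf_eq0 => /andP[/eqP p1 /eqP p2].
  by case: p p1 p2 {n0 r0} => /= a b -> ->.
set r := Num.sqrt _ in r0 nE *.
have [|s s01 sE] := @circle_point_surj (p.1 / r, p.2 / r).
  rewrite /sqnorm /= !expr_div_n -mulrDl -/(sqnorm p) -nE divff //.
  by rewrite sqrf_eq0.
exists s => //; have -> : polar (r, s) = (r * (cp s).1, r * (cp s).2) by [].
by rewrite -sE /= ![r * _]mulrC !divfK //; case: (p).
Qed.

Definition unit_square : set (R * R) := unit_interval R `*` unit_interval R.

Lemma compact_unit_square : compact unit_square.
Proof. by apply: compact_setX; exact: segment_compact. Qed.

Lemma in_unit_interval t : unit_interval R t <-> 0 <= t <= 1.
Proof. by rewrite /unit_interval /= in_itv. Qed.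

(** Polar coordinates present the closed disk as a quotient of a compact square, where both
    compactness of the disk and continuity of maps out of it can be tested. *)
Lemma closed_diskE : closed_disk R = polar @` unit_square.
Proof.
apply/seteqP; split=> p.
  rewrite /closed_disk /= -/(sqnorm p) => p1.
  have [s /andP[s0 s1] pE] := polar_surj p.
  exists (Num.sqrt (sqnorm p), s) => //; split=> /=; apply/in_unit_interval.
    by rewrite sqrtr_ge0 /= -sqrtr1 ler_sqrt.
  by rewrite s0 ltW.
move=> [[r s] [/= /in_unit_interval/andP[r0 r1] _] <-].
change (is_true (sqnorm (polar (r, s)) <= 1)).
by rewrite sqnorm_polar /= expr_le1.
Qed.

Lemma compact_closed_disk : compact (closed_disk R).
Proof.
rewrite closed_diskE; apply: continuous_compact compact_unit_square.
by apply: continuous_subspaceT; exact: continuous_polar.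
Qed.

Lemma open_open_disk : open (open_disk R).
Proof.
have -> : open_disk R = sqnorm @^-1` [set t | t < 1] by [].
by move/continuousP: continuous_sqnorm; apply; exact: open_lt.
Qed.

Lemma open_sub_closed_disk : open_disk R `<=` closed_disk R.
Proof. by move=> p /=; apply: ltW. Qed.

Lemma circle_point_closed_disk t : closed_disk R (cp t).
Proof. by rewrite /closed_disk /= -/(sqnorm (cp t)) sqnorm_circle_point. Qed.

Lemma closed_disk_cases p : closed_disk R p ->
  open_disk R p \/ exists2 s, 0 <= s < 1 & p = cp s.
Proof.
rewrite /closed_disk /open_disk /= -!/(sqnorm p) le_eqVlt => /predU1P[/circle_point_surj|]; by [right|left].
Qed.

(** * Reparametrization of the disk by the angle *)

Section AngularHomeo.
Variable h : R -> R.
Hypothesis h_cont : continuous h.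
Hypothesis h0 : h 0 = 0.
Hypothesis h1 : h 1 = 1.

(** Arbitrary at the origin, where the radius is zero and [angular] ignores it; unique elsewhere. *)
Definition angle p : R := get [set s | 0 <= s < 1 /\ p = polar (Num.sqrt (sqnorm p), s)].

Definition angular p : R * R := polar (Num.sqrt (sqnorm p), h (angle p)).

Lemma angularE r s : 0 <= r -> 0 <= s <= 1 -> angular (polar (r, s)) = polar (r, h s).
Proof.
move=> r0 /andP[s0 s1]; rewrite /angular sqnorm_polar /= sqrtr_sqr ger0_norm //.
have [r00|rn0] := eqVneq r 0; first by rewrite /polar r00 /= !mul0r.
have [/andP[a0 a1] aE] : 0 <= angle (polar (r, s)) < 1 /\
    polar (r, s) = polar (r, angle (polar (r, s))).
  have [t t01 tE] := polar_surj (polar (r, s)).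
  have [a01 aE] := getPex (ex_intro [set t | 0 <= t < 1 /\
    polar (r, s) = polar (Num.sqrt (sqnorm (polar (r, s))), t)] t (conj t01 tE)).
  split; first exact: a01.
  transitivity (polar (Num.sqrt (sqnorm (polar (r, s))), angle (polar (r, s)))).
    exact: aE.
  by congr (polar (_, _)); rewrite sqnorm_polar /= sqrtr_sqr ger0_norm.
have cpE : cp s = cp (angle (polar (r, s))).
  by move: aE => [] /(mulfI rn0) e1 /(mulfI rn0) e2; rewrite /circle_point e1 e2.
move: s1; rewrite le_eqVlt => /predU1P[s1|s1]; last first.
  by congr (polar (r, h _)); symmetry; apply: circle_point_inj cpE; rewrite ?s0 ?a0.
have -> : angle (polar (r, s)) = 0.
  symmetry; apply: circle_point_inj; rewrite ?lexx ?ltr01 ?a0 //.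
  by rewrite -cpE s1 circle_point0 circle_point1.
have pE t : polar (r, t) = (r * (cp t).1, r * (cp t).2) by [].
by rewrite s1 h0 h1 !pE circle_point0 circle_point1.
Qed.

Lemma angular_circle s : 0 <= s <= 1 -> angular (cp s) = cp (h s).
Proof.
move=> s01; have polar1 t : polar (1, t) = cp t by rewrite /polar /= !mul1r.
by rewrite -!polar1 angularE.
Qed.

Lemma sqnorm_angular p : sqnorm (angular p) = sqnorm p.
Proof. by rewrite sqnorm_polar /= sqr_sqrtr // addr_ge0 ?sqr_ge0. Qed.

Lemma angular_continuous : {within closed_disk R, continuous angular}.
Proof.
rewrite closed_diskE.
apply: (@compact_quotient_continuous _ _ _ unit_square polar
  (fun q => polar (q.1, h q.2))).
- exact: compact_unit_square.
- exact: plane_hausdorff.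
- by apply: continuous_subspaceT; exact: continuous_polar.
- apply: continuous_subspaceT => q.
  apply: (continuous_comp (f := fun q : R * R => (q.1, h q.2)) (g := polar)); last exact: continuous_polar.
  apply: continuous_pairing; first exact: continuous_fst2.
  move=> p; apply: (continuous_comp (f := snd) (g := h)); [exact: continuous_snd2|exact: h_cont].
- move=> [r s] [/= /in_unit_interval/andP[r0 r1] /in_unit_interval s01].
  exact: angularE.
Qed.

End AngularHomeo.

Lemma angularK (h k : R -> R) : (forall t, 0 <= t <= 1 -> 0 <= h t <= 1) ->
  h 0 = 0 -> h 1 = 1 -> k 0 = 0 -> k 1 = 1 ->
  (forall t, 0 <= t <= 1 -> k (h t) = t) ->
  forall p, angular k (angular h p) = p.
Proof.
move=> h01 h0 h1 k0 k1 hk p; have [s /andP[s0 s1] ->] := polar_surj p.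
have s01 : 0 <= s <= 1 by rewrite s0 ltW.
by rewrite (angularE h0 h1) ?sqrtr_ge0 // (angularE k0 k1) ?sqrtr_ge0 ?h01 // hk.
Qed.

Lemma angular_homeomorphism (h k : R -> R) :
  continuous h -> continuous k ->
  (forall t, 0 <= t <= 1 -> 0 <= h t <= 1) ->
  (forall t, 0 <= t <= 1 -> 0 <= k t <= 1) ->
  h 0 = 0 -> h 1 = 1 -> k 0 = 0 -> k 1 = 1 ->
  (forall t, 0 <= t <= 1 -> k (h t) = t) ->
  (forall t, 0 <= t <= 1 -> h (k t) = t) ->
  homeomorphism (open_disk R) (open_disk R) (angular h).
Proof.
move=> ch ck h01 k01 h0 h1 k0 k1 hk kh.
have diskE g p : open_disk R (angular g p) = open_disk R p.
  by change ((sqnorm (angular g p) < 1 : Prop) = (sqnorm p < 1)); rewrite sqnorm_angular.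
have hK := angularK h01 h0 h1 k0 k1 hk; have kK := angularK k01 k0 k1 h0 h1 kh.
split.
- split.
  + by move=> p /=; rewrite diskE.
  + by move=> p q _ _ E; rewrite -(hK p) E hK.
  + by move=> p Dp; exists (angular k p); rewrite ?diskE.
- by apply: continuous_subspaceW open_sub_closed_disk _; apply: angular_continuous.
- exists (angular k) => //.
  by apply: continuous_subspaceW open_sub_closed_disk _; apply: angular_continuous.
Qed.

(** * Half disks *)

Definition half_height x : R := Num.sqrt (1 - x ^+ 2).

(* Affine on each vertical fibre of the disk, onto its upper ([e = 1]) or lower
   ([e = -1]) half. *)
Definition half_disk (e : R) p : R * R := (p.1, (p.2 + e * half_height p.1) / 2).

Definition open_half_disk (e : R) : set (R * R) :=
  [set p | open_disk R p /\ 0 < e * p.2].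

Lemma continuous_half_height : continuous half_height.
Proof.
move=> x; apply: (continuous_comp (f := fun x => 1 - x ^+ 2) (g := @Num.sqrt R)).
  by apply: cvgB; [apply: cvg_cst|rewrite expr2; apply: cvgM; exact: cvg_id].
exact: sqrt_continuous.
Qed.

Lemma continuous_half_height_fst e : continuous (fun p => e * half_height p.1).
Proof.
move=> p; apply: cvgM; first exact: cvg_cst.
apply: (continuous_comp (f := fst) (g := half_height)); [exact: continuous_fst2|exact: continuous_half_height].
Qed.

Lemma continuous_half_disk e : continuous (half_disk e).
Proof.
apply: continuous_pairing; first exact: continuous_fst2.
move=> p; apply: cvgM; last exact: cvg_cst.
by apply: cvgD; [exact: continuous_snd2|exact: continuous_half_height_fst].
Qed.

Lemma half_height_ge0 x : 0 <= half_height x.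
Proof. exact: sqrtr_ge0. Qed.

Lemma half_height_sqr x : x ^+ 2 <= 1 -> half_height x ^+ 2 = 1 - x ^+ 2.
Proof. by move=> x1; rewrite sqr_sqrtr // subr_ge0. Qed.

Lemma open_diskP x y : open_disk R (x, y) -> - half_height x < y < half_height x.
Proof.
rewrite /open_disk /= => xy; have x1 : x ^+ 2 <= 1 by nra.
have w0 := half_height_ge0 x; have w2 := half_height_sqr x1.
by apply/andP; split; nra.
Qed.

Lemma half_disk_homeomorphism e : e = 1 \/ e = -1 ->
  homeomorphism (open_disk R) (open_half_disk e) (half_disk e).
Proof.
move=> e1; pose g p : R * R := (p.1, 2 * p.2 - e * half_height p.1).
have gK p : g (half_disk e p) = p.
  by case: p => x y; rewrite /g /half_disk /=; congr (_, _); field.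
have Kg p : half_disk e (g p) = p.
  by case: p => x y; rewrite /g /half_disk /=; congr (_, _); field.
split.
- split.
  + move=> [x y] /= xy; have /andP[y1 y2] := open_diskP xy.
    move: xy; rewrite /open_half_disk /open_disk /= => xy.
    have x1 : x ^+ 2 <= 1 by nra.
    have w0 := half_height_ge0 x; have w2 := half_height_sqr x1.
    by case: e1 => ->; split; nra.
  + by move=> p q _ _ E; rewrite -(gK p) E gK.
  + move=> [x y] [xy ey]; exists (g (x, y)) => //.
    have /andP[y1 y2] := open_diskP xy.
    move: xy ey; rewrite /open_disk /g /= => xy ey.
    have x1 : x ^+ 2 <= 1 by nra.
    have w0 := half_height_ge0 x; have w2 := half_height_sqr x1.
    by case: e1 ey => ->; nra.
- by apply: continuous_subspaceT; apply: continuous_half_disk.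
- exists g => //; apply: continuous_subspaceT.
  apply: continuous_pairing; first exact: continuous_fst2.
  move=> p; apply: cvgB; last exact: continuous_half_height_fst.
  by apply: cvgM; [exact: cvg_cst|exact: continuous_snd2].
Qed.

(** On the half circle of the side of [e] the height equals [e * half_height], an end of the fibre
    which the affine map fixes. The opposite end goes to the diameter, so the circle becomes an old
    half circle followed by the diameter. *)
Lemma half_disk_circle_fixed e p : e = 1 \/ e = -1 -> sqnorm p = 1 ->
  0 <= e * p.2 -> half_disk e p = p.
Proof.
case: p => x y; rewrite /sqnorm /= => e1 xy ey.
have x1 : x ^+ 2 <= 1 by nra.
have w0 := half_height_ge0 x; have w2 := half_height_sqr x1.
rewrite /half_disk /=; congr (_, _).
by case: e1 ey => ->; nra.
Qed.

Lemma half_disk_circle_flat e p : e = 1 \/ e = -1 -> sqnorm p = 1 ->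
  e * p.2 <= 0 -> half_disk e p = (p.1, 0).
Proof.
case: p => x y; rewrite /sqnorm /= => e1 xy ey.
have x1 : x ^+ 2 <= 1 by nra.
have w0 := half_height_ge0 x; have w2 := half_height_sqr x1.
rewrite /half_disk /=; congr (_, _).
by case: e1 ey => ->; nra.
Qed.

Lemma half_disk_closed e p : e = 1 \/ e = -1 -> closed_disk R p ->
  closed_disk R (half_disk e p).
Proof.
case: p => x y e1; rewrite /closed_disk /= => xy.
have x1 : x ^+ 2 <= 1 by nra.
have w0 := half_height_ge0 x; have w2 := half_height_sqr x1.
by case: e1 => ->; nra.
Qed.

End Disk.

(** * Arcs and boundary walks *)

Section Arcs.
Variables (R : realType) (S : topologicalType).
Hypothesis S_hausdorff : hausdorff_space S.
Implicit Types (e : set S) (u v : S) (a b s t : R) (c : R -> S).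

Lemma runs_along_comp a b c e u v a' b' (k : R -> R) :
  runs_along a b c e u v -> continuous k -> set_bij `[a', b'] `[a, b] k ->
  runs_along a' b' (c \o k) e (c (k a')) (c (k b')).
Proof.
move=> [cc ic <- _ _] ck bk; have [fk ik sk] := bk; split=> //.
- apply: within_continuous_comp cc _; first exact: continuous_subspaceT.
  by move=> x xab; apply: fk.
- move=> x y /set_mem xab /set_mem yab /= E; apply: ik; rewrite ?inE //.
  by apply: ic => //; apply: mem_set; apply: fk.
- apply/seteqP; split=> _ [x xab <-] /=; first by exists (k x) => //; apply: fk.
  by have [y yab <-] := sk _ xab; exists y.
Qed.

Lemma runs_along_eq a b c c' e u v : a <= b ->
  (forall t, a <= t <= b -> c t = c' t) ->
  runs_along a b c e u v -> runs_along a b c' e u v.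
Proof.
move=> ab cc' [cc ic <- <- <-].
have cE t : `[a, b]%classic t -> c t = c' t by rewrite /= in_itv; apply: cc'.
split.
- exact: within_eq_continuous cc.
- by move=> x y xab yab; rewrite -!cE; [apply: ic|apply: set_mem..].
- by apply/seteqP; split=> _ [x xab <-]; exists x; rewrite ?cE.
- by rewrite cE //= in_itv /= lexx.
- by rewrite cE //= in_itv /= lexx andbT.
Qed.

Lemma set_bij_affine a b (m n : R) : 0 < m ->
  set_bij `[a, b] `[m * a + n, m * b + n] (fun t => m * t + n).
Proof.
move=> m0; split.
- by move=> t /=; rewrite !in_itv /= !lerD2r !ler_pM2l.
- by move=> s t _ _ /addIr; apply: mulfI; rewrite gt_eqF.
- move=> y /=; rewrite in_itv /= => /andP[y1 y2]; exists ((y - n) / m); last first.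
    by rewrite mulrC divfK ?subrK // gt_eqF.
  rewrite /= in_itv /= ler_pdivlMr // ler_pdivrMr // lerBrDr lerBlDr.
  by rewrite ![_ * m]mulrC y1.
Qed.

Lemma set_bij_reverse a b (n : R) :
  set_bij `[a, b] `[n - b, n - a] (fun t => n - t).
Proof.
split.
- by move=> t /=; rewrite !in_itv /= !lerD2l !lerN2 andbC.
- by move=> s t _ _ /addrI /oppr_inj.
- move=> y /=; rewrite in_itv /= => /andP[y1 y2]; exists (n - y); last by rewrite subKr.
  by rewrite /= in_itv /= lerBrDr -lerBrDl y2 lerBlDr -lerBlDl.
Qed.

Lemma continuous_affine (m n : R) : continuous (fun t : R => m * t + n).
Proof.
by move=> t; apply: cvgD; [apply: cvgM; [exact: cvg_cst|exact: cvg_id]|exact: cvg_cst].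
Qed.

Lemma continuous_reverse (n : R) : continuous (fun t : R => n - t).
Proof. by move=> t; apply: cvgB; [exact: cvg_cst|exact: cvg_id]. Qed.

Lemma runs_along_affine a b c e u v (m n : R) : 0 < m ->
  runs_along (m * a + n) (m * b + n) c e u v ->
  runs_along a b (fun t => c (m * t + n)) e u v.
Proof.
move=> m0 /[dup] [[_ _ _ <- <-]] h.
exact: (runs_along_comp h (@continuous_affine m n) (@set_bij_affine a b m n m0)).
Qed.

Lemma runs_along_reverse a b c e u v (n : R) :
  runs_along (n - b) (n - a) c e u v ->
  runs_along a b (fun t => c (n - t)) e v u.
Proof.
move=> /[dup] [[_ _ _ <- <-]] h.
exact: (runs_along_comp h (@continuous_reverse n) (@set_bij_reverse a b n)).
Qed.

Lemma runs_along_joins a b c e u v : a < b ->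
  runs_along a b c e u v -> joins R e u v.
Proof.
move=> ab h; exists (fun t => c ((b - a) * t + a)).
apply: runs_along_affine; first by rewrite subr_gt0.
by rewrite mulr0 add0r mulr1 subrK.
Qed.

Lemma joins_sym e u v : joins R e u v -> joins R e v u.
Proof.
move=> [c h]; exists (fun t => c (1 - t)).
by apply: runs_along_reverse; rewrite subrr subr0.
Qed.

Lemma runs_along_ends a b c e u v : a < b -> runs_along a b c e u v ->
  [/\ e u, e v & u <> v].
Proof.
move=> ab [_ ic <- <- <-].
have aab : `[a, b]%classic a by rewrite /= in_itv /= lexx ltW.
have bab : `[a, b]%classic b by rewrite /= in_itv /= lexx ltW.
split; [by exists a|by exists b|].
move=> /ic; rewrite !inE => /(_ aab bab) E.
by move: ab; rewrite E ltxx.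
Qed.

Lemma joins_ends e u v : joins R e u v -> [/\ e u, e v & u <> v].
Proof. by move=> [c]; apply: runs_along_ends; exact: ltr01. Qed.

Lemma joins_compact e u v : joins R e u v -> compact e.
Proof.
by move=> [c [cc _ <- _ _]]; apply: continuous_compact cc _; exact: segment_compact.
Qed.

(** An edge is a bare set, so its ends must be recovered from it. Comparing two parametrizations
    gives a continuous injection of the unit interval into itself taking the values 0 and 1; being
    monotone, it sends 0 to 0 or 1. Continuity of the inverse parametrization comes from
    compactness. *)
Lemma joins_end_unique e u v u' v' : joins R e u v -> joins R e u' v' ->
  u = u' \/ u = v'.
Proof.
move=> [c [cc ic ce <- _]] [d [cd id de <- <-]].
have i01 : `[0, 1]%classic (0 : R) by rewrite /= in_itv /= lexx ler01.
pose g (y : S) : R := get [set t | `[0, 1]%classic t /\ d t = y].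
have gP y : e y -> `[0, 1]%classic (g y) /\ d (g y) = y.
  by rewrite -de => -[t t01 ty]; apply: (getPex (ex_intro [set t | `[0, 1]%classic t /\ d t = y] t (conj t01 ty))).
have gd t : `[0, 1]%classic t -> g (d t) = t.
  move=> t01; have [] := gP (d t); first by rewrite -de; exists t.
  by move=> g01 E; apply: id; rewrite ?inE.
have cg : {within e, continuous g}.
  rewrite -de; apply: (@compact_quotient_continuous _ _ _ _ d (fun t : R => t)) => //.
    exact: segment_compact.
  by apply: continuous_subspaceT => t; exact: cvg_id.
have ec t : `[0, 1]%classic t -> e (c t) by move=> t01; rewrite -ce; exists t.
have ck : {within `[0, 1]%classic, continuous (g \o c)}.
  exact: within_continuous_comp cc cg _.
have dk t : `[0, 1]%classic t -> d (g (c t)) = c t by move=> /ec/gP[].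
have ik : {in `[0, 1]%R &, injective (g \o c)}.
  move=> s t s01 t01 /= E; apply: ic; rewrite ?inE //.
  by rewrite -[c s]dk // -[c t]dk // E.
have [t0 t001 t0E] : exists2 t, `[0, 1]%classic t & g (c t) = 0.
  have : e (d 0) by rewrite -de; exists 0.
  by rewrite -ce => -[t t01 tE]; exists t => //; rewrite tE gd.
have [t1 t101 t1E] : exists2 t, `[0, 1]%classic t & g (c t) = 1.
  have i1 : `[0, 1]%classic (1 : R) by rewrite /= in_itv /= lexx ler01.
  have : e (d 1) by rewrite -de; exists 1.
  by rewrite -ce => -[t t01 tE]; exists t => //; rewrite tE gd.
have [g01 _] := gP _ (ec _ i01).
move: (t001) (t101) (g01); rewrite /= !in_itv /= => /andP[t00 t01] /andP[t10 t11] /andP[g0 g1].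
have [mono|mono] := itv_continuous_inj_mono ck ik.
- left; rewrite -(dk 0 i01); congr d.
  have [t0z|t0p] := eqVneq t0 0; first by move: t0E; rewrite t0z.
  have := mono 0 t0; rewrite !in_itv /= lexx ler01 t00 t01 lt_def t0p t00.
  by move=> /(_ isT isT isT); rewrite t0E ltNge g0.
- right; rewrite -(dk 0 i01); congr d.
  have [t1z|t1p] := eqVneq t1 0; first by move: t1E; rewrite t1z.
  have := mono t1 0; rewrite !in_itv /= lexx ler01 t10 t11 lt_def t1p t10.
  by move=> /(_ isT isT isT); rewrite t1E ltNge g1.
Qed.

Lemma joins_unique e u v u' v' : joins R e u v -> joins R e u' v' ->
  (u = u' /\ v = v') \/ (u = v' /\ v = u').
Proof.
move=> j j'; have [_ _ uv] := joins_ends j.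
have := joins_end_unique (joins_sym j) j'.
have [uE|uE] := joins_end_unique j j'; move=> -[vE|vE]; try by [left|right].
  by case: uv; rewrite uE vE.
by case: uv; rewrite uE vE.
Qed.

End Arcs.

Section Chains.
Variables (R : realType) (S : topologicalType).
Implicit Types (E : set (set S)) (c : R -> S) (x y : R * S) (l : seq (R * S)).

Local Notation cp := (@circle_point R).

(* [chain E c (t0, v0) [:: (t1, v1); ...]] : [c] runs along edges of [E] from
   [v0] to [v1] during [t0, t1], and so on. *)
Fixpoint chain E c x l : Prop :=
  if l is y :: l' then
    [/\ x.1 < y.1, exists2 e, E e & runs_along x.1 y.1 c e x.2 y.2 & chain E c y l']
  else True.

Lemma chain_cat E c x l1 l2 :
  chain E c x (l1 ++ l2) <-> chain E c x l1 /\ chain E c (last x l1) l2.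
Proof.
elim: l1 x => [|y l1 IH] x /=; first by split=> [|[]].
by split=> [[? ? /IH[]]|[[? ? ?] ?]] //; split=> //; apply/IH.
Qed.

Lemma chain_sub E E' c x l : E `<=` E' -> chain E c x l -> chain E' c x l.
Proof.
move=> EE'; elim: l x => [//|y l IH] x /= [xy [e /EE' Ee re] /IH h]; split=> //.
by exists e.
Qed.

Lemma chain_le E c x l : chain E c x l ->
  forall y, y \in x :: l -> x.1 <= y.1 <= (last x l).1.
Proof.
elim: l x => [|z l IH] x /=; first by move=> _ y; rewrite inE => /eqP->; rewrite lexx.
move=> [xz _ /IH h] y; rewrite inE => /predU1P[->|/h].
  rewrite lexx /=; have /andP[_ zl] := h z (mem_head _ _).
  exact: le_trans (ltW xz) zl.
by move=> /andP[zy ->]; rewrite (le_trans (ltW xz) zy).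
Qed.

(** Serves every change of disk parametrization: only single edges have to be treated. *)
Lemma chain_map E E' c c' (a b : R) (k : R -> R) x l :
  (forall s t e u v, a <= s -> s < t -> t <= b -> E e ->
     runs_along s t c e u v ->
     k s < k t /\ exists2 e', E' e' & runs_along (k s) (k t) c' e' u v) ->
  a <= x.1 -> (last x l).1 <= b -> chain E c x l ->
  chain E' c' (k x.1, x.2) [seq (k y.1, y.2) | y <- l].
Proof.
move=> hk; elim: l x => [//|y l IH] x /= ax lb [xy [e Ee re] hl].
have /andP[_ yb] := chain_le hl (mem_head _ _).
have [kxy ke] := hk _ _ _ _ _ ax xy (le_trans yb lb) Ee re.
by split=> //; apply: IH => //; apply: le_trans ax (ltW xy).
Qed.

Lemma chainP E c x l : chain E c x l <-> forall i, (i < size l)%N ->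
  (nth x (x :: l) i).1 < (nth x l i).1 /\
  exists2 e, E e & runs_along (nth x (x :: l) i).1 (nth x l i).1 c e
     (nth x (x :: l) i).2 (nth x l i).2.
Proof.
elim: l x => [//|y l IH] x; split=> /=.
  move=> [xy re /IH hl] [|i] //= il.
  by have := hl i il; rewrite !(set_nth_default y x) //= ltnW.
move=> h; have [xy re] := h 0%N isT; split=> //; apply/IH => i il.
by have := h i.+1 il; rewrite /= !(set_nth_default y x) //= ltnW.
Qed.

(** A boundary walk based at [v], as a list of timed stops. The explicit return to [v] at time 1
    replaces indices modulo the length, so that walks can be cut and concatenated as lists. *)
Definition disk_walk E (F : set S) (v : S) (w : seq S) : Prop :=
  exists (phi : R * R -> S) (l : seq (R * S)),
    [/\ {within closed_disk R, continuous phi},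
        homeomorphism (open_disk R) F phi,
        chain E (phi \o cp) (0, v) l,
        last (0, v) l = (1, v) & map snd l = rcons w v].

Lemma boundary_walkP (G : drawing S) F v w :
  boundary_walk R G F (v :: w) <-> disk_walk (edges G) F v w.
Proof.
split.
- move=> [phi [t [cphi hphi [t0 t1] tt ht]]]; set vs := v :: w in t1 tt ht.
  pose l := mkseq (fun i => (t i.+1, nth v vs (i.+1 %% size vs))) (size vs).
  have nthl i : (i < size vs)%N -> nth (0, v) l i = (t i.+1, nth v vs (i.+1 %% size vs)).
    by move=> im; rewrite nth_mkseq.
  have nthxl i : (i < size vs)%N -> nth (0, v) ((0, v) :: l) i = (t i, nth v vs i).
    case: i => [|i] im /=; first by rewrite t0.
    by rewrite nthl 1?ltnW // modn_small.
  have sl : size l = size vs by rewrite size_mkseq.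
  exists phi, l; split=> //.
  + apply/chainP => i; rewrite sl => im; rewrite nthl // nthxl //=.
    by split; [exact: tt|exact: ht].
  + rewrite (last_nth (0, v)) sl -[size vs]/(size w).+1 /= nthl // t1.
    by rewrite modnn.
  + apply: (@eq_from_nth _ v); first by rewrite size_map sl size_rcons.
    move=> i; rewrite size_map sl => im; rewrite (nth_map (0, v)) ?sl // nthl //=.
    move: im; rewrite ltnS leq_eqVlt => /predU1P[->|im].
      by rewrite modnn nth_rcons ltnn eqxx.
    by rewrite modn_small ?ltnS //= nth_rcons im.
- move=> [phi [l [cphi hphi hl lastl ml]]]; set vs := v :: w.
  have sl : size l = size vs by have := congr1 size ml; rewrite size_map size_rcons.
  have lastE : nth (0, v) ((0, v) :: l) (size vs) = (1, v).
    by rewrite -sl -(last_nth (0, v)).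
  have nth2 (x0 : S) i : (i < size vs)%N -> (nth (0, v) ((0, v) :: l) i).2 = nth x0 vs i.
    case: i => [//|i] im /=.
    rewrite -[LHS](nth_map _ v snd) ?sl 1?ltnW // ml nth_rcons.
    have im' : (i < size w)%N by move: im; rewrite /vs /= ltnS.
    by rewrite im'; exact: set_nth_default.
  exists phi, (fun i => (nth (0, v) ((0, v) :: l) i).1); split=> //.
  + by rewrite lastE.
  + by move=> i im; have /chainP/(_ i) := hl; rewrite sl => /(_ im)[].
  + move=> x0 i im; have /chainP/(_ i) := hl; rewrite sl => /(_ im)[_].
    rewrite (nth2 x0) //.
    have -> : nth (0, v) l i = nth (0, v) ((0, v) :: l) i.+1 by [].
    suff -> : nth x0 vs (i.+1 %% size vs) = (nth (0, v) ((0, v) :: l) i.+1).2 by [].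
    move: im; rewrite leq_eqVlt => /predU1P[iE|im]; last by rewrite modn_small // (nth2 x0).
    by rewrite iE lastE modnn.
Qed.

Lemma disk_walk_sub E E' F v w : E `<=` E' -> disk_walk E F v w -> disk_walk E' F v w.
Proof.
move=> EE' [phi [l [? ? hl ? ?]]]; exists phi, l; split=> //.
exact: chain_sub hl.
Qed.

Definition rotate (t : R) (p : R * R) : R * R :=
  ((cp t).1 * p.1 - (cp t).2 * p.2, (cp t).2 * p.1 + (cp t).1 * p.2).

Lemma rotateK t s p : rotate t (rotate s p) = rotate (t + s) p.
Proof.
have e : 2 * pi * (t + s) = 2 * pi * t + 2 * pi * s by rewrite mulrDr.
by rewrite /rotate /circle_point e cosD sinD /=; congr (_, _); ring.
Qed.

Lemma rotate0 p : rotate 0 p = p.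
Proof. by rewrite /rotate circle_point0 /=; case: p => x y; congr (_, _) => /=; ring. Qed.

Lemma rotate_circle t s : rotate t (cp s) = cp (s + t).
Proof.
have e : 2 * pi * (s + t) = 2 * pi * s + 2 * pi * t by rewrite mulrDr.
by rewrite /rotate /circle_point e cosD sinD /=; congr (_, _); ring.
Qed.

Lemma sqnorm_rotate t p : sqnorm (rotate t p) = sqnorm p.
Proof.
have := sqnorm_circle_point t; rewrite /sqnorm /rotate /=.
set C := cos _; set D := sin _ => CD.
transitivity ((C ^+ 2 + D ^+ 2) * (p.1 ^+ 2 + p.2 ^+ 2)); first by ring.
by rewrite CD mul1r.
Qed.

Lemma continuous_rotate t : continuous (rotate t).
Proof.
apply: continuous_pairing => p; [apply: cvgB|apply: cvgD];
by apply: cvgM; [exact: cvg_cst|by [exact: continuous_fst2|exact: continuous_snd2]].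
Qed.

Lemma rotate_homeomorphism t : homeomorphism (open_disk R) (open_disk R) (rotate t).
Proof.
have diskE s p : open_disk R (rotate s p) = open_disk R p.
  by change ((sqnorm (rotate s p) < 1 : Prop) = (sqnorm p < 1)); rewrite sqnorm_rotate.
split.
- split.
  + by move=> p /=; rewrite diskE.
  + by move=> p q _ _ E; rewrite -(rotate0 p) -(addNr t) -rotateK E rotateK addNr rotate0.
  + move=> p Dp; exists (rotate (- t) p); first by rewrite diskE.
    by rewrite rotateK subrr rotate0.
- by apply: continuous_subspaceT; exact: continuous_rotate.
- exists (rotate (- t)); first by apply: continuous_subspaceT; exact: continuous_rotate.
  by move=> p _; rewrite rotateK addNr rotate0.
Qed.

(** Turning the disk by the time [t1] of the first stop moves the base point to [u]. The first edge
    is then run last, at angles beyond a full turn, and periodicity of [circle_point] brings it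
    back. *)
Lemma disk_walk_rotate E F v u w : disk_walk E F v (u :: w) -> disk_walk E F u (rcons w v).
Proof.
move=> [phi [[|[t1 u'] l] [cphi hphi hl lastl ml]]]; first by [].
move: ml => -[-> ml] in hl lastl *.
have /= [t10 [e Ee re] hl'] := hl.
have lastl' : last (t1, u) l = (1, v) by [].
have t11 : t1 <= 1 by have /andP[] := chain_le hl' (mem_head _ _); rewrite lastl'.
exists (phi \o rotate t1), ([seq (y.1 - t1, y.2) | y <- l] ++ [:: (1, u)]).
have cpE s : (phi \o rotate t1) (cp s) = phi (cp (s + t1)) by rewrite /= rotate_circle.
have lastm : last (0, u) [seq (y.1 - t1, y.2) | y <- l] = (1 - t1, v).
  by rewrite -(subrr t1) (last_map (fun y : R * S => (y.1 - t1, y.2)) l (t1, u)) lastl'.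
split.
- apply: within_continuous_comp cphi _.
    by apply: continuous_subspaceT; exact: continuous_rotate.
  by move=> p; change (is_true (sqnorm p <= 1) -> is_true (sqnorm (rotate t1 p) <= 1)); rewrite sqnorm_rotate.
- exact: homeomorphism_comp (rotate_homeomorphism t1) hphi.
- apply/chain_cat; split.
    have := @chain_map E E (phi \o cp) ((phi \o rotate t1) \o cp) t1 1
      (fun t => t - t1) (t1, u) l.
    rewrite /= subrr lastl'; apply=> //.
    move=> s s' e' x y st ss s1 Ee' re'; split; first by rewrite ltrD2r.
    exists e' => //; apply: (@runs_along_eq _ _ _ _ (fun s => (phi \o cp) (1 * s + t1))).
    + by rewrite lerD2r ltW.
    + by move=> r _ /=; rewrite rotate_circle mul1r.
    + by apply: runs_along_affine; rewrite ?ltr01 // !mul1r !subrK.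
  rewrite lastm /=; split=> //; first by rewrite ltrBlDr ltrDl.
  exists e => //; apply: (@runs_along_eq _ _ _ _ (fun s => (phi \o cp) (1 * s + (t1 - 1)))).
  + by rewrite lerBlDr lerDl ltW.
  + by move=> r _ /=; rewrite rotate_circle mul1r addrA -(circle_pointD1 (r + t1 - 1)) subrK.
  + apply: runs_along_affine; rewrite ?ltr01 // !mul1r.
    by have -> : 1 - t1 + (t1 - 1) = 0 by [ring]; have -> : 1 + (t1 - 1) = t1 by [ring].
- by rewrite last_cat.
- by rewrite map_cat -map_comp /= (eq_map (g := snd)) // ml cats1.
Qed.

End Chains.

(** * Cutting a disk along a chord *)

Section Broken.
Variable R : realType.
Implicit Types (m n x s t : R).

(* Slope [m] before [x], slope [n] after [x]. *)
Definition broken_line m n x s : R := m * s + (n - m) * ((s - x + `|s - x|) / 2).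

Lemma broken_lineL m n x s : s <= x -> broken_line m n x s = m * s.
Proof.
by move=> sx; rewrite /broken_line ler0_norm ?subr_le0 // subrr mul0r mulr0 addr0.
Qed.

Lemma broken_lineR m n x s : x <= s -> broken_line m n x s = m * x + n * (s - x).
Proof.
by move=> sx; rewrite /broken_line ger0_norm ?subr_ge0 //; field.
Qed.

Lemma continuous_broken_line m n x : continuous (broken_line m n x).
Proof.
have c1 : continuous (fun s : R => s - x) by move=> s; apply: cvgB; [exact: cvg_id|exact: cvg_cst].
move=> s; apply: cvgD; first by apply: cvgM; [exact: cvg_cst|exact: cvg_id].
apply: cvgM; first exact: cvg_cst.
apply: cvgM; last exact: cvg_cst.
apply: cvgD; first exact: c1.
by apply: cvg_norm; exact: c1.
Qed.

Lemma broken_line_le m n x s t : 0 < m -> 0 < n -> s <= t ->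
  broken_line m n x s <= broken_line m n x t.
Proof.
move=> m0 n0 st; have [sx|sx] := leP s x; have [tx|tx] := leP t x.
- by rewrite !broken_lineL // ler_pM2l.
- by rewrite broken_lineL // broken_lineR ?(ltW tx) //; nra.
- by lra.
- by rewrite !broken_lineR ?(ltW sx) ?(ltW tx) // lerD2l ler_pM2l // lerD2r.
Qed.

Lemma broken_lineK m n x s : 0 < m -> 0 < n ->
  broken_line m^-1 n^-1 (m * x) (broken_line m n x s) = s.
Proof.
move=> m0 n0; have [sx|/ltW sx] := leP s x.
  rewrite (broken_lineL _ _ sx) broken_lineL ?ler_pM2l // mulrA mulVf ?mul1r //.
  by rewrite gt_eqF.
rewrite (broken_lineR _ _ sx) broken_lineR ?lerDl ?mulr_ge0 ?subr_ge0 ?(ltW n0) //.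
by field; rewrite !gt_eqF.
Qed.

Lemma set_bij_mono (h k : R -> R) s t :
  {homo h : x y / x <= y} -> {homo k : x y / x <= y} ->
  cancel h k -> cancel k h -> set_bij `[k s, k t] `[s, t] h.
Proof.
move=> hm km hK kK; split.
- by move=> x /=; rewrite !in_itv /= => /andP[/hm + /hm]; rewrite !kK => -> ->.
- by move=> x y _ _ E; apply: (can_inj hK).
- move=> y /=; rewrite in_itv /= => /andP[/km sy /km yt]; exists (k y); last exact: kK.
  by rewrite /= in_itv /= sy.
Qed.

End Broken.

(** A union of segments through the common point [o]. *)
Lemma star_connected (R : realType) (D : set (R * R)) (o : R * R) : D o ->
  (forall p t, D p -> 0 <= t <= 1 ->
     D (o.1 + t * (p.1 - o.1), o.2 + t * (p.2 - o.2))) -> connected D.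
Proof.
move=> Do star.
pose seg (p : R * R) : set (R * R) :=
  (fun t : R => (o.1 + t * (p.1 - o.1), o.2 + t * (p.2 - o.2))) @` `[0, 1].
have -> : D = \bigcup_(p in D) seg p.
  apply/seteqP; split=> [p Dp|q [p Dp [t]]].
    exists p => //; exists 1; first by rewrite /= in_itv /= lexx ler01.
    by rewrite !mul1r !subrKC; case: (p).
  by rewrite /= in_itv => t01 <-; apply: star.
apply: bigcup_connected.
  exists o => p _; exists 0; first by rewrite /= in_itv /= lexx ler01.
  by rewrite !mul0r !addr0; case: (o).
move=> p _; apply: connected_continuous_connected; first exact: segment_connected.
apply: continuous_subspaceT; apply: continuous_pairing => t;
by apply: cvgD; [exact: cvg_cst|apply: cvgM; [exact: cvg_id|exact: cvg_cst]].
Qed.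

Lemma connected_open_disk (R : realType) : connected (open_disk R).
Proof.
apply: (@star_connected _ _ (0, 0)); first by rewrite /open_disk /= expr0n /= addr0 ltr01.
move=> p t Dp /andP[t0 t1]; move: Dp; rewrite /open_disk /= !subr0 !add0r => Dp.
rewrite !exprMn -mulrDr; apply: le_lt_trans Dp.
by rewrite ler_piMl ?addr_ge0 ?sqr_ge0 // expr_le1.
Qed.

Section Split.
Variables (R : realType) (S : topologicalType).
Implicit Types (E : set (set S)) (F : set S) (c : R -> S) (l : seq (R * S)).
Implicit Types (a b v : S) (p q w : seq S) (phi : R * R -> S).

Local Notation cp := (@circle_point R).

(** The stop at [b] is moved to time 1/2, opposite to the base point. *)
Lemma disk_walk_split E F a p b q : disk_walk R E F a (p ++ b :: q) ->
  exists phi lp lq,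
    [/\ {within closed_disk R, continuous phi},
        homeomorphism (open_disk R) F phi,
        chain E (phi \o cp) (0, a) (rcons lp (1 / 2, b)),
        chain E (phi \o cp) (1 / 2, b) lq &
        [/\ last (1 / 2, b) lq = (1, a), map snd lp = p & map snd lq = rcons q a]].
Proof.
move=> [phi [l [cphi hphi hl lastl ml]]].
have [lp [tau [lq [lE mp mq]]]] : exists lp tau lq,
    [/\ l = lp ++ (tau, b) :: lq, map snd lp = p & map snd lq = rcons q a].
  move: ml {hl lastl}; elim: p l => [|x p IH] [|[t y] l] //= [-> ml].
    by exists [::], t, l.
  have [lp [tau [lq [-> <- ?]]]] := IH l ml.
  by exists ((t, x) :: lp), tau, lq.
move: hl lastl; rewrite lE => hl; rewrite last_cat /= => lastl.
have /chain_cat[_ /= [_ _ hq]] := hl.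
have /chain_cat[] : chain E (phi \o cp) (0, a) (rcons lp (tau, b) ++ lq) by rewrite cat_rcons.
move=> hp _.
have tau0 : 0 < tau.
  have -> : tau = (last (0, a) (rcons lp (tau, b))).1 by rewrite last_rcons.
  case: (lp) hp => [|y lp'] /= [y0 _ hp]; first by [].
  have /andP[_ yl] := chain_le hp (mem_head _ _).
  exact: lt_le_trans y0 yl.
have tau1 : tau < 1.
  have -> : 1 = (last (tau, b) lq).1 by rewrite lastl.
  case: (lq) hq mq => [_|y lq' /= [y0 _ hq'] _]; first by case: (q).
  have /andP[_ yl] := chain_le hq' (mem_head _ _).
  exact: lt_le_trans y0 yl.
(* The slopes for which [h] fixes 0 and 1 and sends 1/2 to [tau]; both are positive as [tau] lies
   strictly between 0 and 1. *)
set m := 2 * tau; set n := 2 * (1 - tau).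
have m0 : 0 < m by rewrite mulr_gt0.
have n0 : 0 < n by rewrite mulr_gt0 // subr_gt0.
pose h := broken_line m n (1 / 2); pose k := broken_line m^-1 n^-1 tau.
have mE : m * (1 / 2) = tau by rewrite /m; field.
have hK : cancel h k by move=> s; rewrite /k -{1}mE; apply: broken_lineK.
have kK : cancel k h.
  move=> s; rewrite /h -{1}[m]invrK -{1}[n]invrK.
  have -> : 1 / 2 = m^-1 * tau by rewrite -mE mulKf // gt_eqF.
  by apply: broken_lineK; rewrite invr_gt0.
have hm : {homo h : x y / x <= y} by move=> s t; apply: broken_line_le.
have km : {homo k : x y / x <= y} by move=> s t; apply: broken_line_le; rewrite invr_gt0.
have h0 : h 0 = 0 by rewrite /h broken_lineL ?mulr0 //; lra.
have h1 : h 1 = 1 by rewrite /h broken_lineR; [rewrite mE /n; field|lra].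
have k0 : k 0 = 0 by rewrite -h0 hK.
have k1 : k 1 = 1 by rewrite -h1 hK.
have ktau : k tau = 1 / 2 by rewrite /k broken_lineL // -mE mulKf // gt_eqF.
have h01 t : 0 <= t <= 1 -> 0 <= h t <= 1 by move=> /andP[/hm + /hm]; rewrite h0 h1 => -> ->.
have k01 t : 0 <= t <= 1 -> 0 <= k t <= 1 by move=> /andP[/km + /km]; rewrite k0 k1 => -> ->.
have ch : continuous h by apply: continuous_broken_line.
have hpsi : homeomorphism (open_disk R) (open_disk R) (angular h).
  by apply: (@angular_homeomorphism R h k) => //; apply: continuous_broken_line.
have piece s t e u v : 0 <= s -> s < t -> t <= 1 -> E e ->
    runs_along s t (phi \o cp) e u v ->
    k s < k t /\ exists2 e', E e' & runs_along (k s) (k t) ((phi \o angular h) \o cp) e' u v.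
  move=> s0 st t1 Ee re; have kst : k s < k t.
    by rewrite lt_neqAle (inj_eq (can_inj kK)) (lt_eqF st) /= km // ltW.
  split=> //; exists e => //.
  have := runs_along_comp re ch (@set_bij_mono R h k s t hm km hK kK).
  have [_ _ _ <- <-] := re; rewrite !kK; apply: runs_along_eq; first exact: ltW.
  move=> r /andP[sr rt] /=; rewrite angular_circle // (le_trans _ sr) ?(le_trans rt) //.
    by rewrite -k1 km.
  by rewrite -k0 km.
exists (phi \o angular h), [seq (k y.1, y.2) | y <- lp], [seq (k y.1, y.2) | y <- lq].
split.
- apply: within_continuous_comp (angular_continuous ch h0 h1) cphi _ => x.
  by change (is_true (sqnorm x <= 1) -> is_true (sqnorm (angular h x) <= 1)); rewrite sqnorm_angular.
- exact: homeomorphism_comp hpsi hphi.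
- have := chain_map piece (x := (0, a)) (l := rcons lp (tau, b)).
  by rewrite /= k0 map_rcons /= ktau last_rcons /=; apply=> //; rewrite ltW.
- have := chain_map piece (x := (tau, b)) (l := lq).
  by rewrite /= ktau lastl /=; apply=> //; rewrite ltW.
- have sndk (l0 : seq (R * S)) : map snd [seq (k y.1, y.2) | y <- l0] = map snd l0.
    by rewrite -map_comp; apply: eq_map.
  rewrite !sndk.
  split=> //; rewrite -ktau.
  by rewrite (last_map (fun y : R * S => (k y.1, y.2)) lq (tau, b)) lastl /= k1.
Qed.

(** The cosine makes the diameter match the flattened half circle time by time, so the same function
    parametrizes the new side of both halves: from [a] to [b] on [[0, 1/2]] and from [b] to [a] on
    [[1/2, 1]], when [phi] sends [(1, 0)] to [a] and [(-1, 0)] to [b]. *)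
Definition chord phi (s : R) : S := phi (cos (2 * pi * s), 0).

Section Halves.
Variables (phi : R * R -> S) (F : set S) (a b : S).
Hypothesis phi_cont : {within closed_disk R, continuous phi}.
Hypothesis phi_homeo : homeomorphism (open_disk R) F phi.
Hypothesis phia : phi (1, 0) = a.
Hypothesis phib : phi (-1, 0) = b.

Let one_pm1 : (1 : R) = 1 \/ (1 : R) = -1. Proof. by left. Qed.
Let none_pm1 : (-1 : R) = 1 \/ (-1 : R) = -1. Proof. by right. Qed.

Definition half_face (e : R) : set S := phi @` open_half_disk e.

Lemma half_face_homeo e : e = 1 \/ e = -1 ->
  homeomorphism (open_disk R) (half_face e) (phi \o half_disk e).
Proof.
move=> e1; apply: homeomorphism_comp (half_disk_homeomorphism e1) _.
by apply: homeomorphism_sub phi_homeo _ => p [].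
Qed.

Lemma half_face_cont e : e = 1 \/ e = -1 ->
  {within closed_disk R, continuous (phi \o half_disk e)}.
Proof.
move=> e1; apply: within_continuous_comp phi_cont _.
  by apply: continuous_subspaceT; exact: continuous_half_disk.
by move=> p; apply: half_disk_closed.
Qed.

Lemma half_circle_upper s : 0 <= s <= 1 / 2 ->
  (phi \o half_disk 1) (cp s) = phi (cp s) /\
  (phi \o half_disk (-1)) (cp s) = chord phi s.
Proof.
move=> s01; have y0 := sin_upper s01.
rewrite /= half_disk_circle_fixed ?half_disk_circle_flat ?sqnorm_circle_point //=.
  by rewrite mulN1r oppr_le0.
by rewrite mul1r.
Qed.

Lemma half_circle_lower s : 1 / 2 <= s <= 1 ->
  (phi \o half_disk 1) (cp s) = chord phi s /\
  (phi \o half_disk (-1)) (cp s) = phi (cp s).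
Proof.
move=> s01; have y0 := sin_lower s01.
rewrite /= half_disk_circle_flat ?half_disk_circle_fixed ?sqnorm_circle_point //=.
  by rewrite mulN1r oppr_ge0.
by rewrite mul1r.
Qed.

(** The half keeps the walk up to [b] and returns along the chord. The subdivision [lc] of the chord
    is left open: one edge for a plain chord, two when a new vertex lies on it. *)
Lemma upper_walk E E' lp lc w : E `<=` E' ->
  chain E (phi \o cp) (0, a) (rcons lp (1 / 2, b)) ->
  chain E' (chord phi) (1 / 2, b) lc -> last (1 / 2, b) lc = (1, a) ->
  map snd lc = rcons w a ->
  disk_walk R E' (half_face 1) a (map snd lp ++ b :: w).
Proof.
move=> EE' hp hc lastc mc; exists (phi \o half_disk 1), (rcons lp (1 / 2, b) ++ lc); split.
- exact: half_face_cont.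
- exact: half_face_homeo.
- apply/chain_cat; split; last rewrite last_rcons.
    have := @chain_map R S E E' (phi \o cp) ((phi \o half_disk 1) \o cp) 0 (1 / 2) id
      (0, a) (rcons lp (1 / 2, b)).
    rewrite /= last_rcons /= (eq_map (g := id)) ?map_id; last by case.
    apply=> // s t e u v s0 st t1 Ee re; split=> //; exists e; first exact: EE'.
    apply: runs_along_eq re; first exact: ltW.
    move=> r /andP[sr rt] /=; have [] := @half_circle_upper r; last by move=> /= ->.
    by rewrite (le_trans s0 sr) (le_trans rt).
  have := @chain_map R S E' E' (chord phi) ((phi \o half_disk 1) \o cp) (1 / 2) 1 id
    (1 / 2, b) lc.
  rewrite /= lastc /= (eq_map (g := id)) ?map_id; last by case.
  apply=> // s t e u v s0 st t1 Ee re; split=> //; exists e => //.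
  apply: runs_along_eq re; first exact: ltW.
  move=> r /andP[sr rt] /=; have [] := @half_circle_lower r; last by move=> /= ->.
  by rewrite (le_trans s0 sr) (le_trans rt).
- by rewrite last_cat last_rcons.
- by rewrite map_cat map_rcons cat_rcons mc rcons_cat.
Qed.

Lemma lower_walk E E' lc lq q : E `<=` E' ->
  chain E' (chord phi) (0, a) (rcons lc (1 / 2, b)) ->
  chain E (phi \o cp) (1 / 2, b) lq -> last (1 / 2, b) lq = (1, a) ->
  map snd lq = rcons q a ->
  disk_walk R E' (half_face (-1)) a (map snd lc ++ b :: q).
Proof.
move=> EE' hc hq lastq mq; exists (phi \o half_disk (-1)), (rcons lc (1 / 2, b) ++ lq); split.
- exact: half_face_cont.
- exact: half_face_homeo.
- apply/chain_cat; split; last rewrite last_rcons.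
    have := @chain_map R S E' E' (chord phi) ((phi \o half_disk (-1)) \o cp) 0 (1 / 2) id
      (0, a) (rcons lc (1 / 2, b)).
    rewrite /= last_rcons /= (eq_map (g := id)) ?map_id; last by case.
    apply=> // s t e u v s0 st t1 Ee re; split=> //; exists e => //.
    apply: runs_along_eq re; first exact: ltW.
    move=> r /andP[sr rt] /=; have [] := @half_circle_upper r; last by move=> /= _ ->.
    by rewrite (le_trans s0 sr) (le_trans rt).
  have := @chain_map R S E E' (phi \o cp) ((phi \o half_disk (-1)) \o cp) (1 / 2) 1 id
    (1 / 2, b) lq.
  rewrite /= lastq /= (eq_map (g := id)) ?map_id; last by case.
  apply=> // s t e u v s0 st t1 Ee re; split=> //; exists e; first exact: EE'.
  apply: runs_along_eq re; first exact: ltW.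
  move=> r /andP[sr rt] /=; have [] := @half_circle_lower r; last by move=> /= _ ->.
  by rewrite (le_trans s0 sr) (le_trans rt).
- by rewrite last_cat last_rcons.
- by rewrite map_cat map_rcons cat_rcons mq rcons_cat.
Qed.

Lemma half_face_sub e : half_face e `<=` F.
Proof.
have [[fphi _ _] _ _] := phi_homeo.
by move=> _ [p [Dp _] <-]; apply: fphi.
Qed.

Lemma half_face_connected e : e = 1 \/ e = -1 -> connected (half_face e).
Proof.
move=> e1; have [[fphi _ sphi] _ _] := half_face_homeo e1.
have -> : half_face e = (phi \o half_disk e) @` open_disk R.
  by apply/seteqP; split=> [y /sphi//|_ [p Dp <-]]; apply: fphi.
apply: connected_continuous_connected; first exact: connected_open_disk.
by apply: continuous_subspaceW (half_face_cont e1); exact: open_sub_closed_disk.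
Qed.

Lemma half_face_open e : open F -> open (half_face e).
Proof.
move=> oF; apply: homeomorphism_open phi_homeo oF _ _; last by move=> p [].
apply: openI; first exact: open_open_disk.
have c : continuous (fun p : R * R => e * p.2).
  by move=> p; apply: cvgM; [exact: cvg_cst|exact: continuous_snd2].
by move/continuousP: c => /(_ [set t | 0 < t]); apply; exact: open_gt.
Qed.

Lemma half_face_nonempty e : e = 1 \/ e = -1 -> half_face e !=set0.
Proof.
move=> e1; exists (phi (0, e / 2)); exists (0, e / 2) => //; split.
  by rewrite /open_disk /=; case: e1 => ->; lra.
by case: e1 => -> /=; lra.
Qed.

Lemma half_face_disjoint : half_face 1 `&` half_face (-1) = set0.
Proof.
have [[_ iphi _] _ _] := phi_homeo.
rewrite -subset0 => y [[p [Dp p0] py] [q [Dq q0] qy]].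
have pq : p = q by apply: iphi; rewrite ?inE // py qy.
by move: p0 q0; rewrite pq mul1r mulN1r; lra.
Qed.

Lemma lower_cos s : 1 / 2 < s < 1 -> open_disk R (cos (2 * pi * s), 0).
Proof.
move=> /sin_lower_lt0 s0; rewrite /open_disk /= expr0n addr0.
by have := cos2Dsin2 (2 * pi * s); nra.
Qed.

Lemma chord_sub s : 1 / 2 < s < 1 -> F (chord phi s).
Proof. by have [[fphi _ _] _ _] := phi_homeo; move=> /lower_cos; apply: fphi. Qed.

Lemma chord_half_face e s : 1 / 2 < s < 1 -> ~ half_face e (chord phi s).
Proof.
have [[_ iphi _] _ _] := phi_homeo.
move=> /lower_cos Ds [p [Dp p0] py].
have pq : p = (cos (2 * pi * s), 0) by apply: iphi; rewrite ?inE.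
by move: p0; rewrite pq mulr0 ltxx.
Qed.

Lemma chord_end1 : chord phi 1 = a.
Proof. by rewrite /chord mulr1 mulr_natl cos2pi. Qed.

Lemma chord_endh : chord phi (1 / 2) = b.
Proof. by have [] := circle_point_half R => c _; rewrite /chord c. Qed.

Lemma face_halves y : F y ->
  [\/ half_face 1 y, half_face (-1) y | exists2 s, 1 / 2 < s < 1 & y = chord phi s].
Proof.
have [[_ _ sphi] _ _] := phi_homeo.
move=> /sphi[[x0 y0] Dp <-]; have [y1|y1|y1] := ltgtP 0 y0.
- by apply: Or31; exists (x0, y0) => //; split=> //=; rewrite mul1r.
- by apply: Or32; exists (x0, y0) => //; split=> //=; rewrite mulN1r oppr_gt0.
- apply: Or33; rewrite -y1 in Dp *.
  have x1 : -1 < x0 < 1 by move: Dp; rewrite /open_disk /= expr0n addr0 => ?; nra.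
  have pi0 := pi_gt0 R.
  have /andP[xl xr] := x1.
  have a0 : 0 < acos x0 by rewrite acos_gt0 // (ltW xl).
  have a1 : acos x0 < pi by rewrite acos_ltpi // (ltW xr) andbT.
  have pi2 : 2 * pi != 0 :> R by rewrite mulf_neq0 ?pnatr_eq0 // gt_eqF.
  (* The angle of [x0] on the lower half circle, where [chord] is injective; the cosine is even and
     periodic. *)
  exists (1 - acos x0 / (2 * pi)).
    apply/andP; split; last by rewrite ltrBlDr ltrDl divr_gt0 ?mulr_gt0.
    rewrite ltrBrDr -ltrBrDl ltr_pdivrMr ?mulr_gt0 //; lra.
  rewrite /chord mulrBr mulr1 [2 * pi * (_ / _)]mulrC divfK // addrC mulr_natl cosD2pi cosN.
  by rewrite acosK // in_itv /= (ltW xl) (ltW xr).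
Qed.

Hypothesis Fa : ~ F a.
Hypothesis Fb : ~ F b.
Hypothesis ab : a <> b.

(** The ends are distinct and outside [F], while the interior is in [F]; there injectivity is that
    of [phi] and of the cosine on a half turn. *)
Lemma chord_inj s t : 1 / 2 <= s <= 1 -> 1 / 2 <= t <= 1 -> chord phi s = chord phi t -> s = t.
Proof.
have [[_ iphi _] _ _] := phi_homeo.
have cases (r : R) : 1 / 2 <= r <= 1 -> [\/ r = 1 / 2, r = 1 | 1 / 2 < r < 1].
  move=> /andP[]; rewrite !le_eqVlt => /predU1P[->|r1]; first by move=> _; apply: Or31.
  by move=> /predU1P[->|r2]; [apply: Or32|apply: Or33; rewrite r1].
move=> /cases[->|->|s1] /cases[->|->|t1] //; rewrite ?chord_end1 ?chord_endh.
- by move=> E; case: ab.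
- by move=> E; case: Fb; rewrite E; apply: chord_sub.
- by move=> E; case: ab.
- by move=> E; case: Fa; rewrite E; apply: chord_sub.
- by move=> E; case: Fb; rewrite -E; apply: chord_sub.
- by move=> E; case: Fa; rewrite -E; apply: chord_sub.
move=> E; have [] : (cos (2 * pi * s), 0) = (cos (2 * pi * t), 0 : R).
  by apply: iphi; rewrite ?inE; [exact: lower_cos|exact: lower_cos|exact: E].
rewrite (shift_half s) (shift_half t) !cosDpi => /oppr_inj ec.
suff : s - 1 / 2 = t - 1 / 2 by move/addIr.
by move: s1 t1 => /andP[? ?] /andP[? ?]; apply: cos_inj_upper ec; apply/andP; split; lra.
Qed.

Lemma chord_cont s t : {within `[s, t], continuous (chord phi)}.
Proof.
apply: (@within_continuous_comp _ _ _ _ (closed_disk R) (fun s : R => (cos (2 * pi * s), 0 : R))) => //.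
  apply: continuous_subspaceT; apply: continuous_pairing => r; last exact: cvg_cst.
  apply: (continuous_comp (g := cos)); last exact: continuous_cos.
  by apply: cvgM; [apply: cvg_cst|exact: cvg_id].
move=> r _; rewrite /closed_disk /= expr0n addr0.
by rewrite -[leRHS](cos2Dsin2 (2 * pi * r)) lerDl sqr_ge0.
Qed.

Lemma chord_runs s t : 1 / 2 <= s -> s < t -> t <= 1 ->
  runs_along s t (chord phi) (chord phi @` `[s, t]) (chord phi s) (chord phi t).
Proof.
move=> s0 st t1; split=> //; first exact: chord_cont.
move=> x y; rewrite !inE /= !in_itv /= => /andP[sx xt] /andP[sy yt].
by apply: chord_inj; rewrite ?(le_trans s0) ?(le_trans _ t1).
Qed.

Lemma chordB s : chord phi (1 - s) = chord phi s.
Proof.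
by rewrite /chord mulrBr mulr1 addrC mulr_natl cosD2pi cosN.
Qed.

(** By symmetry of the cosine, the reflected times in the first half turn trace the same arc
    backwards. *)
Lemma chord_runs_back s t : 1 / 2 <= s -> s < t -> t <= 1 ->
  runs_along (1 - t) (1 - s) (chord phi) (chord phi @` `[s, t]) (chord phi t) (chord phi s).
Proof.
move=> s0 st t1; apply: (@runs_along_eq _ _ _ _ (fun r => chord phi (1 - r))).
- by rewrite lerD2l lerN2 ltW.
- by move=> r _; rewrite chordB.
- by apply: runs_along_reverse; rewrite !subKr; apply: chord_runs.
Qed.

End Halves.
End Split.

(** * Drawings and their faces *)

Lemma closed_finite (T : topologicalType) (A : set T) :
  hausdorff_space T -> finite_set A -> closed A.
Proof.
move=> hT fA; apply: compact_closed => //; exact: finite_compact.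
Qed.

Lemma open_disjoint_closure (T : topologicalType) (A B : set T) :
  open B -> A `&` B = set0 -> closure A `&` B = set0.
Proof.
move=> oB AB; rewrite -subset0 => x [cAx Bx].
have [y []] := cAx B (open_nbhs_nbhs (conj oB Bx)).
by move=> Ay By; have : (A `&` B) y by []; rewrite AB.
Qed.

(** Disjoint open sets are separated, so a connected set in their union cannot meet both. *)
Lemma connected_sub_open (T : topologicalType) (A B C : set T) :
  open A -> open B -> A `&` B = set0 -> connected C -> C `<=` A `|` B ->
  C `&` A !=set0 -> C `<=` A.
Proof.
move=> oA oB AB cC CAB [x [Cx Ax]].
have sep : separated A B.
  split; first by apply: open_disjoint_closure.
  by rewrite setIC; apply: open_disjoint_closure; rewrite // setIC.
have [//|CB] := connected_subset sep CAB cC.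
by have : (A `&` B) x; [split=> //; apply: CB|rewrite AB].
Qed.

Section Drawings.
Variables (R : realType) (S : topologicalType).
Implicit Types (G : drawing S) (F H K A e : set S) (u v x y z : S).

Definition add_vertex G x : drawing S := Drawing (vertices G `|` [set x]) (edges G).
Definition add_edge G e : drawing S := Drawing (vertices G) (edges G `|` [set e]).

Lemma graph_points_add_vertex G x :
  graph_points (add_vertex G x) = graph_points G `|` [set x].
Proof. by rewrite /graph_points /= setUAC. Qed.

Lemma graph_points_add_edge G e :
  graph_points (add_edge G e) = graph_points G `|` e.
Proof. by rewrite /graph_points /= bigcup_setU bigcup_set1 setUA. Qed.

Lemma edge_graph_points G e : edges G e -> e `<=` graph_points G.
Proof. by move=> Ee x ex; right; exists e. Qed.

Lemma face_component G F x : face G F -> F x ->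
  F = connected_component (~` graph_points G) x.
Proof.
by move=> [y Cy ->] Fx; rewrite (same_connected_component Fx).
Qed.

Lemma face_sub G F : face G F -> F `<=` ~` graph_points G.
Proof. by move=> [x _ ->]; exact: connected_component_sub. Qed.

Lemma face_nonempty G F : face G F -> F !=set0.
Proof. by move=> [x Cx ->]; exists x; apply: connected_component_refl. Qed.

Lemma face_connected G F : face G F -> connected F.
Proof. by move=> [x _ ->]; exact: component_connected. Qed.

Lemma face_eq G F K x : face G F -> face G K -> F x -> K x -> F = K.
Proof. by move=> fF fK Fx Kx; rewrite (face_component fF Fx) (face_component fK Kx). Qed.

Lemma component_face G x : ~ graph_points G x ->
  face G (connected_component (~` graph_points G) x).
Proof. by move=> Cx; exists x. Qed.

(** A component of the new complement which meets [H1] stays inside [H] and avoids [A], hence lies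
    in two disjoint open sets and cannot cross from one to the other. The remaining faces miss [A],
    which lies in the old graph and [H], so they stay components. *)
Lemma face_cut G G2 H H1 H2 A :
  graph_points G2 = graph_points G `|` A -> face G H ->
  open H1 -> open H2 -> connected H1 -> connected H2 ->
  H1 !=set0 -> H2 !=set0 -> H1 `&` H2 = set0 ->
  H1 `<=` H -> H2 `<=` H -> H1 `&` A = set0 -> H2 `&` A = set0 ->
  H `<=` H1 `|` H2 `|` A -> A `<=` graph_points G `|` H ->
  forall K, face G2 K <-> [\/ face G K /\ K <> H, K = H1 | K = H2].
Proof.
move=> gp fH o1 o2 c1 c2 n1 n2 H12 H1H H2H H1A H2A HH AH.
have C2C : ~` graph_points G2 `<=` ~` graph_points G.
  by rewrite gp => x h1 h2; apply: h1; left.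
have inC2 B : B `<=` H -> B `&` A = set0 -> B `<=` ~` graph_points G2.
  move=> BH BA x Bx; rewrite gp => -[|Ax].
    exact: (face_sub fH (BH _ Bx)).
  by have : (B `&` A) x by []; rewrite BA.
have comp B B' z : open B -> open B' -> connected B -> B `&` B' = set0 ->
    B `<=` H -> B `&` A = set0 -> H `<=` B `|` B' `|` A -> B z ->
    connected_component (~` graph_points G2) z = B.
  move=> oB oB' cB BB' BH BA HB Bz; apply/seteqP; split; last first.
    by apply: connected_component_max => //; apply: inC2.
  have Cz : (~` graph_points G2) z by apply: inC2 Bz.
  apply: (connected_sub_open oB oB' BB'); first exact: component_connected; last first.
    by exists z; split=> //; apply: connected_component_refl.
  move=> y Ky.
  have Hy : H y.
    rewrite (face_component fH (BH _ Bz)).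
    apply: (@connected_component_max _ _ (connected_component (~` graph_points G2) z)) => //.
    - exact: connected_component_refl.
    - by apply: subset_trans C2C; exact: connected_component_sub.
    - exact: component_connected.
  have := connected_component_sub Ky; rewrite gp => nA.
  by case: (HB _ Hy) => [//|Ay]; case: nA; right.
have comp1 z : H1 z -> connected_component (~` graph_points G2) z = H1.
  by apply: (@comp H1 H2).
have comp2 z : H2 z -> connected_component (~` graph_points G2) z = H2.
  apply: (@comp H2 H1) => //; first by rewrite setIC.
  by rewrite (setUC H2).
have old K z : face G K -> K <> H -> K z -> connected_component (~` graph_points G2) z = K.
  move=> fK KH Kz; have KC2 : K `<=` ~` graph_points G2.
    move=> x Kx; rewrite gp => -[|/AH[|Hx]]; [exact: (face_sub fK Kx)|exact: (face_sub fK Kx)|].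
    exact: KH (face_eq fK fH Kx Hx).
  apply/seteqP; split; last first.
    by apply: connected_component_max => //; exact: face_connected fK.
  rewrite [X in _ `<=` X](face_component fK Kz).
  apply: connected_component_max.
  - by apply: connected_component_refl; apply: KC2.
  - by apply: subset_trans C2C; exact: connected_component_sub.
  - exact: component_connected.
move=> K; split.
- move=> [z Cz ->]; have Cz' := C2C _ Cz.
  have [Hz|nHz] := pselect (H z).
    have [[/comp1 ->|/comp2 ->]|Az] := HH _ Hz.
    + by apply: Or32.
    + by apply: Or33.
    + by case: Cz; rewrite gp; right.
  apply: Or31; have fK := component_face Cz'; have Kz := connected_component_refl Cz'.
  rewrite (old _ z fK) //; first by split=> // E; apply: nHz; rewrite -E.
  by move=> E; apply: nHz; rewrite -E.
- move=> [[fK KH]|->|->].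
  + have [z Kz] := face_nonempty fK; rewrite -(old _ _ fK KH Kz); apply: component_face.
    move=> h; have := old _ _ fK KH Kz; rewrite connected_component_out; last by move=> h2; apply: h2.
    by move=> E; rewrite -E in Kz.
  + by have [z Hz] := n1; rewrite -(comp1 _ Hz); apply: component_face; apply: inC2 Hz.
  + by have [z Hz] := n2; rewrite -(comp2 _ Hz); apply: component_face; apply: inC2 Hz.
Qed.

Hypothesis S_hausdorff : hausdorff_space S.

Lemma graph_points_closed G : embedded_simple_graph R G -> closed (graph_points G).
Proof.
move=> [fV fE hE _ _]; apply: closedU; first exact: closed_finite.
apply: closed_bigcup => // e /hE[u [v [j _]]].
by apply: compact_closed => //; apply: joins_compact j.
Qed.

Lemma joins_vertices G e u v : embedded_simple_graph R G -> edges G e ->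
  joins R e u v -> [/\ vertices G u, vertices G v &
    forall z, e z -> vertices G z -> z = u \/ z = v].
Proof.
move=> [_ _ hE _ _] Ee j; have [u' [v' [j' eV]]] := hE _ Ee.
have ends z : e z -> vertices G z -> z = u' \/ z = v'.
  by move=> ez Vz; have : (e `&` vertices G) z by []; rewrite eV.
have Vu : vertices G u' by have [] : (e `&` vertices G) u' by rewrite eV; left.
have Vv : vertices G v' by have [] : (e `&` vertices G) v' by rewrite eV; right.
have [[-> ->]|[-> ->]] := joins_unique S_hausdorff j j'; split=> // z ez Vz.
by have [->|->] := ends _ ez Vz; [right|left].
Qed.

Lemma adjacent_sym G u v : adjacent R G u v -> adjacent R G v u.
Proof. by move=> [e Ee j]; exists e => //; apply: joins_sym. Qed.

Lemma adjacent_neq G u v : adjacent R G u v -> u <> v.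
Proof. by move=> [e _ /joins_ends[]]. Qed.

Lemma adjacent_vertices G u v : embedded_simple_graph R G ->
  adjacent R G u v -> vertices G u /\ vertices G v.
Proof. by move=> hG [e Ee /(joins_vertices hG Ee)[]]. Qed.

Lemma adjacent_sub G G2 u v : edges G `<=` edges G2 ->
  adjacent R G u v -> adjacent R G2 u v.
Proof. by move=> GG [e /GG Ee j]; exists e. Qed.

Lemma embedded_add_vertex G x : embedded_simple_graph R G -> ~ graph_points G x ->
  embedded_simple_graph R (add_vertex G x).
Proof.
move=> [fV fE hE hI hU] nx; split=> //=.
- by rewrite finite_setU; split=> //; exact: finite_set1.
- move=> e Ee; have [u [v [j eV]]] := hE _ Ee; exists u, v; split=> //.
  rewrite setIUr eV; apply/seteqP; split=> [z [//|[ez /= zx]]|z]; last by left.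
  by case: nx; rewrite -zx; apply: edge_graph_points Ee _ ez.
- by move=> e e' Ee Ee' ne z /hI h; left; apply: h.
Qed.

Lemma embedded_add_edge G e u v : embedded_simple_graph R G ->
  vertices G u -> vertices G v -> joins R e u v ->
  (forall z, e z -> graph_points G z -> z = u \/ z = v) ->
  ~ adjacent R G u v -> embedded_simple_graph R (add_edge G e).
Proof.
move=> hG Vu Vv j inter nadj; have [fV fE hE hI hU] := hG; split=> //=.
- by rewrite finite_setU; split=> //; exact: finite_set1.
- move=> e' [/hE//|->]; exists u, v; split=> //.
  have [eu ev _] := joins_ends j.
  apply/seteqP; split=> [z [ez Vz]|z [->|->]] //.
  by apply: inter ez _; left.
- have sub e' : edges G e' -> e' `&` e `<=` vertices G.
    by move=> Ee' z [e'z ez]; have [->|->] := inter _ ez (edge_graph_points Ee' e'z).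
  move=> e1 e2 [E1|->] [E2|->] ne //; first exact: hI.
    exact: sub.
  by rewrite setIC; apply: sub.
- have uniq e' u' v' : edges G e' -> joins R e' u' v' -> joins R e u' v' -> False.
    move=> Ee' j1 j2; apply: nadj.
    have [[-> ->]|[-> ->]] := joins_unique S_hausdorff j j2; first by exists e'.
    by apply: adjacent_sym; exists e'.
  move=> e1 e2 u' v' [E1|->] [E2|->] //; first exact: hU.
    by move=> j1 j2; case: (uniq _ _ _ E1 j1 j2).
  by move=> j1 j2; case: (uniq _ _ _ E2 j2 j1).
Qed.

Lemma connected_graph_sub G G2 : edges G `<=` edges G2 ->
  vertices G = vertices G2 -> connected_graph R G -> connected_graph R G2.
Proof.
move=> EE VV [n0 h]; rewrite /connected_graph -VV; split=> // u v Vu Vv.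
have := h u v Vu Vv; elim=> [x y /(adjacent_sub EE) a|x|x y z _ h1 _ h2].
- exact: Relation_Operators.rt_step.
- exact: Relation_Operators.rt_refl.
- exact: Relation_Operators.rt_trans h1 h2.
Qed.

(** Every vertex is connected with [u] in both directions, including the new one. *)
Lemma connected_graph_pendant G x e u : connected_graph R G ->
  vertices G u -> joins R e u x -> connected_graph R (add_edge (add_vertex G x) e).
Proof.
move=> [n0 h] Vu j; have [w0 Vw0] := n0; split; first by exists w0; left.
have EE : edges G `<=` edges (add_edge (add_vertex G x) e) by move=> e' ?; left.
have hu y : vertices G y -> Relation_Operators.clos_refl_trans S
      (adjacent R (add_edge (add_vertex G x) e)) y u /\
    Relation_Operators.clos_refl_trans S
      (adjacent R (add_edge (add_vertex G x) e)) u y.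
  have mono a b : vertices G a -> vertices G b -> Relation_Operators.clos_refl_trans S
      (adjacent R (add_edge (add_vertex G x) e)) a b.
    move=> Va Vb; have := h a b Va Vb; elim=> [x' y' /(adjacent_sub EE) a'|x'|x' y' z _ h1 _ h2].
    - exact: Relation_Operators.rt_step.
    - exact: Relation_Operators.rt_refl.
    - exact: Relation_Operators.rt_trans h1 h2.
  by move=> Vy; split; apply: mono.
have ux : adjacent R (add_edge (add_vertex G x) e) u x by exists e => //; right.
have hx y : (vertices G `|` [set x]) y -> Relation_Operators.clos_refl_trans S
      (adjacent R (add_edge (add_vertex G x) e)) y u /\
    Relation_Operators.clos_refl_trans S
      (adjacent R (add_edge (add_vertex G x) e)) u y.
  move=> [/hu//|->]; split; apply: Relation_Operators.rt_step => //.
  exact: adjacent_sym.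
move=> y z /hx[h1 _] /hx[_ h2]; exact: Relation_Operators.rt_trans h1 h2.
Qed.

(** * Open faces and vertices in their closures *)

Hypothesis S_surface : surface R S.

(** Surfaces are locally connected: around a point of the open set [A], the image of a small ball of
    a chart is open, connected and contained in [A]. *)
Lemma component_open A x : open A -> open (connected_component A x).
Proof.
move=> oA; rewrite openE => y Cy; rewrite (same_connected_component Cy).
have Ay := connected_component_sub Cy.
have [_ _ /(_ y) [U [oU Uy [f hf]]]] := S_surface.
have [[ff iF sf] cf _] := hf.
have [p Dp py] := sf _ Uy.
have oD : open (open_disk R `&` f @^-1` A).
  move: cf; rewrite continuous_open_subspace; last exact: open_open_disk.
  by rewrite continuous_inP; [apply|exact: open_open_disk].
have : nbhs p (open_disk R `&` f @^-1` A).
  by apply: open_nbhs_nbhs; split=> //; split=> //=; rewrite py.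
move=> /nbhs_ballP[r /= r0 rD].
have oB : open (ball p r) by exact: ball_open.
have Bp : ball p r p by exact: ballxx.
have cB : connected (ball p r).
  apply: (@star_connected _ _ p Bp) => q t [q1 q2] /andP[t0 t1].
  have key (a b : R) : `|a - b| < r -> `|a - (a + t * (b - a))| < r.
    rewrite opprD addrA subrr sub0r normrN normrM (ger0_norm t0) (distrC b) => ab.
    by apply: le_lt_trans ab; rewrite ler_piMl.
  by split; apply: key.
have oI : open (f @` ball p r).
  by apply: homeomorphism_open hf oU oB _ => q /rD[].
apply: (@filterS _ _ _ (f @` ball p r)); last first.
  by apply: open_nbhs_nbhs; split=> //; exists p.
apply: connected_component_max; first by exists p.
  by move=> _ [q /rD[_ Aq] <-].
apply: connected_continuous_connected => //.
by apply: continuous_subspaceW cf => q /rD[].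
Qed.

Lemma face_open G F : embedded_simple_graph R G -> face G F -> open F.
Proof.
move=> hG [x Cx ->]; apply: component_open; apply: closed_openC.
exact: graph_points_closed.
Qed.

Lemma chain_cover E (c : R -> S) (p : R * S) l s : chain E c p l -> l != [::] ->
  p.1 <= s <= (last p l).1 -> exists e u v, [/\ E e, joins R e u v,
    u \in map snd (p :: l), v \in map snd (p :: l) & e (c s)].
Proof.
elim: l p => [//|q l IH] p /= [pq [e Ee re] hl] _ /andP[ps sl].
have [sq|qs] := leP s q.1.
  exists e, p.2, q.2; split=> //; first exact: runs_along_joins pq re.
  - by rewrite inE eqxx.
  - by rewrite !inE eqxx orbT.
  - by have [_ _ <- _ _] := re; exists s => //=; rewrite in_itv /= ps.
have l0 : l != [::] by apply/eqP => l0; move: sl; rewrite l0 /= leNgt qs.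
have [|e' [u [v [Ee' j' ul vl es]]]] := IH q hl l0; first by rewrite (ltW qs).
by exists e', u, v; split=> //; rewrite inE ?ul ?vl orbT.
Qed.

Lemma chain_joins E (c : R -> S) (p : R * S) l : chain E c p l -> l != [::] ->
  forall z, z \in map snd (p :: l) -> exists e u, E e /\ joins R e u z.
Proof.
elim: l p => [//|q l IH] p /= [pq [e Ee re] hl] _ z; rewrite inE => /predU1P[->|zl].
  by exists e, q.2; split=> //; apply: joins_sym; apply: runs_along_joins re.
have [l0|l0] := eqVneq l [::]; last exact: IH hl l0 z zl.
move: zl; rewrite l0 /= inE => /eqP->.
by exists e, p.2; split=> //; apply: runs_along_joins re.
Qed.

Lemma chain_values E (c : R -> S) (p : R * S) l : chain E c p l -> l != [::] ->
  forall z, z \in map snd (p :: l) -> exists s, c s = z.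
Proof.
elim: l p => [//|q l IH] p /= [pq [e Ee [_ _ _ cp cq]] hl] _ z; rewrite inE => /predU1P[->|zl].
  by exists p.1.
have [l0|l0] := eqVneq l [::]; last exact: IH hl l0 z zl.
by move: zl; rewrite l0 /= inE => /eqP->; exists q.1.
Qed.

Lemma disk_walk_chain E F v w : disk_walk R E F v w -> exists phi l,
  [/\ {within closed_disk R, continuous phi}, homeomorphism (open_disk R) F phi,
      chain E (phi \o @circle_point R) (0, v) l, l != [::] &
      (last (0, v) l).1 = 1 /\ map snd ((0, v) :: l) =i v :: w].
Proof.
move=> [phi [l [cphi hphi hl lastl ml]]]; exists phi, l; split=> //.
  by case: (l) lastl => //= -[/eqP]; rewrite eq_sym oner_eq0.
split; first by rewrite lastl.
by move=> z; rewrite /= ml !inE mem_rcons inE orbA orbb.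
Qed.

Lemma disk_walk_vertices G F v w : embedded_simple_graph R G ->
  disk_walk R (edges G) F v w -> forall z, z \in v :: w -> vertices G z.
Proof.
move=> hG /disk_walk_chain[phi [l [_ _ hl l0 [_ lw]]]] z; rewrite -lw => zl.
have [e [u [Ee j]]] := chain_joins hl l0 zl.
by have [] := joins_vertices hG Ee j.
Qed.

(** The image of the closed disk is compact, so it contains the closure of [F]. A vertex is not in
    [F], hence comes from the circle and lies on an edge of the walk; an edge meets the vertex set
    only at its ends. *)
Lemma disk_walk_closure_vertex G F v w z : embedded_simple_graph R G -> face G F ->
  disk_walk R (edges G) F v w -> closure F z -> vertices G z -> z \in v :: w.
Proof.
move=> hG fF /disk_walk_chain[phi [l [cphi [[fphi _ sphi] _ _] hl l0 [ll lw]]]] clz Vz.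
have cl : closed (phi @` closed_disk R).
  apply: compact_closed => //; apply: continuous_compact cphi _.
  exact: compact_closed_disk.
have : (phi @` closed_disk R) z.
  apply: cl; apply: closureS clz => y /sphi[p Dp <-]; exists p => //.
  exact: open_sub_closed_disk.
move=> [p /closed_disk_cases[Dp|[s /andP[s0 s1] ->]] pz].
  by case: (face_sub fF (fphi _ Dp)); rewrite pz; left.
have [|e [u [u' [Ee j ul vl ez]]]] := chain_cover (s := s) hl l0.
  by rewrite ll /= s0 ltW.
have [_ _ hz] := joins_vertices hG Ee j.
rewrite -lw; have [|->|->] := hz z _ Vz; by rewrite -?pz.
Qed.

(** A stop of the walk is approached radially from inside the disk. *)
Lemma disk_walk_closure G F v w z : disk_walk R (edges G) F v w ->
  z \in v :: w -> closure F z.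
Proof.
move=> /disk_walk_chain[phi [l [cphi [[fphi _ _] _ _] hl l0 [_ lw]]]]; rewrite -lw => zl.
have [s <-] := chain_values hl l0 zl; set p := circle_point s => N /= nN.
have /subspace_continuousP/(_ p (circle_point_closed_disk s) N nN) := cphi.
rewrite nbhs_simpl /within /= => nD.
have c1 : continuous (fun t : R => (t * p.1, t * p.2)).
  by apply: continuous_pairing => t; apply: cvgM; [exact: cvg_id|exact: cvg_cst|exact: cvg_id|exact: cvg_cst].
have : nbhs (1 : R) [set t | closed_disk R (t * p.1, t * p.2) -> N (phi (t * p.1, t * p.2))].
  have c11 : nbhs (1 * p.1, 1 * p.2) [set q | closed_disk R q -> N (phi q)].
    by rewrite !mul1r -surjective_pairing; exact: nD.
  by have := c1 1 _ c11.
move=> /nbhs_ballP[r /= r0 rN].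
(* Less than [r] to stay in the neighbourhood; positive and at most 1/2 to be strictly inside the
   disk. *)
pose d := Num.min (r / 2) (1 / 2); pose t := 1 - d.
have d0 : 0 < d by rewrite lt_min !divr_gt0.
have d1 : d <= 1 / 2 by rewrite ge_min lexx orbT.
have dr : d < r by rewrite gt_min; apply/orP; left; lra.
have tD : open_disk R (t * p.1, t * p.2).
  rewrite /open_disk /= !exprMn -mulrDr.
  by have := sqnorm_circle_point s; rewrite /sqnorm -/p => ->; rewrite mulr1 /t; nra.
exists (phi (t * p.1, t * p.2)); split; first exact: fphi.
apply: rN; last exact: open_sub_closed_disk.
by rewrite /ball /= /t subKr gtr0_norm.
Qed.

End Drawings.

(** * Refinements of a map inside a face *)

Section Refinements.
Variables (R : realType) (S : topologicalType).
Hypothesis S_surface : surface R S.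
Variables (G : drawing S) (F : set S).
Hypothesis F_face : face G F.

Let S_hausdorff : hausdorff_space S.
Proof. by have [] := S_surface. Qed.

Implicit Types (L : seq S) (es : seq (S * S)) (D : seq (set S * seq S)).

(* [G'] is [G] with [F] subdivided: [L] lists vertices of [G'] (at least those
   on the walks of the new faces), [es] the new edges by their ends, the first
   of which lies in [F], and [D] the new faces with their boundary walks. *)
Record refinement (G' : drawing S) L es D : Prop := Refinement {
  ref_embedded : embedded_simple_graph R G';
  ref_connected : connected_graph R G';
  ref_vertices : vertices G `<=` vertices G';
  ref_new_vertices : vertices G' `<=` vertices G `|` F;
  ref_edges : edges G `<=` edges G';
  ref_new_edges : forall e, edges G' e -> edges G e \/
    e `\` vertices G `<=` F /\ exists2 p, p \in es & joins R e p.1 p.2;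
  ref_es : forall p, p \in es ->
    [/\ adjacent R G' p.1 p.2, F p.1, p.1 \in L & p.2 \in L];
  ref_faces : forall K, face G' K <->
    (face G K /\ K <> F) \/ K \in map fst D;
  ref_uniq : uniq (map fst D);
  ref_walks : forall K w, (K, w) \in D -> [/\ K `<=` F, {subset w <= L} &
    exists v w', w = v :: w' /\ disk_walk R (edges G') K v w'];
  ref_labels : forall x, x \in L -> vertices G' x }.

(** The bookkeeping shared by chords and cones. *)
Lemma refine_cut G' G2 L L2 es es2 D1 H w D2 H1 H2 w1 w2 :
  refinement G' L es (D1 ++ (H, w) :: D2) ->
  embedded_simple_graph R G2 -> connected_graph R G2 ->
  vertices G' `<=` vertices G2 -> vertices G2 `<=` vertices G' `|` H ->
  edges G' `<=` edges G2 ->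
  (forall e, edges G2 e -> edges G' e \/
    e `\` vertices G `<=` F /\ exists2 p, p \in es2 & joins R e p.1 p.2) ->
  {subset es <= es2} -> {subset L <= L2} ->
  (forall p, p \in es2 -> p \in es \/
    [/\ adjacent R G2 p.1 p.2, F p.1, p.1 \in L2 & p.2 \in L2]) ->
  (forall x, x \in L2 -> vertices G2 x) ->
  (forall K, face G2 K <-> [\/ face G' K /\ K <> H, K = H1 | K = H2]) ->
  H1 `<=` H -> H2 `<=` H -> H1 !=set0 -> H2 !=set0 -> H1 `&` H2 = set0 ->
  {subset w1 <= L2} -> {subset w2 <= L2} ->
  (exists v w', w1 = v :: w' /\ disk_walk R (edges G2) H1 v w') ->
  (exists v w', w2 = v :: w' /\ disk_walk R (edges G2) H2 v w') ->
  refinement G2 L2 es2 (D1 ++ [:: (H1, w1), (H2, w2) & D2]).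
Proof.
move=> hG' emb2 con2 VV V2 EE E2 ee LL es2P L2P faces H1H H2H n1 n2 H12 w1L w2L dw1 dw2.
have HD : (H, w) \in D1 ++ (H, w) :: D2 by rewrite mem_cat mem_head orbT.
have [HF wL _] := ref_walks hG' HD.
have fH : face G' H.
  by apply/(ref_faces hG'); right; rewrite map_cat mem_cat mem_head orbT.
have uD := ref_uniq hG'; rewrite map_cat /= cat_uniq /= negb_or in uD.
have /and3P[u1 /andP[HM1 /hasPn M12] /andP[HM2 u2]] := uD.
(* A listed face equal to a part of [H] would meet [H], hence be [H], which occurs only once in the
   list. *)
have notin K : K `<=` H -> K !=set0 -> face G2 K -> K \notin map fst D1 /\ K \notin map fst D2.
  move=> KH [z Kz] _; split; apply/negP => KM.
    have fK : face G' K by apply/(ref_faces hG'); right; rewrite map_cat mem_cat KM.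
    by move: HM1; rewrite (face_eq fH fK (KH _ Kz) Kz) KM.
  have fK : face G' K.
    by apply/(ref_faces hG'); right; rewrite map_cat mem_cat /= inE KM !orbT.
  by move: HM2; rewrite (face_eq fH fK (KH _ Kz) Kz) KM.
have f1 : face G2 H1 by apply/faces; apply: Or32.
have f2 : face G2 H2 by apply/faces; apply: Or33.
have [h11 h12] := notin _ H1H n1 f1; have [h21 h22] := notin _ H2H n2 f2.
have H1n2 : H1 <> H2.
  by move=> E; have [z Hz] := n1; have : (H1 `&` H2) z by [split=> //; rewrite -E]; rewrite H12.
split=> //.
- by move=> x /(ref_vertices hG')/VV.
- by move=> x /V2[/(ref_new_vertices hG')//|/HF]; right.
- by move=> e /(ref_edges hG')/EE.
- move=> e /E2[/(ref_new_edges hG')[|[eF [p pe j]]]|]; [by left| |by right].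
  by right; split=> //; exists p => //; apply: ee.
- move=> p /es2P[/(ref_es hG')[a Fp p1 p2]|//]; split=> //; try exact: LL.
  exact: adjacent_sub a.
- move=> K; rewrite faces map_cat mem_cat /= !inE; split.
  + move=> [[/(ref_faces hG')[|]]|->|->]; rewrite ?eqxx ?orbT; try by right.
      by left.
    rewrite map_cat mem_cat /= inE => /or3P[-> _|/eqP->|-> _]; rewrite ?orbT //; by right.
  + move=> [[fK KF]|/or4P[KM|/eqP->|/eqP->|KM]].
    * apply: Or31; split; first by apply/(ref_faces hG'); left.
      move=> KH; apply: KF; have [z Hz] := face_nonempty fH.
      by apply: (face_eq fK F_face (x := z)); [rewrite KH|apply: HF].
    * apply: Or31; split; first by apply/(ref_faces hG'); right; rewrite map_cat mem_cat KM.
      by move=> E; move: HM1; rewrite -E KM.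
    * by apply: Or32.
    * by apply: Or33.
    * apply: Or31; split; first by apply/(ref_faces hG'); right; rewrite map_cat mem_cat /= inE KM !orbT.
      by move=> E; move: HM2; rewrite -E KM.
- rewrite map_cat cat_uniq /= u1 u2 !inE !negb_or h11 h12 h21 h22 !andbT /=.
  by apply/andP; split; [apply/hasPn|case: pselect].
- move=> K w'; rewrite mem_cat !inE => KD.
  have [KD'|[[-> ->]|[-> ->]]] : (K, w') \in D1 ++ (H, w) :: D2 \/
      ((K, w') = (H1, w1) \/ (K, w') = (H2, w2)).
    case/or4P: KD => [h|/eqP->|/eqP->|h]; [left|right; left|right; right|left] => //.
      by rewrite mem_cat h.
    by rewrite mem_cat inE h !orbT.
  + have [KF w'L [v [w2' [wE dw]]]] := ref_walks hG' KD'; split=> //.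
      by move=> x /w'L/LL.
    by exists v, w2'; split=> //; apply: disk_walk_sub dw.
  + by split=> //; apply: subset_trans HF.
  + by split=> //; apply: subset_trans HF.
Qed.

Lemma split_pairs D W1 w W2 : map snd D = W1 ++ w :: W2 -> exists D1 K D2,
  [/\ D = D1 ++ (K, w) :: D2, map snd D1 = W1 & map snd D2 = W2].
Proof.
elim: W1 D => [|w1 W1 IH] [|[K w'] D] //= [-> h]; first by exists [::], K, D.
by have [D1 [K' [D2 [-> <- <-]]]] := IH _ h; exists ((K, w1) :: D1), K', D2.
Qed.

(** The concrete [P] of the combinatorial part, with membership in [F] as [new]. *)
Definition realizable L es (Ws : seq (seq S)) : Prop :=
  exists G' D, refinement G' L es D /\ map snd D = Ws.

Lemma disk_walk_rot E (K : set S) v w k : disk_walk R E K v w ->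
  exists v' w', rot k (v :: w) = v' :: w' /\ disk_walk R E K v' w'.
Proof.
move=> dw; elim: k => [|k [v' [w' [rE dw']]]]; first by exists v, w; rewrite rot0.
have [kw|kw] := ltnP k (size (v :: w)); last by exists v, w; rewrite rot_oversize // ltnW.
rewrite rotS // rE; case: w' {rE} dw' => [|u w'] dw'; first by exists v', [::].
by exists u, (rcons w' v'); rewrite rot1_cons; split=> //; apply: disk_walk_rotate.
Qed.

Lemma realizable_rot L es W1 w W2 k : realizable L es (W1 ++ w :: W2) ->
  realizable L es (W1 ++ rot k w :: W2).
Proof.
move=> [G' [D [hG' /split_pairs[D1 [K [D2 [DE <- <-]]]]]]].
exists G', (D1 ++ (K, rot k w) :: D2); split; last by rewrite map_cat.
have fstE : map fst (D1 ++ (K, rot k w) :: D2) = map fst D by rewrite DE !map_cat.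
have hW := ref_walks hG'; case: hG' => *; split=> //; rewrite ?fstE //.
move=> K' w'; rewrite mem_cat inE => KD.
have [KD'|[-> ->]] : (K', w') \in D \/ (K' = K /\ w' = rot k w).
- rewrite DE; case/or3P: KD => [h|/eqP[-> ->]|h]; [left|by right|left].
    by rewrite mem_cat h.
  by rewrite mem_cat inE h !orbT.
- exact: hW.
- have [KF wL [v [w2 [wE dw]]]] : [/\ K `<=` F, {subset w <= L} &
      exists v w', w = v :: w' /\ disk_walk R (edges G') K v w'].
    by apply: hW; rewrite DE mem_cat mem_head orbT.
  split=> //; first by move=> x; rewrite mem_rot; apply: wL.
  by rewrite wE; have [v' [w3 [-> dw']]] := disk_walk_rot k dw; exists v', w3.
Qed.

Lemma face_diameter G' L es D1 H a p b q D2 :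
  refinement G' L es (D1 ++ (H, a :: p ++ b :: q) :: D2) -> a <> b ->
  exists phi lp lq,
    [/\ [/\ {within closed_disk R, continuous phi},
        homeomorphism (open_disk R) H phi &
        phi (1, 0) = a /\ phi (-1, 0) = b],
        [/\ face G' H, open H & H `<=` F],
        [/\ vertices G' a, vertices G' b, ~ H a & ~ H b] &
    [/\ chain (edges G') (phi \o @circle_point R) (0, a) (rcons lp (1 / 2, b)),
        chain (edges G') (phi \o @circle_point R) (1 / 2, b) lq,
        last (1 / 2, b) lq = (1, a), map snd lp = p & map snd lq = rcons q a]].
Proof.
move=> hG' ab; have hE := ref_embedded hG'.
have HD : (H, a :: p ++ b :: q) \in D1 ++ (H, a :: p ++ b :: q) :: D2.
  by rewrite mem_cat mem_head orbT.
have [HF wL [v [w' [[<- <-] dw]]]] := ref_walks hG' HD.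
have fH : face G' H by apply/(ref_faces hG'); right; rewrite map_cat mem_cat mem_head orbT.
have Vw := disk_walk_vertices S_hausdorff hE dw.
have Va : vertices G' a by apply: Vw; rewrite mem_head.
have Vb : vertices G' b by apply: Vw; rewrite inE mem_cat mem_head !orbT.
have nH z : vertices G' z -> ~ H z by move=> Vz /(face_sub fH); apply; left.
have [phi [lp [lq [cphi hphi hp hq [lastq mp mq]]]]] := disk_walk_split dw.
exists phi, lp, lq; split=> //.
- split=> //; split; first rewrite -(circle_point0 R).
    by case: (lp) hp => [|y l] /= [_ [e _ [_ _ _ <- _]] _].
  rewrite -(circle_point_half R).
  by case: (lq) hq mq => [_|y l /= [_ [e _ [_ _ _ <- _]] _] _] //; case: (q).
- by split=> //; exact: (face_open S_hausdorff S_surface hE fH).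
- by split=> //; apply: nH.
Qed.

Lemma realizable_chord L es W1 a p b q W2 :
  realizable L es (W1 ++ (a :: p ++ b :: q) :: W2) -> F a -> a != b ->
  (a, b) \notin es -> (b, a) \notin es ->
  realizable L ((a, b) :: es) (W1 ++ [:: a :: p ++ [:: b], [:: a, b & q] & W2]).
Proof.
move=> [G' [D [hG' /split_pairs[D1 [H [D2 [DE <- <-]]]]]]] Fa /eqP ab nab nba.
rewrite DE in hG'.
have [phi [lp [lq [[cphi hphi [phia phib]] [fH oH HF] [Va Vb Ha Hb]]]]] := face_diameter hG' ab.
move=> [hp hq lastq mp mq].
have hE := ref_embedded hG'.
have wL : {subset a :: p ++ b :: q <= L}.
  by have [] := ref_walks hG' (K := H) (w := a :: p ++ b :: q) _; rewrite ?mem_cat ?mem_head ?orbT.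
pose e := chord phi @` `[1 / 2, 1].
have half1 : 1 / 2 < 1 :> R by lra.
have run1 : runs_along (1 / 2) 1 (chord phi) e b a.
  have := chord_runs cphi hphi phia phib Ha Hb ab (lexx (1 / 2)) half1 (lexx 1).
  by rewrite (chord_endh phib) (chord_end1 phia).
have run2 : runs_along 0 (1 / 2) (chord phi) e a b.
  have := chord_runs_back cphi hphi phia phib Ha Hb ab (lexx (1 / 2)) half1 (lexx 1).
  rewrite (chord_endh phib) (chord_end1 phia).
  by rewrite subrr (_ : 1 - 1 / 2 = 1 / 2 :> R) //; field.
have je : joins R e a b by apply: joins_sym; apply: runs_along_joins run1.
have eP z : e z -> [\/ z = a, z = b | exists2 s, 1 / 2 < s < 1 & z = chord phi s].
  move=> [s /=]; rewrite in_itv /= => /andP[]; rewrite !le_eqVlt => /predU1P[<- _ <-|s0].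
    by apply: Or32; exact: chord_endh.
  move=> /predU1P[->|s1] <-; first by apply: Or31; exact: chord_end1.
  by apply: Or33; exists s; rewrite ?s0.
have eH z : e z -> [\/ z = a, z = b | H z].
  move=> /eP[->|->|[s s01 ->]]; [exact: Or31|exact: Or32|apply: Or33].
  exact (chord_sub hphi s01).
(* An edge of [G] cannot contain [a], which is in [F]; the ends of a new edge are listed in [es],
   where both orders are excluded. *)
have nadj : ~ adjacent R G' a b.
  move=> [e' Ee' j']; have [e'a e'b _] := joins_ends j'.
  have [E|[_ [pr prin jp]]] := ref_new_edges hG' Ee'.
    by apply: (face_sub F_face Fa); apply: edge_graph_points E _ e'a.
  have [[aE bE]|[aE bE]] := joins_unique S_hausdorff j' jp.
    by move: nab; rewrite aE bE -surjective_pairing prin.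
  by move: nba; rewrite aE bE -surjective_pairing prin.
pose G2 := add_edge G' e.
have EE : edges G' `<=` edges G2 by move=> e' ?; left.
have E2e : edges G2 e by right.
exists G2, (D1 ++ [:: (half_face phi 1, a :: p ++ [:: b]), (half_face phi (-1), [:: a, b & q]) & D2]).
split; last by rewrite map_cat.
have pm1 : (1 : R) = 1 \/ (1 : R) = -1 by left.
have pmN1 : (-1 : R) = 1 \/ (-1 : R) = -1 by right.
have halfA (r : R) : half_face phi r `&` e = set0.
  rewrite -subset0 => z [hz /eP[zE|zE|[s s01 zE]]].
  - by apply: Ha; rewrite -zE; apply: (half_face_sub hphi hz).
  - by apply: Hb; rewrite -zE; apply: (half_face_sub hphi hz).
  - by apply: (chord_half_face hphi s01 (e := r)); rewrite -zE.
apply: (refine_cut hG').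
- apply: (embedded_add_edge S_hausdorff hE Va Vb je) => // z /eH[->|->|Hz]; [by left|by right|].
  by move=> /(face_sub fH Hz).
- exact: connected_graph_sub (ref_connected hG').
- by [].
- by move=> z; left.
- exact: EE.
- move=> e' [|->]; [by left|right]; split; last by exists (a, b); rewrite ?mem_head.
  move=> z [ez nV]; case: (eH _ ez) => [zE|zE|/HF//]; rewrite zE in nV *; first exact: Fa.
  by have [] := ref_new_vertices hG' Vb.
- by move=> pr pin; rewrite inE pin orbT.
- by [].
- move=> pr; rewrite inE => /predU1P[->|]; [right|by left]; split=> //=.
  + by exists e.
  + by apply: wL; rewrite mem_head.
  + by apply: wL; rewrite inE mem_cat mem_head !orbT.
- by move=> x xL; exact: (ref_labels hG' xL).
- apply: (face_cut (A := e)) => //.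
  + exact: graph_points_add_edge.
  + exact: (half_face_open hphi _ oH).
  + exact: (half_face_open hphi _ oH).
  + exact: (half_face_connected cphi hphi pm1).
  + exact: (half_face_connected cphi hphi pmN1).
  + exact: half_face_nonempty.
  + exact: half_face_nonempty.
  + exact: half_face_disjoint hphi.
  + exact: (half_face_sub hphi).
  + exact: (half_face_sub hphi).
  + move=> z /(face_halves hphi)[?|?|[s /andP[s0 s1] ->]]; [by left; left|by left; right|right].
    by exists s; rewrite //= in_itv /= !ltW.
  + by move=> z /eH[->|->|Hz]; [left; left|left; left|right].
- exact: (half_face_sub hphi).
- exact: (half_face_sub hphi).
- exact: half_face_nonempty.
- exact: half_face_nonempty.
- exact: half_face_disjoint hphi.
- move=> z; rewrite inE mem_cat mem_seq1 => zin; apply: wL; rewrite inE mem_cat inE.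
  by case/or3P: zin => ->; rewrite ?orbT.
- move=> z; rewrite !inE => zin; apply: wL; rewrite inE mem_cat inE.
  by case/or3P: zin => ->; rewrite ?orbT.
- exists a, (p ++ [:: b]); split=> //; rewrite -mp.
  apply: (upper_walk cphi hphi EE hp (lc := [:: (1, a)]) (w := [::])) => //=.
  by split=> //; exists e.
- exists a, (b :: q); split=> //.
  apply: (lower_walk cphi hphi EE (lc := [::]) _ hq lastq mq) => //=.
  by split; [lra|exists e|].
Qed.

Lemma realizable_cone L es W1 a p b q W2 :
  realizable L es (W1 ++ (a :: p ++ b :: q) :: W2) -> a != b ->
  exists x, [/\ x \notin L, F x &
    realizable (x :: L) [:: (x, a), (x, b) & es]
      (W1 ++ [:: a :: p ++ [:: b; x], [:: a, x, b & q] & W2])].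
Proof.
move=> [G' [D [hG' /split_pairs[D1 [H [D2 [DE <- <-]]]]]]] /eqP ab.
rewrite DE in hG'.
have [phi [lp [lq [[cphi hphi [phia phib]] [fH oH HF] [Va Vb Ha Hb]]]]] := face_diameter hG' ab.
move=> [hp hq lastq mp mq].
have hE := ref_embedded hG'.
have wL : {subset a :: p ++ b :: q <= L}.
  by have [] := ref_walks hG' (K := H) (w := a :: p ++ b :: q) _; rewrite ?mem_cat ?mem_head ?orbT.
(* The image of the centre of the disk. Seen from the upper half, [e1] and [e2] occupy the times
   between 1/2, 3/4 and 1; from the lower half, [e2] comes first, up to time 1/4. *)
pose x := chord phi (3 / 4).
pose e1 := chord phi @` `[1 / 2, 3 / 4]; pose e2 := chord phi @` `[3 / 4, 1].
have Hx : H x by refine (chord_sub hphi _); apply/andP; split; lra.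
have nx : ~ graph_points G' x by exact: face_sub fH _ Hx.
have xa : x <> a by move=> E; apply: Ha; rewrite -E.
have xb : x <> b by move=> E; apply: Hb; rewrite -E.
have l1 : 1 / 2 < 3 / 4 :> R by lra.
have l2 : 3 / 4 < 1 :> R by lra.
have q34 : 1 - 3 / 4 = 1 / 4 :> R by field.
have q12 : 1 - 1 / 2 = 1 / 2 :> R by field.
have runs := chord_runs cphi hphi phia phib Ha Hb ab.
have runs_back := chord_runs_back cphi hphi phia phib Ha Hb ab.
have run1 : runs_along (1 / 2) (3 / 4) (chord phi) e1 b x.
  by have := runs _ _ (lexx _) l1 (ltW l2); rewrite (chord_endh phib).
have run2 : runs_along (3 / 4) 1 (chord phi) e2 x a.
  by have := runs _ _ (ltW l1) l2 (lexx _); rewrite (chord_end1 phia).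
have run3 : runs_along 0 (1 / 4) (chord phi) e2 a x.
  by have := runs_back _ _ (ltW l1) l2 (lexx _); rewrite (chord_end1 phia) subrr q34.
have run4 : runs_along (1 / 4) (1 / 2) (chord phi) e1 x b.
  by have := runs_back _ _ (lexx _) l1 (ltW l2); rewrite (chord_endh phib) q34 q12.
have j1 : joins R e1 b x by apply: runs_along_joins run1.
have j2 : joins R e2 x a by apply: runs_along_joins run2.
have e1P z : e1 z -> z = b \/ exists2 s, 1 / 2 < s <= 3 / 4 & z = chord phi s.
  move=> [s /=]; rewrite in_itv /= => /andP[]; rewrite le_eqVlt => /predU1P[<- _ <-|s0 s1 <-].
    by left; exact: chord_endh.
  by right; exists s; rewrite ?s0.
have e2P z : e2 z -> z = a \/ exists2 s, 3 / 4 <= s < 1 & z = chord phi s.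
  move=> [s /=]; rewrite in_itv /= => /andP[s0]; rewrite le_eqVlt => /predU1P[-> <-|s1 <-].
    by left; exact: chord_end1.
  by right; exists s; rewrite ?s0.
have eP z : e1 z \/ e2 z -> [\/ z = a, z = b | exists2 s, 1 / 2 < s < 1 & z = chord phi s].
  move=> [/e1P[->|[s /andP[s0 s1] ->]]|/e2P[->|[s /andP[s0 s1] ->]]];
    [exact: Or32|apply: Or33; exists s|exact: Or31|apply: Or33; exists s] => //; lra.
have eH z : e1 z \/ e2 z -> [\/ z = a, z = b | H z].
  move=> /eP[->|->|[s s01 ->]]; [exact: Or31|exact: Or32|apply: Or33].
  exact (chord_sub hphi s01).
have nadj1 : ~ adjacent R (add_vertex G' x) b x.
  move=> [e' Ee' j']; have [_ e'x _] := joins_ends j'.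
  by apply: nx; exact (edge_graph_points (G := G') Ee' e'x).
have nadj2 : ~ adjacent R (add_edge (add_vertex G' x) e1) x a.
  move=> [e' [Ee'|->] j']; have [e'x e'a _] := joins_ends j'.
    by apply: nx; exact (edge_graph_points (G := G') Ee' e'x).
  have [[xE _]|[_ aE]] := joins_unique S_hausdorff j' j1.
    exact: xb.
  exact: ab.
(* The edges are added one at a time: after the first, [x] is a pendant vertex and the graph is
   connected; the second then joins two existing vertices. *)
have emb1 : embedded_simple_graph R (add_edge (add_vertex G' x) e1).
  apply: (embedded_add_edge S_hausdorff (embedded_add_vertex hE nx) _ _ j1) => //; [by left|by right|].
  rewrite graph_points_add_vertex => z /e1P[->|[s /andP[s0 s1] zE]]; first by left.
  move=> [/(face_sub fH)|->]; last by right.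
  by case; rewrite zE; refine (chord_sub hphi _); apply/andP; split; lra.
pose G2 := add_edge (add_edge (add_vertex G' x) e1) e2.
have emb2 : embedded_simple_graph R G2.
  apply: (embedded_add_edge S_hausdorff emb1 _ _ j2) => //; [by right|by left|].
  rewrite graph_points_add_edge graph_points_add_vertex.
  move=> z /e2P[->|[s /andP[s0 s1] zE]]; first by right.
  have s01 : 1 / 2 < s < 1 by apply/andP; split; lra.
  move=> [[/(face_sub fH)|->]|/e1P[zb|[s' /andP[s0' s1'] zE']]]; last 2 first.
  - by case: Hb; rewrite -zb zE; exact (chord_sub hphi s01).
  - left; rewrite zE /x; congr (chord phi _).
    have : s = s'.
      apply: (chord_inj hphi phia phib Ha Hb ab); last by rewrite -zE zE'.
        by apply/andP; split; lra.
      by apply/andP; split; lra.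
    by move=> E; apply/eqP; rewrite eq_le s0 E s1'.
  - by case; rewrite zE; exact (chord_sub hphi s01).
  - by left.
have EE : edges G' `<=` edges G2 by move=> e' ?; left; left.
have E1 : edges G2 e1 by left; right.
have E2 : edges G2 e2 by right.
exists x; split; [|exact: HF|].
  by apply/negP => /(ref_labels hG') Vx; apply: nx; left.
exists G2, (D1 ++ [:: (half_face phi 1, a :: p ++ [:: b; x]),
  (half_face phi (-1), [:: a, x, b & q]) & D2]).
split; last by rewrite map_cat.
have pm1 : (1 : R) = 1 \/ (1 : R) = -1 by left.
have pmN1 : (-1 : R) = 1 \/ (-1 : R) = -1 by right.
have e1x : e1 x by exists (3 / 4) => //=; rewrite in_itv /= lexx ltW.
have halfA (r : R) : half_face phi r `&` ([set x] `|` e1 `|` e2) = set0.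
  rewrite -subset0 => z [hz zA].
  have /eP[zE|zE|[s s01 zE]] : e1 z \/ e2 z.
  - by case: zA => [[->|]|]; [left|left|right].
  - by apply: Ha; rewrite -zE; apply: (half_face_sub hphi hz).
  - by apply: Hb; rewrite -zE; apply: (half_face_sub hphi hz).
  - by apply: (chord_half_face hphi s01 (e := r)); rewrite -zE.
have old_or_F z : e1 z \/ e2 z -> ~ vertices G z -> F z.
  move=> /eH[->|->|/HF//]; first by have [] := ref_new_vertices hG' Va.
  by have [] := ref_new_vertices hG' Vb.
apply: (refine_cut hG').
- exact: emb2.
- apply: (@connected_graph_sub _ _ (add_edge (add_vertex G' x) e1)) => //; first by move=> e' ?; left.
  exact: connected_graph_pendant (ref_connected hG') Vb j1.
- by move=> z; left.
- by move=> z [|->]; [left|right].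
- exact: EE.
- move=> e' [[|->]|->]; [by left|right|right].
    split; first by move=> z [ez nV]; apply: old_or_F nV; left.
    by exists (x, b); [rewrite !inE eqxx orbT|apply: joins_sym].
  split; first by move=> z [ez nV]; apply: old_or_F nV; right.
  by exists (x, a); [rewrite !inE eqxx|].
- by move=> pr pin; rewrite !inE pin !orbT.
- by move=> z zL; rewrite inE zL orbT.
- have aL : a \in x :: L by rewrite inE wL ?orbT // mem_head.
  have bL : b \in x :: L by rewrite inE wL ?orbT // inE mem_cat mem_head !orbT.
  move=> pr; rewrite !inE => /or3P[/eqP->|/eqP->|]; [right|right|by left]; split=> //=.
  + by exists e2.
  + exact: HF.
  + exact: mem_head.
  + by exists e1 => //; apply: joins_sym.
  + exact: HF.
  + exact: mem_head.
- by move=> z; rewrite inE => /predU1P[->|/(ref_labels hG')]; [right|left].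
- apply: (face_cut (A := [set x] `|` e1 `|` e2)) => //.
  + by rewrite !graph_points_add_edge graph_points_add_vertex !setUA.
  + exact: (half_face_open hphi _ oH).
  + exact: (half_face_open hphi _ oH).
  + exact: (half_face_connected cphi hphi pm1).
  + exact: (half_face_connected cphi hphi pmN1).
  + exact: half_face_nonempty.
  + exact: half_face_nonempty.
  + exact: half_face_disjoint hphi.
  + exact: (half_face_sub hphi).
  + exact: (half_face_sub hphi).
  + move=> z /(face_halves hphi)[?|?|[s /andP[s0 s1] ->]]; [by left; left|by left; right|right].
    have [s34|s34] := leP s (3 / 4); [left; right|right]; exists s; rewrite //= in_itv /=.
      by rewrite s34 ltW.
    by rewrite !ltW.
  + move=> z zA; have /eH[->|->|Hz] : e1 z \/ e2 z by case: zA => [[->|]|]; [left|left|right].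
    * by left; left.
    * by left; left.
    * by right.
- exact: (half_face_sub hphi).
- exact: (half_face_sub hphi).
- exact: half_face_nonempty.
- exact: half_face_nonempty.
- exact: half_face_disjoint hphi.
- move=> z; rewrite !in_cons mem_cat !inE => zin; rewrite orbC; apply/orP.
  case/or4P: zin => h; [left|left|left|by right]; apply: wL;
  by rewrite in_cons mem_cat in_cons h ?orbT.
- move=> z; rewrite !inE => zin; rewrite orbC; apply/orP.
  case/or4P: zin => h; [left|by right|left|left]; apply: wL;
  by rewrite in_cons mem_cat in_cons h ?orbT.
- exists a, (p ++ [:: b; x]); split=> //; rewrite -mp.
  apply: (upper_walk cphi hphi EE hp (lc := [:: (3 / 4, x); (1, a)]) (w := [:: x])) => //=.
  by split=> //; [exists e1|split=> //; exists e2].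
- exists a, [:: x, b & q]; split=> //.
  apply: (lower_walk cphi hphi EE (lc := [:: (1 / 4, x)]) _ hq lastq mq) => //=.
  by split; [lra|exists e2|split; [lra|exists e1|]].
Qed.

End Refinements.

(** * Open disks are simply connected *)

Section DiskSimplyConnected.
Variable R : realType.
Implicit Types (p q : R * R) (t : R).

Definition segment_point q (z : (R * R) * R) : R * R :=
  (z.1.1 + z.2 * (q.1 - z.1.1), z.1.2 + z.2 * (q.2 - z.1.2)).

Lemma continuous_segment_point q : continuous (segment_point q).
Proof.
have c1 : continuous (fun z : (R * R) * R => z.1.1).
  by move=> z; apply: (continuous_comp (f := fst) (g := fst)); [exact: cvg_fst|exact: cvg_fst].
have c2 : continuous (fun z : (R * R) * R => z.1.2).
  by move=> z; apply: (continuous_comp (f := fst) (g := snd)); [exact: cvg_fst|exact: cvg_snd].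
have c3 : continuous (fun z : (R * R) * R => z.2) by move=> z; exact: cvg_snd.
apply: continuous_pairing => z; (apply: cvgD; [by [exact: c1|exact: c2]|]);
  apply: cvgM; [exact: c3| |exact: c3|];
  by apply: cvgB; [exact: cvg_cst|by [exact: c1|exact: c2]].
Qed.

Lemma segment_point_disk q p t : open_disk R p -> open_disk R q -> 0 <= t <= 1 ->
  open_disk R (segment_point q (p, t)).
Proof.
case: p => a b; case: q => c d; rewrite /open_disk /segment_point /= => ab cd /andP[t0 t1].
have h : 0 <= t * (1 - t) * ((c - a) ^+ 2 + (d - b) ^+ 2).
  by rewrite !mulr_ge0 ?subr_ge0 // addr_ge0 ?sqr_ge0.
(* The convexity identity for the squared norm. At least one of the weights [1 - t] and [t] is
   positive, which makes the inequality strict. *)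
have -> : (a + t * (c - a)) ^+ 2 + (b + t * (d - b)) ^+ 2 =
   (1 - t) * (a ^+ 2 + b ^+ 2) + t * (c ^+ 2 + d ^+ 2) -
   t * (1 - t) * ((c - a) ^+ 2 + (d - b) ^+ 2) by ring.
move: h ab cd; set A := _ + b ^+ 2; set C := _ + d ^+ 2; set B := _ * _ => h ab cd.
have h1 : 0 <= (1 - t) * (1 - A) by rewrite mulr_ge0 ?subr_ge0 // ltW.
have h2 : 0 <= t * (1 - C) by rewrite mulr_ge0 ?subr_ge0 // ltW.
have [t2|t2] := leP t (1 / 2).
  have : 0 < (1 - t) * (1 - A) by rewrite mulr_gt0 ?subr_gt0 //; lra.
  by lra.
have : 0 < t * (1 - C) by rewrite mulr_gt0 ?subr_gt0 //; lra.
by lra.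
Qed.

(** Straight segments of the disk, carried over by [f], join points and contract a loop towards its
    base point, which stays fixed. *)
Lemma disk_simply_connected (S : topologicalType) (A : set S) (f : R * R -> S) :
  homeomorphism (open_disk R) A f -> simply_connected R A.
Proof.
move=> [[ff _ sf] cf [g cg gf]].
have fg y : A y -> f (g y) = y by move=> /sf[p Dp <-]; rewrite gf.
have Dg y : A y -> open_disk R (g y) by move=> /sf[p Dp <-]; rewrite gf.
have i0 : unit_interval R 0 by apply/in_unit_interval; rewrite lexx ler01.
have i1 : unit_interval R 1 by apply/in_unit_interval; rewrite lexx ler01.
split.
- exists (f (0, 0)); apply: ff.
  by rewrite /open_disk /= expr0n /= addr0 ltr01.
- move=> x y Ax Ay; exists (fun t => f (segment_point (g y) (g x, t))); split.
  + split.
      apply: (within_continuous_comp (f := fun t : R => segment_point (g y) (g x, t)) _ cf).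
        apply: continuous_subspaceT => t.
        apply: (continuous_comp (f := fun t : R => (g x, t))); last exact: continuous_segment_point.
        by apply: continuous_pairing; [move=> s; exact: cvg_cst|move=> s; exact: cvg_id].
      by move=> t /in_unit_interval; apply: segment_point_disk; apply: Dg.
    by move=> t /in_unit_interval t01; apply: ff; apply: segment_point_disk t01; apply: Dg.
  + by rewrite /segment_point /= !mul0r !addr0 -surjective_pairing fg.
  + by rewrite /segment_point /= !mul1r !subrKC -surjective_pairing fg.
- move=> c [cc cA] c01.
  exists (fun z => f (segment_point (g (c 0)) (g (c z.1), z.2))); split.
  + apply: (@within_continuous_comp _ _ _ _ (open_disk R) (fun z : R * R => segment_point (g (c 0)) (g (c z.1), z.2))) => //.
      apply: (@within_continuous_comp _ _ _ _ setT (fun z : R * R => (g (c z.1), z.2))) => //.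
        apply: (@continuous_pairing (subspace (unit_interval R `*` unit_interval R))).
          apply: (@within_continuous_comp _ _ _ _ (unit_interval R) fst (g \o c)).
          - by apply: continuous_subspaceT; exact: continuous_fst2.
          - exact: within_continuous_comp cc cg cA.
          - by move=> z [].
        by apply: continuous_subspaceT; exact: continuous_snd2.
      by apply: continuous_subspaceT; exact: continuous_segment_point.
    move=> [s t] [/= s01 /in_unit_interval t01].
    by apply: segment_point_disk t01; apply: Dg; apply: cA.
  + move=> s t s01 /in_unit_interval t01 /=.
    by apply: ff; apply: segment_point_disk t01; apply: Dg; apply: cA.
  + move=> s s01; rewrite /segment_point /= !mul0r !addr0 -surjective_pairing fg //.
    exact: cA.
  + move=> s s01; rewrite /segment_point /= !mul1r !subrKC -surjective_pairing fg //.
    exact: cA.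
  + move=> t t01; rewrite -c01 /segment_point /= !subrr !mulr0 !addr0 -surjective_pairing fg //.
    exact: cA.
Qed.

End DiskSimplyConnected.

(** * The interior of the new part *)

Section Interior.
Variables (R : realType) (S : topologicalType).
Hypothesis S_surface : surface R S.
Variables (G G' : drawing S) (F : set S).
Hypothesis G_embedded : embedded_simple_graph R G.
Hypothesis G_connected : connected_graph R G.
Hypothesis F_face : face G F.
Hypothesis two_vertices : exists u v, [/\ vertices G u, vertices G v & u <> v].
Hypothesis G'_replaces : replaces_interior G F G'.

Let S_hausdorff : hausdorff_space S.
Proof. by have [] := S_surface. Qed.

(** In a connected graph with a second vertex, a path to it must leave [v] along an edge. *)
Lemma vertex_edge v : vertices G v -> exists e u, edges G e /\ joins R e v u.
Proof.
move=> Vv; have [u [u' [Vu Vu' uu']]] := two_vertices.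
have [w [Vw vw]] : exists w, vertices G w /\ v <> w.
  have [E|ne] := pselect (v = u); last by exists u.
  by exists u'; split=> // E'; apply: uu'; rewrite -E.
have [_ /(_ v w Vv Vw)/Operators_Properties.clos_rt_rt1n_iff h] := G_connected.
case: h vw => [//|x y [e Ee j] _ _].
by exists e, x.
Qed.

(** Outside [F] the new part has only old vertices, the ends of new edges. Such a vertex is not
    interior: an edge of [G] leaves it through points which are neither in [F] nor vertices.
    Conversely [F] is open and covered by the new part. *)
Lemma interior_new_part : (new_part G G')^° = F.
Proof.
have [[VV EE] faces nV nE nF] := G'_replaces.
have oF := face_open S_hausdorff S_surface G_embedded F_face.
have sub : new_part G G' `<=` F `|` vertices G.
  move=> z [[/nV|[e he ez]]|[K /nF KF /KF]]; [by left| |by left].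
  by have [Vz|nVz] := pselect (vertices G z); [right|left; apply: (nE _ he)].
apply/seteqP; split=> [z|z Fz].
- move=> nz; have [//|Vz] := sub _ (nbhs_singleton nz).
  have [e [u [Ee [c [cc ic ce c0 c1]]]]] := vertex_edge Vz.
  have i01 : `[0, 1]%classic (0 : R) by rewrite /= in_itv /= lexx ler01.
  have nz' : nbhs (c 0) (new_part G G') by rewrite c0.
  have /subspace_continuousP/(_ 0 i01 _ nz') := cc.
  rewrite nbhs_simpl /within /= => /nbhs_ballP[r /= r0 rN].
  (* Small enough for the neighbourhood, but strictly between 0 and 1, so that [c t] is not an end
     of the edge. *)
  pose t := Num.min (r / 2) (1 / 2).
  have t0 : 0 < t by rewrite lt_min !divr_gt0.
  have t1 : t <= 1 / 2 by rewrite ge_min lexx orbT.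
  have tr : t < r by rewrite gt_min; apply/orP; left; lra.
  have t01 : `[0, 1]%classic t by rewrite /= in_itv /= ltW //=; lra.
  have : new_part G G' (c t).
    by apply: rN t01; rewrite /ball /= sub0r normrN gtr0_norm.
  have ect : e (c t) by rewrite -ce; exists t.
  move=> /sub[/(face_sub F_face)|Vc]; first by case; apply: edge_graph_points Ee _ ect.
  have j : joins R e z u by exists c.
  have [_ _ /(_ _ ect Vc)] := joins_vertices S_hausdorff G_embedded Ee j.
  have i1 : `[0, 1]%classic (1 : R) by rewrite /= in_itv /= lexx ler01.
  rewrite -c0 -c1 => -[] /ic; rewrite !inE => h.
    by have := h t01 i01 => tE; move: t0; rewrite tE ltxx.
  by have := h t01 i1 => tE; move: t1; rewrite tE; lra.
- apply: (@filterS _ _ _ F); last exact: open_nbhs_nbhs.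
  move=> y Fy; have nG := face_sub F_face Fy.
  have [[Vy|[e Ee ey]]|ny] := pselect (graph_points G' y).
  + by left; left; split=> // Vy'; apply: nG; left.
  + left; right; exists e => //; split=> // Ee'; apply: nG.
    exact: edge_graph_points Ee' _ ey.
  (* If the face of [G'] around [y] were a face of [G], it would be [F], which is not a face of
     [G']. *)
  + right; set K := connected_component (~` graph_points G') y.
    have fK : face G' K by apply: component_face.
    have Ky : K y by apply: connected_component_refl.
    exists K => //; split=> // fGK.
    by have /(faces _ fGK) := fK; apply; apply: face_eq fGK F_face Ky Fy.
Qed.

End Interior.

Theorem theorem3 (R : realType) (S : topologicalType)
    (S_surface : surface R S)
    (G : drawing S) (G_map : is_map R G)
    (F : set S) (F_irreducible : irreducible_face R G F) :
  exists G' : drawing S,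
    [/\ is_map R G',
        replaces_interior G F G',
        forall H, new_faces G G' H -> three_face R G' H,
        forall e, new_edges G G' e -> noncontractible R G' e &
        simply_connected R (new_part G G')^°].
Proof.
have [S_hausdorff _ _] := S_surface.
have [G_emb G_con G_faces] := G_map.
have [F_face [vs [bw vs4 adj2]]] := F_irreducible.
have [v [w vsE]] : exists v w, vs = v :: w by case: (vs) vs4 => // v w; exists v, w.
have dw : disk_walk R (edges G) F v w by apply/boundary_walkP; rewrite -vsE.
have adj1 x0 i : (i < size vs)%N -> adjacent R G (nth x0 vs i) (nth x0 vs (i.+1 %% size vs)).
  have [phi [t [_ _ _ tt /(_ x0 i) h]]] := bw => im.
  by have [e Ee re] := h im; exists e => //; apply: runs_along_joins (tt _ im) re.
have init : realizable R G F vs [::] [:: vs].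
  exists G, [:: (F, vs)]; split=> //; split=> //=.
  - by left.
  - move=> K; rewrite inE; split=> [fK|[[]//|/eqP->//]].
    by have [->|KF] := pselect (K = F); [right|left].
  - by move=> K w'; rewrite inE => /eqP[-> ->]; split=> //; exists v, w.
  - by move=> x; rewrite vsE; apply: (disk_walk_vertices S_hausdorff G_emb dw).
have cyc : cyclically_adjacent (adjacent R G) vs.
  by move=> x0 i im; split; [exact: adj1|have := adj2 x0 i im; rewrite addn2].
have adj_neq (x y : S) : adjacent R G x y -> x != y.
  by move=> /adjacent_neq xy; apply/eqP.
have [||L [es [Ws [[G' [D [hG' DW]]] es0 sz3 cert]]]] :=
  irreducible_filling (@adjacent_sym R S G) adj_neq
    (@realizable_rot R S G F) (@realizable_cone R S S_surface G F F_face)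
    (@realizable_chord R S S_surface G F F_face) _ _ cyc vs4 init.
- move=> L es Ws w' [G' [D [hG' <-]]] /mapP[[K w2] KD ->].
  by have [] := ref_walks hG' KD.
- move=> L es Ws e [G' [D [hG' _]]] ee.
  by have [] := ref_es hG' ee.
have [p0 p0es] : exists p, p \in es by case: (es) es0 => // p l _; exists p; rewrite mem_head.
have [/(adjacent_vertices S_hausdorff (ref_embedded hG'))[Vc _] Fc _ _] := ref_es hG' p0es.
(* The first end of a new edge is a vertex of [G'] lying in [F]. *)
have FnotG' : ~ face G' F by move=> /face_sub/(_ _ Fc); apply; left.
have newP K : K \in map fst D -> exists v w, [/\ [:: v & w] \in Ws, K `<=` F &
    disk_walk R (edges G') K v w].
  move=> /mapP[[K' w'] KD ->]; have [KF _ [v' [w2 [wE dw']]]] := ref_walks hG' KD.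
  by exists v', w2; split=> //; rewrite -wE -DW; apply/mapP; exists (K', w').
have new_inD K : new_faces G G' K -> K \in map fst D.
  by move=> [/(ref_faces hG')[[]|] //].
have G'_map : is_map R G'.
  split; [exact: ref_embedded hG'|exact: ref_connected hG'|].
  move=> K /(ref_faces hG')[[/G_faces //]|/newP[v' [w' [_ _ [phi [l [_ h _ _ _]]]]]]].
  by exists phi.
have rep : replaces_interior G F G'.
  split.
  - by split; [exact: ref_vertices hG'|exact: ref_edges hG'].
  - move=> H fH; split=> [fH' HF|HF]; first by apply: FnotG'; rewrite -HF.
    by apply/(ref_faces hG'); left.
  - by move=> z [/(ref_new_vertices hG')[]].
  - by move=> e [/(ref_new_edges hG')[|[]]].
  - by move=> K /new_inD/newP[v' [w' []]].
exists G'; split=> //.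
- move=> K nK; split; first by case: nK.
  have [v' [w' [wW _ dw']]] := newP _ (new_inD _ nK).
  by exists (v' :: w'); [apply/boundary_walkP|exact: sz3].
- move=> e [Ee nEe]; have [//|[_ [p pes j]]] := ref_new_edges hG' Ee.
  have [z [l1 l2 hz]] := cert _ pes; have [a12 Fp _ _] := ref_es hG' pes.
  have adjP x y : linked (adjacent R G) es x y -> adjacent R G' x y.
    move=> [|/(ref_es hG')[] //|/(ref_es hG')[a _ _ _]]; last exact: adjacent_sym a.
    by apply: adjacent_sub; exact: ref_edges hG'.
  exists p.1, p.2, z; split=> //.
    by split=> //; [exact: adjP|apply: adjacent_sym; exact: adjP].
  (* The supposed 3-face comes with its own parametrized walk, unrelated to the recorded one. The
     two are compared through the closure of the face, which depends on no parametrization. *)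
  move=> [K [vs' [fK bw' pvs]]].
  have [v' [w' vsE']] : exists v w, vs' = v :: w.
    by case: (vs') pvs => [/perm_size//|v' w' _]; exists v', w'.
  rewrite vsE' in bw' pvs; move/boundary_walkP in bw'.
  have hE := ref_embedded hG'.
  have clK x : x \in [:: p.1; p.2; z] -> closure K x.
    by rewrite -(perm_mem pvs); apply: (disk_walk_closure bw').
  (* An old face other than [F] is disjoint from the open set [F], so its closure misses [p.1]. The
     recorded walk of a new face would contain all three vertices, against the certificate. *)
  have /(ref_faces hG')[[fGK KF]|/newP[v2 [w2 [wW _ dw2]]]] := fK.
    have oF := face_open S_hausdorff S_surface G_emb F_face.
    have KF0 : K `&` F = set0.
      by rewrite -subset0 => y [Ky Fy]; apply: KF; apply: face_eq fGK F_face Ky Fy.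
    have : (closure K `&` F) p.1 by split=> //; apply: clK; rewrite mem_head.
    by rewrite (open_disjoint_closure oF KF0).
  have inw x : vertices G' x -> x \in [:: p.1; p.2; z] -> x \in v2 :: w2.
    by move=> Vx /clK cx; apply: (disk_walk_closure_vertex S_hausdorff hE fK dw2 cx Vx).
  have [V1 V2] := adjacent_vertices S_hausdorff hE a12.
  have [_ Vz] := adjacent_vertices S_hausdorff hE (adjP _ _ l1).
  apply: (hz (v2 :: w2) wW); apply: inw => //; by rewrite !inE eqxx ?orbT.
- rewrite (interior_new_part S_surface G_emb G_con F_face) //.
    by have [phi [l [_ h _ _ _]]] := dw; apply: disk_simply_connected h.
  have /adjacent_vertices := adj1 v 0%N (leq_trans (isT : (0 < 4)%N) vs4).
  have /adjacent_neq := adj1 v 0%N (leq_trans (isT : (0 < 4)%N) vs4).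
  move=> ne /(_ S_hausdorff G_emb)[? ?].
  by exists (nth v vs 0), (nth v vs (1 %% size vs)).
Qed.
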